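(* Let $M$ be a smooth Fréchet manifold modelled on a Fréchet space $F$, and let $\mathcal{B}$ be a bornology on $F$ that contains all compact subsets of $F$ and satisfies $T(\mathcal{B})\subset\mathcal{B}$ for every continuous linear endomorphism $T$ of $F$. Let $\mathbb{T}M = TM\oplus TM_{\mathcal{B}}'$ be the generalized tangent bundle of $M$ and let $\mathbb{D}\subset\mathbb{T}M$ be a Dirac structure. Then the restriction to $\Gamma(\mathbb{D})$ of the Courant bracket $$ \llbracket (X,\alpha),(Y,\beta)\rrbracket=\Bigl([X,Y],\ \mathcal{L}_X\beta-\mathcal{L}_Y\alpha+\tfrac12\,\mathrm{d}_{\mathrm{dR}}\bigl(\alpha(Y)-\beta(X)\bigr)\Bigr) $$ on $\Gamma(\mathbb{T}M)$ yields a Lie bracket $\llbracket\cdot,\cdot\rrbracket_{\mathbb{D}}$. Moreover, if $\mathrm{Pr}:\mathbb{D}\to TM$ denotes the restriction to $\mathbb{D}$ of the projection $\mathbb{T}M\to TM$, $(X,\alpha)\mapsto X$, then $(\mathbb{D},\llbracket\cdot,\cdot\rrbracket_{\mathbb{D}},\mathrm{Pr})$ is a Fréchet Lie algebroid over $M$.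
   Context: Smoothness is in the Michal–Bastiani sense: a continuous map $f:U\to F_2$, with $U$ open in $F_1$, is $C^1$ if all directional derivatives $\mathrm{d}f(x)(h)=\lim_{t\to0}\frac1t(f(x+th)-f(x))$ exist and $\mathrm{d}f:U\times F_1\to F_2$ is continuous; $C^k$ and $C^\infty$ are defined inductively. Manifolds, vector bundles, bundle maps and sections are smooth in this sense. A bornology $\mathcal{B}$ on $F$ is a family of bounded subsets covering $F$, directed upwards by inclusion, such that for all $B\in\mathcal{B}$ and $r\in\mathbb{R}$ there is $C\in\mathcal{B}$ with $rB\subset C$. $E'_{\mathcal{B}}$ is the continuous dual of $E$ with the topology of uniform convergence on the sets in $\mathcal{B}$. The $\mathcal{B}$-cotangent bundle is $TM_{\mathcal{B}}'=\bigcup_{x\in M}(T_xM)'_{\mathcal{B}}$; under the assumptions on $\mathcal{B}$ it is a vector bundle in the category of locally convex spaces with local model $F\times F'_{\mathcal{B}}$. A smooth $k$-form is a smooth section of $\bigwedge^k TM_{\mathcal{B}}'$, whose fiber at $x$ is the space of jointly continuous anti-symmetric $k$-linear maps $(T_xM)^k\to\mathbb{R}$. $\mathfrak{X}(M)$ is the Lie algebra of smooth vector fields with the usual bracket $[\cdot,\cdot]$; $\Gamma(L)$ is the space of smooth sections of a vector bundle $L$. $\imath_X$ is contraction with $X$ in the first slot. The de Rham differential is $$(\mathrm{d}_{\mathrm{dR}}\omega)(X_0,\dots,X_k)=\sum_{i}(-1)^iX_i(\omega(X_0,\dots,\hat X_i,\dots,X_k))+\sum_{i<j}(-1)^{i+j}\omega([X_i,X_j],X_0,\dots,\hat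 X_i,\dots,\hat X_j,\dots,X_k),$$ and the Lie derivative of forms is $\mathcal{L}_X=\mathrm{d}_{\mathrm{dR}}\circ\imath_X+\imath_X\circ\mathrm{d}_{\mathrm{dR}}$. On $\mathbb{T}M=TM\oplus TM_{\mathcal{B}}'$ consider the symmetric pairing $\langle (X,\alpha),(Y,\beta)\rangle=\alpha(Y)+\beta(X)$ and, on sections, the bracket $$[(X,\alpha),(Y,\beta)]_{\mathbb{T}M}=([X,Y],\ \mathcal{L}_X\beta-\imath_Y\mathrm{d}_{\mathrm{dR}}\alpha).$$ For a vector subbundle $\mathbb{L}\subset\mathbb{T}M$, $\mathbb{L}^\perp$ consists of the elements $(X,\alpha)$ of $\mathbb{T}M$ whose pairing with every element $(Y,\beta)$ of $\mathbb{L}$ vanishes. A Dirac structure is a vector subbundle $\mathbb{D}\subset\mathbb{T}M$ with $\mathbb{D}=\mathbb{D}^\perp$ that is closed under $[\cdot,\cdot]_{\mathbb{T}M}$. A Fréchet Lie algebroid over $M$ is a Fréchet vector bundle $\pi:L\to M$ together with a bracket $[\cdot,\cdot]_L$ on $\Gamma(L)$ and a bundle map $\lambda_L:L\to TM$ (the anchor) such that (1) the induced map $\lambda_L:(\Gamma(L),[\cdot,\cdot]_L)\to(\mathfrak{X}(M),[\cdot,\cdot])$, $(\lambda_L(s))(x)=\lambda_L(s(x))$, is a Lie algebra homomorphism, and (2) $[s_1,fs_2]_L=f[s_1,s_2]_L+\lambda_L(s_1)(f)\,s_2$ for all $f\in C^\infty(M)$, $s_1,s_2\in\Gamma(L)$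.
   Formalization: That D is a Fréchet vector bundle, hence a Fréchet Lie algebroid, is claimed only if the typical fibre of D is a Fréchet space (it fails for D = 0⊕TM'_B over M = R^N); the Lie bracket, anchor and Leibniz claims are made for every Dirac structure. *)

(* Defs.v *)
From HB Require Import structures.
From mathcomp Require Import all_boot all_order all_algebra.
From mathcomp Require Import all_classical all_reals all_analysis.

Set Implicit Arguments.
Unset Strict Implicit.
Unset Printing Implicit Defensive.

Import Order.TTheory GRing.Theory Num.Theory.
Import numFieldNormedType.Exports.

Local Open Scope classical_set_scope.
Local Open Scope ring_scope.

(* ** Fréchet spaces and bornologies *)

(* The uniform structure carried by a tvsType is only required to induce its
   topology, so completeness and metrizability are expressed through the
   neighbourhoods of 0. *)
Definition tvs_cauchy (R : realType) (E : tvsType R) (G : set_system E) :=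
  forall V : set E, nbhs 0 V ->
    exists2 A, G A & forall x y, A x -> A y -> V (x - y).

Definition frechet (R : realType) (E : tvsType R) :=
  [/\ hausdorff_space E,
      exists U : nat -> set E, (forall n, nbhs 0 (U n)) /\
        forall V : set E, nbhs 0 V -> exists n, U n `<=` V &
      forall G : set_system E, ProperFilter G -> tvs_cauchy G ->
        exists l : E, G --> l].

Definition tvs_bounded (R : realType) (E : tvsType R) (b : set E) :=
  forall V : set E, nbhs 0 V -> exists r : R, b `<=` ( *:%R r) @` V.

Record bornology (R : realType) (F : tvsType R) := Bornology {
  born_set :> set (set F) ;
  born_bounded : forall b, born_set b -> tvs_bounded b ;
  born_cover : forall x, exists2 b, born_set b & b x ;
  born_directed : forall b c, born_set b -> born_set c ->
    exists d, [/\ born_set d, b `<=` d & c `<=` d] ;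
  born_scale : forall b (r : R), born_set b ->
    exists2 c, born_set c & ( *:%R r) @` b `<=` c }.

(* ** The dual F'_B *)

Section Dual.
Context (R : realType) (F : tvsType R).

Definition dual_pred : {pred F -> R^o} :=
  fun f => `[< linear (f : F -> R^o) /\ continuous (f : F -> R^o) >].

Lemma dual_pred_submod : submod_closed dual_pred.
Proof.
split=> [|a f g /asboolP[lf cf] /asboolP[lg cg]]; apply/asboolP; split.
- by move=> a x y; rewrite /= /GRing.zero/= scaler0 addr0.
- by move=> x; exact: cvg_cst.
- move=> k x y; rewrite !fctE lf lg !scalerDr !scalerA addrACA.
  by rewrite [a * k]mulrC.
- by move=> x; apply: cvgD; [apply: cvgZr; exact: cf|exact: cg].
Qed.

HB.instance Definition _ := GRing.isSubmodClosed.Build _ _ dual_pred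
  dual_pred_submod.

Record dual (B : bornology F) := Dual {
  dual_fun :> F -> R^o ; _ : dual_fun \in dual_pred }.
End Dual.

Section DualTvs.
Context (R : realType) (F : tvsType R) (B : bornology F).
HB.instance Definition _ := [isSub for @dual_fun R F B].
HB.instance Definition _ := [Choice of dual B by <:].
HB.instance Definition _ := [SubChoice_isSubLmodule of dual B by <:].

(* topology of uniform convergence on the members of B *)
HB.instance Definition _ := Topological.copy (dual B)
  (initial_topology (@dual_fun R F B : _ -> {family (B : set (set F)), F -> R^o})).

Lemma dual_linear (f : dual B) : linear (f : F -> R^o).
Proof. by case: f => f /= /asboolP[]. Qed.

Lemma dual_continuous (f : dual B) : continuous (f : F -> R^o).
Proof. by case: f => f /= /asboolP[]. Qed.

Lemma nbhs_dual (f : dual B) (P : set (dual B)) :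
  nbhs f P <-> exists b, exists2 e : R, born_set B b /\ 0 < e &
    [set g : dual B | forall v, b v -> `|f v - g v| < e] `<=` P.
Proof.
split.
- pose G : set_system (dual B) := filter_from [set be | born_set B be.1 /\ (0 : R) < be.2]
    (fun be => [set g : dual B | forall v, be.1 v -> `|f v - g v| < be.2]).
  have FG : Filter G.
    apply: filter_from_filter.
      by have [b Bb _] := born_cover B 0; exists (b, 1) => /=; split.
    move=> [b e] [c d] /= [Bb e0] [Bc d0].
    have [a [Ba ba ca]] := born_directed Bb Bc.
    exists (a, Num.min e d) => /=; first by rewrite lt_min e0 d0.
    move=> g /= H; split => v /= Hv.
      by have := H v (ba _ Hv); rewrite lt_min => /andP[].
    by have := H v (ca _ Hv); rewrite lt_min => /andP[].
  have cG : {family (B : set (set F)), (@dual_fun R F B) @ G --> (f : F -> R^o)}.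
    apply/fam_cvgP => A BA Q /uniform_nbhs[E [entE EQ]].
    have := entE; rewrite -entourage_ballE => -[e /= e0 eE].
    exists (A, e) => //= g Hg; apply: EQ => /= v Av; apply: eE => /=.
    exact: Hg.
  case=> _ [[W oW <-] Wf WP].
  have [[b e] /= [Bb e0] H] : (@dual_fun R F B @ G) W.
    by apply: cG; apply: open_nbhs_nbhs.
  by exists b, e => // g Hg; apply: WP; exact: H.
- move=> [b [e [Bb e0] H]]; apply: filterS H _.
  pose E := [set xy : R^o * R^o | `|xy.1 - xy.2| < e].
  have entE : entourage E by rewrite -entourage_ballE; exists e.
  exact: (initial_continuous (fam_nbhs (f : {family _, _ -> _}) entE Bb)).
Qed.

Lemma dual0 (f : dual B) : f 0 = 0.
Proof.
by have := dual_linear f (-1) 0 0; rewrite scaler0 addr0 scaleN1r addNr.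
Qed.

Lemma dual_bound (f : dual B) b : born_set B b -> exists2 M, 0 < M &
  forall v, b v -> `|f v| <= M.
Proof.
move=> /born_bounded bb.
have V0 : nbhs (0 : F) [set v | `|f v| < 1].
  have := @dual_continuous f 0 [set y : R^o | `|y| < 1]; rewrite dual0; apply.
  by apply/nbhs_ballP; exists 1 => //= y; rewrite -ball_normE /= sub0r normrN.
have [r Hr] := bb _ V0; exists (`|r| + 1); first by rewrite ltr_wpDl.
move=> v /Hr [w /= fw <-].
have -> : f (r *: w) = r *: f w.
  by have := dual_linear f r w 0; rewrite addr0 dual0 addr0.
rewrite normrZ; apply: le_trans (_ : `|r| <= _); last by rewrite lerDl.
by rewrite ler_piMr // ltW.
Qed.

Lemma dual_add_continuous : continuous (fun x : dual B * dual B => x.1 + x.2).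
Proof.
move=> [f g] P /nbhs_dual[b [e [Bb e0] H]].
have nb (h : dual B) : nbhs h [set k : dual B | forall v, b v -> `|h v - k v| < e / 2].
  by apply/nbhs_dual; exists b, (e / 2); rewrite ?divr_gt0.
eexists (_, _) => /=; first by split; [exact: (nb f)|exact: (nb g)].
move=> [f' g'] /= [Hf Hg]; apply: H => v bv /=.
rewrite !fctE opprD addrACA (le_lt_trans (ler_normD _ _))// [ltRHS](splitr e).
by rewrite ltrD // ?Hf ?Hg.
Qed.

Lemma dual_scale_continuous : continuous (fun z : R^o * dual B => z.1 *: z.2).
Proof.
move=> [k f] P /nbhs_dual[b [e [Bb e0] H]].
have [M M0 HM] := dual_bound f Bb.
have k0 : 0 < `|k| + 1 by rewrite ltr_wpDl.
pose d := Num.min 1 (e / 2 / M).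
have d0 : 0 < d by rewrite lt_min ltr01 /= !divr_gt0.
pose c := e / 2 / (`|k| + 1).
have c0 : 0 < c by rewrite !divr_gt0.
exists ([set l : R^o | `|k - l| < d],
  [set g : dual B | forall v, b v -> `|f v - g v| < c]) => /=.
  split; last by apply/nbhs_dual; exists b, c.
  by apply/nbhs_ballP; exists d => //= l; rewrite -ball_normE.
move=> [l g] /= [Hl Hg]; apply: H => v bv /=.
rewrite !fctE.
have -> : k *: f v - l *: g v = (k - l) *: f v + l *: (f v - g v).
  by rewrite scalerBl scalerBr addrA subrK.
rewrite (le_lt_trans (ler_normD _ _))// [ltRHS](splitr e).
move: Hl; rewrite lt_min => /andP[Hl1 Hl2].
apply: ltr_leD.
  rewrite normrZ (le_lt_trans (_ : _ <= `|k - l| * M)) //.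
    by rewrite ler_wpM2l ?HM.
  by rewrite -ltr_pdivlMr.
rewrite normrZ; have lk : `|l| <= `|k| + 1.
  rewrite -[l](subKr k) (le_trans (ler_normB _ _))// lerD2l.
  exact: ltW.
rewrite (le_trans (_ : _ <= (`|k| + 1) * c)) //.
  by apply: ler_pM => //; rewrite ltW // Hg.
by rewrite /c mulrC divfK // gt_eqF.
Qed.

Lemma dual_locally_convex : exists2 U : set_system (dual B),
  (forall u, u \in U -> convex_set u) & basis U.
Proof.
pose C (f : dual B) b (e : R) : set (dual B) :=
  [set g : dual B | exists2 d, d < e & forall v, b v -> `|f v - g v| <= d].
exists [set u | exists f b e, born_set B b /\ u = C f b e].
  move=> u; rewrite inE => -[f [b [e [Bb ->]]]].
  move=> g h l; rewrite !inE => -[d de Hg] [d' de' Hh].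
  exists (Num.max d d'); first by rewrite gt_max de de'.
  move=> v bv.
  have l0 : 0 <= l%:num by [].
  have l1 : 0 <= 1 - l%:num by rewrite subr_ge0.
  have -> : f v - (conv l (g : convex_lmodType _) h : dual B) v
      = l%:num *: (f v - g v) + (1 - l%:num) *: (f v - h v).
    rewrite !scalerBr addrACA -scalerDl addrC [_ + (1 - _)]addrC subrK scale1r.
    by rewrite -opprD addrC.
  rewrite (le_trans (ler_normD _ _)) // !normrZ.
  rewrite (@ger0_norm _ l%:num) // (@ger0_norm _ (1 - l%:num)) //.
  have -> : Num.max d d' = l%:num * Num.max d d' + (1 - l%:num) * Num.max d d'.
    by rewrite -mulrDl [_ + (1 - _)]addrC subrK mul1r.
  apply: lerD; apply: ler_wpM2l => //.
    by rewrite le_max Hg.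
  by rewrite le_max Hh ?orbT.
split.
  move=> u [f [b [e [Bb ->]]]]; rewrite openE => g [d de Hg].
  apply/nbhs_dual; exists b, ((e - d) / 2).
    by split => //; rewrite divr_gt0 // subr_gt0.
  move=> h Hh; exists (d + (e - d) / 2).
    by rewrite -ltrBrDl ltr_pdivrMr // ltr_pMr ?subr_gt0 // ltr1n.
  move=> v bv; rewrite -(subrK (g v) (f v)) -addrA.
  by rewrite (le_trans (ler_normD _ _)) // lerD ?Hg // ltW // Hh.
move=> f P /nbhs_dual[b [e [Bb e0] H]].
exists (C f b e).
  split; first by exists f, b, e.
  by exists 0 => // v bv; rewrite subrr normr0.
move=> g [d de Hg]; apply: H => v bv.
by rewrite (le_lt_trans (Hg _ bv)).
Qed.

(* the factory only provides the uniform structure *)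
HB.instance Definition _ := PreTopologicalLmod_isTvs.Build R (dual B)
  dual_add_continuous dual_scale_continuous dual_locally_convex.
HB.instance Definition _ :=
  PreTopologicalNmodule_isTopologicalNmodule.Build (dual B) dual_add_continuous.
HB.instance Definition _ :=
  TopologicalNmodule_isTopologicalLmodule.Build R (dual B) dual_scale_continuous.
HB.instance Definition _ :=
  Uniform_isTvs.Build R (dual B) dual_locally_convex.
End DualTvs.

(* ** Michal-Bastiani smoothness *)

Section Smooth.
Context (R : realType).
Implicit Types E G : tvsType R.

Definition has_dderiv E G (f : E -> G) (x h : E) (l : G) :=
  (fun t : R => t^-1 *: (f (x + t *: h) - f x)) @ (0 : R)^' --> l.

(* df(x)(h); the value 0 is a dummy, used when the limit does not exist. All
   codomains below are Hausdorff, so that the limit is unique. *)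
Definition dderiv E G (f : E -> G) (x h : E) : G :=
  xget 0 [set l | has_dderiv f x h l].

(* f is C^k on U, for U open in E *)
Fixpoint Ck (k : nat) E G (U : set E) (f : E -> G) : Prop :=
  (forall x, U x -> {for x, continuous f}) /\
  if k is k'.+1 then
    (forall x h, U x -> exists l, has_dderiv f x h l) /\
    Ck k' (U `*` [set: E] : set (E * E)%type) (fun p => dderiv f p.1 p.2)
  else True.

Definition smooth_on E G (U : set E) (f : E -> G) := forall k, Ck k U f.

End Smooth.

(* ** Manifolds *)

Record chart (R : realType) (F : tvsType R) (M : topologicalType) := Chart {
  cdom : set M ;
  cfun :> M -> F ;
  cinv : F -> M ;
  cdom_open : open cdom ;
  cimg_open : open (cfun @` cdom) ;
  cfunK : forall x, cdom x -> cinv (cfun x) = x ;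
  cfun_continuous : forall x, cdom x -> {for x, continuous cfun} ;
  cinv_continuous :
    forall y, (cfun @` cdom) y -> {for y, continuous cinv} }.

(* A manifold modelled on F. The preferred chart at each point only serves to
   represent tangent vectors, see below. *)
Record manifold (R : realType) (F : tvsType R) := Manifold {
  mcarrier :> topologicalType ;
  mhausdorff : hausdorff_space mcarrier ;
  atlas : set (chart F mcarrier) ;
  chart_at : mcarrier -> chart F mcarrier ;
  chart_at_atlas : forall x, atlas (chart_at x) ;
  chart_at_dom : forall x, cdom (chart_at x) x ;
  atlas_smooth : forall c d, atlas c -> atlas d ->
    smooth_on (c @` (cdom c `&` cdom d)) (fun y => d (cinv c y)) }.

Arguments atlas {R F} m _.

Section Bundles.
Context (R : realType) (F : tvsType R) (M : manifold F).

(* C^oo(M) *)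
Definition smooth_fun (f : M -> R) := forall c, atlas M c ->
  smooth_on (c @` cdom c) (fun y => f (cinv c y) : R^o).

(* A family of vector spaces over M with local trivializations. That it is a
   vector bundle is expressed by is_vbundle. *)
Record bundle := Bundle {
  bmodel : tvsType R ;
  bfib : M -> lmodType R ;
  bidx : Type ;
  bdom : bidx -> set M ;
  btriv : bidx -> forall x, bfib x -> bmodel }.

Definition section (L : bundle) := forall x, bfib L x.

(* inverse of a trivialization, fibre by fibre *)
Definition btriv_inv (L : bundle) (i : bidx L) (x : M) (k : bmodel L)
  : bfib L x := xget 0 [set v | btriv i v = k].

(* vector bundle in the category of (Hausdorff) locally convex spaces *)
Definition is_vbundle (L : bundle) :=
  [/\ hausdorff_space (bmodel L),
      (forall i : bidx L, open (bdom i)) /\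
        (forall x, exists i : bidx L, bdom i x),
      forall (i : bidx L) x, bdom i x ->
        linear (@btriv L i x) /\ bijective (@btriv L i x) &
      forall (i j : bidx L) c, atlas M c ->
        smooth_on [set p : (F * bmodel L)%type |
            (c @` (cdom c `&` bdom i `&` bdom j)) p.1]
          (fun p => btriv j (btriv_inv i (cinv c p.1) p.2))].

Definition is_frechet_vbundle (L : bundle) :=
  frechet (bmodel L) /\ is_vbundle L.

(* membership in Gamma(L) *)
Definition smooth_section (L : bundle) (s : section L) :=
  forall (i : bidx L) c, atlas M c ->
    smooth_on (c @` (cdom c `&` bdom i))
      (fun y => btriv i (s (cinv c y))).

Definition is_bundle_map (L L' : bundle) (phi : forall x, bfib L x -> bfib L' x) :=
  (forall x, linear (phi x)) /\
  forall (i : bidx L) (j : bidx L') c, atlas M c ->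
    smooth_on [set p : (F * bmodel L)%type |
        (c @` (cdom c `&` bdom i `&` bdom j)) p.1]
      (fun p => btriv j (phi _ (btriv_inv i (cinv c p.1) p.2))).

(* *** Subbundles *)

Record subspace (V : lmodType R) := Subspace {
  subspace_set :> V -> Prop ;
  subspace_closed :
    submod_closed ((fun v => `[< subspace_set v >]) : {pred V}) }.

(* The trivialization i of L followed by a smooth family Phi of automorphisms
   of the model over U, taking D to the constant subspace iota(K). *)
Record straightening (L : bundle) (D : forall x, subspace (bfib L x))
    (K : tvsType R) (iota : K -> bmodel L) := Straightening {
  st_idx : bidx L ;
  st_dom : set M ;
  st_fun : M -> bmodel L -> bmodel L ;
  st_inv : M -> bmodel L -> bmodel L ;
  st_open : open st_dom ;
  st_sub : st_dom `<=` bdom st_idx ;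
  st_linear : forall x, st_dom x -> linear (st_fun x) ;
  st_funK : forall x, st_dom x -> cancel (st_fun x) (st_inv x) ;
  st_invK : forall x, st_dom x -> cancel (st_inv x) (st_fun x) ;
  st_fun_smooth : forall c, atlas M c ->
    smooth_on [set p : (F * bmodel L)%type | (c @` (cdom c `&` st_dom)) p.1]
      (fun p => st_fun (cinv c p.1) p.2) ;
  st_inv_smooth : forall c, atlas M c ->
    smooth_on [set p : (F * bmodel L)%type | (c @` (cdom c `&` st_dom)) p.1]
      (fun p => st_inv (cinv c p.1) p.2) ;
  st_fib : forall x v, st_dom x ->
    (D x v <-> exists k, iota k = st_fun x (btriv st_idx v)) }.

(* The typical fibre is a closed, not necessarily complemented, subspace of the
   model of L, given as the image of a linear closed embedding. *)
Record subbundle (L : bundle) := Subbundle {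
  sfib :> forall x, subspace (bfib L x) ;
  smodel : tvsType R ;
  sincl : smodel -> bmodel L ;
  sincl_linear : linear sincl ;
  sincl_inj : injective sincl ;
  sincl_nbhs : forall k U, nbhs k U <->
    exists2 V, nbhs (sincl k) V & sincl @^-1` V `<=` U ;
  sincl_closed : closed (range sincl) ;
  sstraight : forall x,
    exists S : straightening sfib sincl, st_dom S x }.

End Bundles.

Section SubspaceType.
Context (R : realType) (V : lmodType R) (W : subspace V).

Definition subspace_pred : {pred V} := fun v => `[< W v >].

HB.instance Definition _ := GRing.isSubmodClosed.Build _ _ subspace_pred
  (subspace_closed W).

Record subspace_type := SubspaceElt {
  subspace_val :> V ; _ : subspace_val \in subspace_pred }.

HB.instance Definition _ := [isSub for subspace_val].
HB.instance Definition _ := [Choice of subspace_type by <:].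
HB.instance Definition _ := [SubChoice_isSubLmodule of subspace_type by <:].
End SubspaceType.

(* A subbundle, as a bundle trivialized by its straightenings. *)
Definition bundle_of_sub (R : realType) (F : tvsType R) (M : manifold F)
    (L : bundle M) (D : subbundle L) : bundle M :=
  @Bundle _ _ M (smodel D) (fun x => subspace_type (D x))
    (straightening D (@sincl _ _ _ _ D)) (fun S => st_dom S)
    (fun S x v => xget 0 [set k |
       sincl k = st_fun S x (btriv (st_idx S) (subspace_val v))]).

(* ** Tangent, cotangent and generalized tangent bundles *)

Section Tangent.
Context (R : realType) (F : tvsType R) (M : manifold F) (B : bornology F).

(* T_x M is represented by F, a tangent vector at x being given by its
   coordinates in the preferred chart at x. tcoord c x v are the coordinates
   in the chart c of the tangent vector v at x, and tcoord_inv c x is the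
   inverse change of coordinates. *)
Definition tcoord (c : chart F M) (x : M) (v : F) : F :=
  dderiv (fun y => c (cinv (chart_at x) y)) (chart_at x x) v.

Definition tcoord_inv (c : chart F M) (x : M) (w : F) : F :=
  dderiv (fun y => chart_at x (cinv c y)) (c x) w.

(* The element of F'_B with the given values. It is only applied to functions
   that are linear and continuous when the data are smooth. *)
Definition to_dual (g : F -> R) : dual B :=
  xget 0 [set a : dual B | forall v, a v = g v].

Definition tangent : bundle M :=
  @Bundle _ _ M F (fun=> F) {c | atlas M c} (fun c => cdom (proj1_sig c))
    (fun c x v => tcoord (proj1_sig c) x v).

(* Unless F is normable, the changes of trivialization of the next two bundles,
   (x, a) |-> a o T_x, need not be jointly continuous for the topology of F'_B,
   but they do map smooth sections to smooth sections. Both bundles are used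
   through their smooth sections and their subbundles only. *)
Definition cotangent : bundle M :=
  @Bundle _ _ M (dual B) (fun=> dual B) {c | atlas M c}
    (fun c => cdom (proj1_sig c))
    (fun c x a => to_dual (fun w => a (tcoord_inv (proj1_sig c) x w))).

Definition gtangent : bundle M :=
  @Bundle _ _ M (F * dual B)%type (fun=> (F * dual B)%type) {c | atlas M c}
    (fun c => cdom (proj1_sig c))
    (fun c x p => (@btriv _ _ _ tangent c x p.1, @btriv _ _ _ cotangent c x p.2)).

(* ** Calculus on M *)

(* X(f) *)
Definition vact (X : section tangent) (f : M -> R) (x : M) : R :=
  dderiv (fun y => f (cinv (chart_at x) y) : R^o) (chart_at x x) (X x).

(* [X, Y] = dY(X) - dX(Y) in the preferred chart at x *)
Definition vbracket (X Y : section tangent) : section tangent := fun x =>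
  let c := chart_at x in
  let loc (Z : section tangent) y := tcoord c (cinv c y) (Z (cinv c y)) in
  dderiv (loc Y) (c x) (X x) - dderiv (loc X) (c x) (Y x).

(* The vector field, meaningful near x, that extends v and is constant in the
   preferred chart at x. The value at x of the de Rham differential is computed
   on such extensions; by tensoriality the choice is immaterial. *)
Definition vext (x : M) (v : F) : section tangent := fun x' =>
  tcoord_inv (chart_at x) x' v.

(* i_X on 1-forms *)
Definition contr1 (X : section tangent) (a : section cotangent) : M -> R :=
  fun x => (a x : dual B) (X x).

(* d_dR on 0-forms and on 1-forms; a 2-form is represented by its values. *)
Definition dR0 (f : M -> R) : section cotangent := fun x =>
  to_dual (fun v => vact (vext x v) f x).

Definition dR1 (a : section cotangent) (x : M) (v w : F) : R :=
  let X0 := vext x v in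
  let X1 := vext x w in
  vact X0 (contr1 X1 a) x - vact X1 (contr1 X0 a) x
  - contr1 (vbracket X0 X1) a x.

(* i_X on 2-forms *)
Definition contr2 (X : section tangent) (w : forall x : M, F -> F -> R)
  : section cotangent := fun x => to_dual (w x (X x)).

Definition lie_der (X : section tangent) (a : section cotangent)
  : section cotangent := fun x =>
  (dR0 (contr1 X a) x : dual B) + contr2 X (dR1 a) x.

Definition pairing (p q : (F * dual B)%type) : R := p.2 q.1 + q.2 p.1.

Definition pr1 (s : section gtangent) : section tangent :=
  fun x => (s x : (F * dual B)%type).1.
Definition pr2 (s : section gtangent) : section cotangent :=
  fun x => (s x : (F * dual B)%type).2.

(* the bracket [ , ]_TM *)
Definition dorfman (s t : section gtangent) : section gtangent := fun x =>
  (vbracket (pr1 s) (pr1 t) x : F,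
   (lie_der (pr1 s) (pr2 t) x : dual B) - contr2 (pr1 t) (dR1 (pr2 s)) x).

Definition courant (s t : section gtangent) : section gtangent := fun x =>
  (vbracket (pr1 s) (pr1 t) x : F,
   (lie_der (pr1 s) (pr2 t) x : dual B) - lie_der (pr1 t) (pr2 s) x
   + 2^-1 *: (dR0 (fun x' =>
       contr1 (pr1 t) (pr2 s) x' - contr1 (pr1 s) (pr2 t) x') x : dual B)).

Definition is_dirac (D : subbundle gtangent) :=
  (forall x (p : bfib gtangent x),
     D x p <-> forall q : bfib gtangent x, D x q -> pairing p q = 0) /\
  (forall s t : section gtangent,
     smooth_section s -> smooth_section t ->
     (forall x, D x (s x)) -> (forall x, D x (t x)) ->
     smooth_section (dorfman s t) /\ forall x, D x (dorfman s t x)).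

(* Pr : D -> TM *)
Definition dirac_pr (D : subbundle gtangent)
    (x : M) (p : bfib (bundle_of_sub D) x) : bfib tangent x :=
  (subspace_val p : (F * dual B)%type).1.

(* ** Lie algebroids *)

Section Algebroid.
Variables (L : bundle M) (br : section L -> section L -> section L)
          (lam : forall x, bfib L x -> bfib tangent x).

(* br restricts to a Lie bracket on Gamma(L) *)
Definition is_lie_bracket :=
  [/\ forall s t, smooth_section s -> smooth_section t ->
        smooth_section (br s t),
      forall (a : R) s t u,
        smooth_section s -> smooth_section t -> smooth_section u ->
        (forall x, br (fun y => a *: s y + t y) u x
                   = a *: br s u x + br t u x) /\
        (forall x, br u (fun y => a *: s y + t y) x
                   = a *: br u s x + br u t x),
      forall s, smooth_section s -> forall x, br s s x = 0 &
      forall s t u,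
        smooth_section s -> smooth_section t -> smooth_section u ->
        forall x, br s (br t u) x + br t (br u s) x + br u (br s t) x = 0].

Definition anchor_section (s : section L) : section tangent :=
  fun x => lam (s x).

(* The anchor is a bundle map (so that it is linear on sections), it preserves
   brackets, and the Leibniz rule holds. *)
Definition algebroid_axioms :=
  [/\ is_bundle_map (L' := tangent) lam,
      forall s t, smooth_section s -> smooth_section t ->
        forall x, anchor_section (br s t) x
                  = vbracket (anchor_section s) (anchor_section t) x &
      forall (f : M -> R) s t,
        smooth_fun f -> smooth_section s -> smooth_section t ->
        forall x, br s (fun y => f y *: t y) x
                  = f x *: br s t x + vact (anchor_section s) f x *: t x].

Definition is_frechet_lie_algebroid :=
  [/\ is_frechet_vbundle L, is_lie_bracket & algebroid_axioms].

End Algebroid.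
End Tangent.

(* Main.v *)
(** In a chart, a section of the generalized tangent bundle is a pair (X, al) with
    X : U -> F and al : U -> F'_B, and the Dorfman bracket of (X, al), (Y, be) is
      dY(X) - dX(Y),
      v |-> dbe(X)(v) + be(dX(v)) - dal(Y)(v) + dal(v)(Y).
    Symmetry of second derivatives makes these formulas independent of the chart,
    and also yields [s, [t, u]] = [[s, t], u] + [t, [s, u]] for all smooth sections
    with smooth brackets. On sections of D the pairing vanishes, so the Courant
    bracket equals the Dorfman bracket and is antisymmetric; the Dorfman identity
    then becomes the Jacobi identity, and the Leibniz rule is read off the formula.

    Evaluation F'_B x F -> R is not continuous, but it is continuous along
    sequences because B contains the compact sets; as F is metrizable this
    suffices to differentiate be(X) and to show that a smooth section keeps its
    smoothness under (x, a) |-> a o T_x. *)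

Require Import Defs.
From HB Require Import structures.
From mathcomp Require Import all_boot all_order all_algebra.
From mathcomp Require Import all_classical all_reals all_analysis.
From mathcomp Require Import ring lra.

Set Implicit Arguments.
Unset Strict Implicit.
Unset Printing Implicit Defensive.

Import Order.TTheory GRing.Theory Num.Theory.
Import numFieldNormedType.Exports.

Local Open Scope classical_set_scope.
Local Open Scope ring_scope.

(** * Limits and the mean value theorem *)

(** The definition of C^k offers neither linearity of the derivative nor a remainder estimate. Both
    are recovered from a mean value theorem for convex neighbourhoods, in the form that difference
    quotients converge even when base point and direction move. The topology of F'_B asks for more:
    forms pulled back along a smooth family T(y, v), linear in v, must be controlled uniformly on
    the members of B. These are bounded, and linearity in v turns the continuity of the derivative
    at (y, 0) into such a uniform estimate. What remains is evaluation on moving vectors, settled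
    along sequences tending to 0, since a filter with a countable base is determined by sequences.
    Hence smoothness of pull-backs is proved on first countable domains: F itself for sections, F *
    smodel D for the trivializations of D. Jacobi involves derivatives of form parts that are known
    only through their values; smoothness of the inner brackets, part of the closure of D, allows
    these derivatives to be computed on fixed vectors. *)

Lemma cvg_pairT (I : Type) (Phi : set_system I) {FPhi : Filter Phi}
    (T U : topologicalType) (f : I -> T) (g : I -> U) (a : T) (b : U) :
  f @ Phi --> a -> g @ Phi --> b -> (fun i => (f i, g i)) @ Phi --> (a, b).
Proof. exact: (@cvg_pair _ _ _ _ (nbhs a) (nbhs b)). Qed.

Section TvsLimits.
Context (R : realType) (I : Type) (Phi : set_system I) {FPhi : Filter Phi}
  (E : tvsType R).

Lemma tvs_cvgD (f g : I -> E) (a b : E) : f @ Phi --> a -> g @ Phi --> b ->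
  (fun i => f i + g i) @ Phi --> a + b.
Proof.
by move=> fa gb; apply: (cvg_comp2 fa gb (@add_continuous E (a, b))).
Qed.

Lemma tvs_cvgZ (r : I -> R^o) (f : I -> E) (k : R^o) (a : E) :
  r @ Phi --> k -> f @ Phi --> a -> (fun i => r i *: f i) @ Phi --> k *: a.
Proof.
by move=> rk fa; apply: (cvg_comp2 rk fa (@scale_continuous R E (k, a))).
Qed.

Lemma tvs_cvgN (f : I -> E) (a : E) :
  f @ Phi --> a -> (fun i => - f i) @ Phi --> - a.
Proof. by move=> fa; apply: (cvg_comp _ _ fa (@opp_continuous E a)). Qed.

Lemma tvs_cvgB (f g : I -> E) (a b : E) : f @ Phi --> a -> g @ Phi --> b ->
  (fun i => f i - g i) @ Phi --> a - b.
Proof. by move=> fa gb; apply: tvs_cvgD => //; exact: tvs_cvgN. Qed.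

End TvsLimits.

Definition is_convex (R : realType) (E : tvsType R) (V : set E) :=
  forall x y (s t : R), V x -> V y -> 0 <= s -> 0 <= t -> s + t = 1 ->
    V (s *: x + t *: y).

(** Restates local convexity with plain scalar weights and an open set, the two features that
    [mean_value] asks for. *)
Lemma convex_nbhs (R : realType) (E : tvsType R) (x : E) (U : set E) :
  nbhs x U -> exists V : set E, [/\ open V, V x, is_convex V & V `<=` U].
Proof.
have [BB cB [oB bB]] := @locally_convex R E.
move=> /bB[V [BV Vx] VU]; exists V; split => //; first exact: oB.
move=> y z s t Vy Vz s0 t0 st1.
have s1 : s <= 1 by lra.
have := cB V (mem_set BV) y z (Itv01 s0 s1) (mem_set Vy) (mem_set Vz).
rewrite inE.
suff -> : (conv (Itv01 s0 s1) (y : convex_lmodType E) z : E)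
   = s *: y + t *: z by [].
by rewrite [LHS](_ : _ = s *: y + (1 - s) *: z) //; congr (_ + _ *: _); lra.

Qed.

Section MeanValue.
Context (R : realType) (E : tvsType R).

(* By convexity, if the slopes of g on two adjacent intervals lie in V then so
   does the slope on their union; hence the supremum of the s whose slope on
   [0, s] lies in V is 1. *)
Lemma mean_value (g g' : R -> E) (V : set E) :
  open V -> is_convex V ->
  (forall s, 0 <= s <= 1 ->
    (fun r : R => r^-1 *: (g (s + r) - g s)) @ (0 : R)^' --> g' s) ->
  (forall s, 0 <= s <= 1 -> V (g' s)) -> V (g 1 - g 0).
Proof.
move=> oV cV dg Vg.
pose P a b := V ((b - a)^-1 *: (g b - g a)).
have loc s : 0 <= s <= 1 -> exists2 d, 0 < d &
    forall s', (s < s' < s + d -> P s s') /\ (s - d < s' < s -> P s' s).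
  move=> s01; have /(dg s s01) : nbhs (g' s) V.
    by apply: open_nbhs_nbhs; split => //; exact: Vg.
  move=> [d /= d0 Hd]; exists d => // s'; split => /andP[h1 h2].
    have := Hd (s' - s); rewrite /= sub0r normrN /P [s + _]addrC subrK. apply.
      by rewrite ger0_norm; lra.
    by rewrite gt_eqF // subr_gt0.
  have := Hd (s' - s); rewrite /= sub0r normrN /P [s + _]addrC subrK.
  have -> : (s - s')^-1 *: (g s - g s') = (s' - s)^-1 *: (g s' - g s).
    by rewrite -[s - s']opprB -[g s - _]opprB invrN scaleNr scalerN opprK.
  apply; first by rewrite ler0_norm; lra.
  by rewrite lt_eqF // subr_lt0.
have trP a b c : a < b -> b < c -> P a b -> P b c -> P a c.
  move=> ab bc Pab Pbc; rewrite /P.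
  have -> : (c - a)^-1 *: (g c - g a) =
    ((b - a) / (c - a)) *: ((b - a)^-1 *: (g b - g a)) +
    ((c - b) / (c - a)) *: ((c - b)^-1 *: (g c - g b)).
    rewrite !scalerA ![_ / (c - a) / _]mulrAC !mulfV ?subr_eq0 ?gt_eqF //.
    rewrite !mul1r -scalerDr; congr (_ *: _).
    by rewrite [RHS]addrC addrA subrK.
  have ca : 0 < c - a by lra.
  apply: cV => //.
  - by rewrite divr_ge0; lra.
  - by rewrite divr_ge0; lra.
  - by rewrite -mulrDl addrC addrA subrK mulfV // gt_eqF.
(* The slope over [0, 0] carries no information, so 0 is left out of [A]; [Hd0] shows that [A] is
   nevertheless inhabited. *)
pose A := [set s : R | 0 < s <= 1 /\ P 0 s].
have [d0 d00 Hd0] : exists2 d : R, 0 < d & forall s', 0 < s' < d -> P 0 s'.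
  have [|d d0 Hd] := loc 0; first by rewrite lexx ler01.
  exists d => // s' h; have [+ _] := Hd s'; apply.
  by rewrite add0r.
have supA : has_sup A.
  split; last by exists 1 => s [/andP[]].
  pose s := Num.min (d0 / 2) 1; exists s; split.
    by rewrite /s lt_min ge_min lexx orbT andbT ltr01 andbT divr_gt0.
  apply: Hd0; rewrite lt_min divr_gt0 //= ltr01 /=.
  by rewrite gt_min ltr_pdivrMr // ltr_pMr // ltr1n.
pose c := sup A.
have c1 : c <= 1 by apply: ge_sup => [|s [/andP[]//]]; case: supA.
have c0 : 0 < c.
  have [[s As] _] := supA; have [/andP[s0 _] _] := As.
  by apply: lt_le_trans s0 _; exact: sup_upper_bound.
have [|d d_gt0 Hd] := loc c; first by rewrite c1 ltW.
have Pc : P 0 c.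
  have [s As] := sup_adherent d_gt0 supA; have [/andP[s0 s1] Ps] := As.
  move=> cs; have : s <= c by exact: sup_upper_bound.
  rewrite le_eqVlt => /orP[/eqP <- //|sc].
  apply: (trP _ s) => //.
  by have [_] := Hd s; apply; rewrite sc -/c in cs *; rewrite cs.
have [c_eq|c_lt] : c = 1 \/ c < 1.
  by move: c1; rewrite le_eqVlt => /orP[/eqP|]; auto.
  by move: Pc; rewrite c_eq /P subr0 invr1 scale1r.
pose s := Num.min (c + d / 2) 1.
have cs : c < s by rewrite lt_min c_lt andbT ltrDl divr_gt0.
have : A s.
  split; first by rewrite (lt_trans c0 cs) /= ge_min lexx orbT.
  apply: (trP _ c) => //; have [+ _] := Hd s; apply.
  rewrite cs /= /s gt_min ltrD2l ltr_pdivrMr // ltr_pMr // ?ltr1n //.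
by move=> /(sup_upper_bound supA); rewrite -/c leNgt cs.
Qed.

End MeanValue.

(** * Strong differentiability *)

Section Derivative.
Context (R : realType).
Implicit Types E G H : tvsType R.

Lemma has_dderiv_unique E G (f : E -> G) x h l m : hausdorff_space G ->
  has_dderiv f x h l -> has_dderiv f x h m -> l = m.
Proof. by move=> hG; exact: cvg_unique. Qed.

Lemma dderivE E G (f : E -> G) x h l : hausdorff_space G ->
  has_dderiv f x h l -> dderiv f x h = l.
Proof.
move=> hG fl; apply: (has_dderiv_unique hG _ fl).
by apply: (@xgetPex _ 0 [set l | has_dderiv f x h l]); exists l.
Qed.

Lemma dderivP E G (f : E -> G) x h :
  (exists l, has_dderiv f x h l) -> has_dderiv f x h (dderiv f x h).
Proof. by move=> fl; exact: (@xgetPex _ 0 [set l | has_dderiv f x h l]). Qed.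

Lemma dnbhs0_mulr (c : R) : c != 0 -> (fun r => r * c) @ (0 : R)^' --> (0 : R)^'.
Proof.
move=> c0 A [d /= d0 dA]; exists (d / `|c|) => /=; first by rewrite divr_gt0 ?normr_gt0.
move=> r /=; rewrite sub0r normrN => rd r0; apply: dA => /=.
  by rewrite sub0r normrN normrM -ltr_pdivlMr ?normr_gt0.
by rewrite mulf_neq0.
Qed.

Lemma line_cvg E (x h : E) : (fun t : R => x + t *: h) @ (0 : R)^' --> x.
Proof.
have c0 : (fun t : R => t : R^o) @ (0 : R)^' --> (0 : R^o) by exact: nbhs_dnbhs.
have ch : (fun _ : R => h) @ (0 : R)^' --> h by exact: cvg_cst.
have cx : (fun _ : R => x) @ (0 : R)^' --> x by exact: cvg_cst.
by generalize (tvs_cvgD cx (tvs_cvgZ c0 ch)); rewrite scale0r addr0.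
Qed.
Arguments line_cvg {E x} h.

Lemma has_dderivZ E G (f : E -> G) x h l (a : R) :
  has_dderiv f x h l -> has_dderiv f x (a *: h) (a *: l).
Proof.
have [-> _|a0 fl] := eqVneq a 0.
  rewrite !scale0r [has_dderiv _ _ _]/has_dderiv (_ : (fun _ => _) = fun=> 0); first exact: cvg_cst.
  by apply/funext => t; rewrite !scaler0 addr0 subrr scaler0.
have := cvg_comp _ _ (dnbhs0_mulr a0) fl.
have ca : (fun=> a : R^o) @ (0 : R)^' --> (a : R^o) by exact: cvg_cst.
move=> c; generalize (tvs_cvgZ ca c); apply: cvg_trans.
apply: near_eq_cvg; near=> t => /=.
rewrite invfM !scalerA [a * _]mulrCA mulfV // mulr1.
by [].
Unshelve. all: by end_near. Qed.

Lemma dderiv0 E G (f : E -> G) x : hausdorff_space G -> dderiv f x 0 = 0.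
Proof.
move=> hG; apply: dderivE => //; rewrite /has_dderiv.
rewrite (_ : (fun _ => _) = fun=> 0); first exact: cvg_cst.
by apply/funext => t; rewrite !scaler0 addr0 subrr scaler0.
Qed.

Definition C1 E G (U : set E) (f : E -> G) := Ck 1 U f.

Lemma C1_dderiv E G (U : set E) (f : E -> G) x h : C1 U f -> U x ->
  has_dderiv f x h (dderiv f x h).
Proof. by move=> [_ [ex _]] Ux; apply: dderivP; exact: ex. Qed.

Arguments C1_dderiv {E G U f x} h.

Lemma C1_cont E G (U : set E) (f : E -> G) x h : C1 U f -> U x ->
  {for (x, h), continuous (fun p : E * E => dderiv f p.1 p.2)}.
Proof. by move=> [_ [_ [c _]]] Ux; apply: c. Qed.

(* The segment from x' to x' + t h' stays where the derivative is close to
   [dderiv f x h], so that the mean value theorem applies. *)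
Lemma strong_dderiv_near E G (U : set E) (f : E -> G) x h (V : set G) :
  hausdorff_space G -> open U -> C1 U f -> U x -> nbhs (dderiv f x h) V ->
  exists A : set E, exists B : set E, exists2 d : R,
    [/\ nbhs x A, nbhs h B & 0 < d] &
    forall x' h' t, A x' -> B h' -> `|t| < d -> t != 0 ->
      V (t^-1 *: (f (x' + t *: h') - f x')).
Proof.
move=> hG oU C1f Ux /convex_nbhs[W [oW Wx cW WV]].
have UW : nbhs (x, h) [set p : E * E | U p.1 /\ W (dderiv f p.1 p.2)].
  apply: filterI.
    exists (U, setT) => /=; last by move=> [a b] [].
    by split; [exact: open_nbhs_nbhs|exact: filterT].
  exact: (C1_cont C1f Ux (open_nbhs_nbhs (conj oW Wx))).
have [[A1 B1] /= [nA1 nB1] AB1] := UW.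
have cm : (fun p : (E * E) * R^o => p.1.1 + p.2 *: p.1.2) @ (nbhs (x, h, 0 : R^o)) --> x.
  rewrite -[X in _ --> X]addr0 -(scale0r h).
  have c1 : (fun p : (E * E) * R^o => p.1) @ nbhs (x, h, 0 : R^o) --> (x, h).
    exact: cvg_fst.
  have c2 : (fun p : (E * E) * R^o => p.2) @ nbhs (x, h, 0 : R^o) --> (0 : R^o).
    exact: cvg_snd.
  have cx : fst @ nbhs (x, h) --> x by exact: cvg_fst.
  have ch : snd @ nbhs (x, h) --> h by exact: cvg_snd.
  apply: tvs_cvgD; first exact: cvg_comp c1 cx.
  by apply: tvs_cvgZ => //; exact: cvg_comp c1 ch.
have [[P D] /= [[[A2 B2] /= [nA2 nB2] AB2] nD] PD] := cm _ nA1.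
have [d d0 dD] := nD.
exists A2, (B1 `&` B2), d; first by split => //; exact: filterI.
move=> x' h' t Ax [B1h B2h] td t0; apply: WV.
have seg s : 0 <= s <= 1 -> U (x' + (s * t) *: h') /\ W (dderiv f (x' + (s * t) *: h') h').
  move=> /andP[s0 s1]; apply: (AB1 (_, _)); split => //=.
  apply: (PD (x', h', s * t)); split; first exact: (AB2 (_, _)).
  apply: dD; rewrite /= sub0r normrN normrM (ger0_norm s0).
  by apply: le_lt_trans td; rewrite ler_piMl.
(* Dividing by t in advance makes the derivative of the path equal to [dderiv f] itself, without a
   factor t. *)
have := @mean_value R G (fun s => t^-1 *: f (x' + (s * t) *: h'))
  (fun s => dderiv f (x' + (s * t) *: h') h') W oW cW.
rewrite mul1r mul0r scale0r addr0 -scalerBr; apply; last by move=> s /seg[].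
move=> s /seg[Us _].
have := cvg_comp _ _ (dnbhs0_mulr t0) (C1_dderiv h' C1f Us).
apply: cvg_trans; apply: near_eq_cvg; near=> r => /=.
by rewrite -scalerBr scalerA mulrDl scalerDl addrA invfM.
Unshelve. all: by end_near. Qed.

(** Base point and direction may both move with the filter. This replaces a remainder estimate in
    the proofs of additivity and of the chain rule. *)
Lemma strong_dderiv E G (U : set E) (f : E -> G) x h (I : Type)
    (Phi : set_system I) {FPhi : Filter Phi} (x_ h_ : I -> E) (t_ : I -> R) :
  hausdorff_space G -> open U -> C1 U f -> U x ->
  x_ @ Phi --> x -> h_ @ Phi --> h -> t_ @ Phi --> (0 : R)^' ->
  (fun i => (t_ i)^-1 *: (f (x_ i + t_ i *: h_ i) - f (x_ i))) @ Phi
    --> dderiv f x h.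
Proof.
move=> hG oU C1f Ux cx ch ct V.
move=> /(strong_dderiv_near hG oU C1f Ux)[A [B [d [nA nB d0] H]]].
have Hd : nbhs (0 : R)^' [set t | `|t| < d /\ t != 0].
  by exists d => //= t; rewrite /= sub0r normrN.
have H1 : Phi [set i | A (x_ i)] := cx _ nA.
have H2 : Phi [set i | B (h_ i)] := ch _ nB.
have H3 : Phi [set i | `|t_ i| < d /\ t_ i != 0] := ct _ Hd.
change (Phi [set i | V ((t_ i)^-1 *: (f (x_ i + t_ i *: h_ i) - f (x_ i)))]).
apply: (filterS3 FPhi _ H1 H2 H3) => i Ax Bh [td t0].
exact: H.
Qed.

(** Go from x to x + t k, and from there to x + t k + t h: the second quotient has a moving base
    point, so its limit comes from [strong_dderiv]. *)
Lemma dderivD E G (U : set E) (f : E -> G) x h k :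
  hausdorff_space G -> open U -> C1 U f -> U x ->
  dderiv f x (h + k) = dderiv f x h + dderiv f x k.
Proof.
move=> hG oU C1f Ux; apply: dderivE => //.
have H1 : (fun t : R => t^-1 *: (f ((x + t *: k) + t *: h) - f (x + t *: k)))
   @ (0 : R)^' --> dderiv f x h.
  by apply: (strong_dderiv hG oU C1f Ux) => //; [exact: line_cvg|exact: cvg_cst].
generalize (tvs_cvgD H1 (C1_dderiv k C1f Ux)); apply: cvg_trans.
apply: near_eq_cvg; near=> t => /=.
by rewrite -scalerDr addrA subrK -addrA -scalerDr [k + h]addrC.
Unshelve. all: by end_near. Qed.

Lemma dderiv_linear E G (U : set E) (f : E -> G) x :
  hausdorff_space G -> open U -> C1 U f -> U x -> linear (dderiv f x).
Proof.
move=> hG oU C1f Ux a h k; rewrite (dderivD _ _ hG oU C1f Ux); congr (_ + _).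
by apply: dderivE => //; apply: has_dderivZ; exact: C1_dderiv C1f Ux.
Qed.

Lemma dderiv_continuous E G (U : set E) (f : E -> G) x :
  C1 U f -> U x -> continuous (dderiv f x).
Proof.
move=> C1f Ux h.
apply: (@continuous_comp E (E * E)%type G (fun h => (x, h))
  (fun p => dderiv f p.1 p.2)); last exact: (C1_cont C1f Ux).
have : (fun k : E => (x, k)) @ nbhs h --> (x, h); last by [].
by apply: cvg_pairT; [exact: cvg_cst|exact: cvg_id].
Qed.

(** The difference quotient of f serves as a moving direction for g. Thus f contributes a single
    directional derivative at x, and only g has to be C^1. *)
Lemma has_dderiv_comp E G H (V : set G) (f : E -> G) (g : G -> H) x h l :
  hausdorff_space H -> open V -> C1 V g -> V (f x) -> has_dderiv f x h l ->
  has_dderiv (g \o f) x h (dderiv g (f x) l).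
Proof.
move=> hH oV C1g Vfx fl.
have : (fun t : R => t^-1 *:
    (g (f x + t *: (t^-1 *: (f (x + t *: h) - f x))) - g (f x))) @ (0 : R)^'
    --> dderiv g (f x) l.
  by apply: (strong_dderiv hH oV C1g Vfx) => //; exact: cvg_cst.
apply: cvg_trans; apply: near_eq_cvg; near=> t => /=.
rewrite scalerA mulfV ?scale1r; last by near: t; exact: nbhs_dnbhs_neq.
by rewrite [f x + _]addrC subrK.
Unshelve. all: by end_near. Qed.

Lemma has_dderiv_near E G (f g : E -> G) x h l :
  (\forall y \near x, f y = g y) -> has_dderiv f x h l -> has_dderiv g x h l.
Proof.
move=> fg; apply: cvg_trans; apply: near_eq_cvg.
near=> t.
have -> : f (x + t *: h) = g (x + t *: h) by near: t; exact: (line_cvg h _ fg).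
by rewrite (nbhs_singleton fg).
Unshelve. all: by end_near. Qed.

(** The sets of limits coincide, so the equality also covers points where no derivative exists and
    both sides are the dummy value. *)
Lemma dderiv_near E G (f g : E -> G) x h :
  (\forall y \near x, f y = g y) -> dderiv f x h = dderiv g x h.
Proof.
move=> fg; rewrite /dderiv; congr xget; apply/seteqP; split => l /=.
  exact: has_dderiv_near.
by apply: has_dderiv_near; apply: filterS fg.
Qed.

Lemma has_dderiv_lin E G (f : E -> G) x h : linear f -> has_dderiv f x h (f h).
Proof.
move=> lf; rewrite /has_dderiv.
have : (fun _ : R => f h) @ (0 : R)^' --> f h by exact: cvg_cst.
apply: cvg_trans; apply: near_eq_cvg; near=> t => /=.
rewrite [x + _]addrC lf addrK scalerA mulVf ?scale1r //.
by near: t; exact: nbhs_dnbhs_neq.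
Unshelve. all: by end_near. Qed.

Lemma has_dderiv_cst E G (c : G) (x h : E) : has_dderiv (fun=> c) x h 0.
Proof.
rewrite /has_dderiv (_ : (fun _ => _) = fun=> 0); first exact: cvg_cst.
by apply/funext => t; rewrite subrr scaler0.
Qed.

Lemma has_dderiv_pair E G H (f : E -> G) (g : E -> H) x h l m :
  has_dderiv f x h l -> has_dderiv g x h m ->
  has_dderiv (fun y => (f y, g y)) x h (l, m).
Proof. by move=> fl gm; exact: cvg_pairT fl gm. Qed.

Lemma has_dderiv_add E G (f g : E -> G) x h l m :
  has_dderiv f x h l -> has_dderiv g x h m ->
  has_dderiv (fun y => f y + g y) x h (l + m).
Proof.
move=> fl gm; generalize (tvs_cvgD fl gm); apply: cvg_trans.
apply: near_eq_cvg; near=> t => /=.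
by rewrite -scalerDr opprD addrACA.
Unshelve. all: by end_near. Qed.

Lemma has_dderiv_clin E G H (f : E -> G) (g : G -> H) x h l :
  linear g -> continuous g -> has_dderiv f x h l ->
  has_dderiv (fun y => g (f y)) x h (g l).
Proof.
move=> lg cg fl; have := cvg_comp _ _ fl (cg l).
apply: cvg_trans; apply: near_eq_cvg; near=> t => /=.
have g0 : g 0 = 0 by have := lg (-1) 0 0; rewrite scaler0 addr0 scaleN1r addNr.
have gZ a u : g (a *: u) = a *: g u by have := lg a u 0; rewrite !addr0 g0 addr0.
by rewrite gZ -[- f x]scaleN1r [f _ + _]addrC lg scaleN1r [- _ + _]addrC.
Unshelve. all: by end_near. Qed.

Lemma has_dderiv_opp E G (f : E -> G) x h l :
  has_dderiv f x h l -> has_dderiv (fun y => - f y) x h (- l).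
Proof.
move=> fl; generalize (tvs_cvgN fl); apply: cvg_trans.
apply: near_eq_cvg; near=> t => /=.
by rewrite -scalerN opprD.
Unshelve. all: by end_near. Qed.

Lemma has_dderiv_sub E G (f g : E -> G) x h l m :
  has_dderiv f x h l -> has_dderiv g x h m ->
  has_dderiv (fun y => f y - g y) x h (l - m).
Proof. by move=> fl gm; apply: has_dderiv_add => //; exact: has_dderiv_opp. Qed.

(** Continuity along the line only, which is all that one directional derivative gives and all that
    the product rules below require. *)
Lemma has_dderiv_cont E G (f : E -> G) x h l :
  has_dderiv f x h l -> (fun t : R => f (x + t *: h)) @ (0 : R)^' --> f x.
Proof.
move=> fl.
have c0 : (fun t : R => t : R^o) @ (0 : R)^' --> (0 : R^o) by exact: nbhs_dnbhs.
have cf : (fun _ : R => f x) @ (0 : R)^' --> f x by exact: cvg_cst.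
generalize (tvs_cvgD (tvs_cvgZ c0 fl) cf); rewrite scale0r add0r; apply: cvg_trans; apply: near_eq_cvg; near=> t => /=.
rewrite scalerA mulfV ?scale1r ?subrK //.
by near: t; exact: nbhs_dnbhs_neq.
Unshelve. all: by end_near. Qed.

End Derivative.
Arguments line_cvg {R E x} h.
Arguments C1_dderiv {R E G U f x} h.

(** * Michal-Bastiani calculus *)

Section SmoothCalculus.
Context (R : realType).
Implicit Types E G H : tvsType R.

Lemma hausdorff_prod (T U : topologicalType) :
  hausdorff_space T -> hausdorff_space U -> hausdorff_space (T * U)%type.
Proof.
move=> hT hU [a b] [c d] cl; congr (_, _).
  apply: hT => A B nA nB.
  have [||[u v] /= [[]]] := cl (A `*` setT) (B `*` setT).
  - by exists (A, setT) => //=; split => //; exact: filterT.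
  - by exists (B, setT) => //=; split => //; exact: filterT.
  by move=> Au _ [Bu _]; exists u.
apply: hU => A B nA nB.
have [||[u v] /= [[]]] := cl (setT `*` A) (setT `*` B).
- by exists (setT, A) => //=; split => //; exact: filterT.
- by exists (setT, B) => //=; split => //; exact: filterT.
by move=> _ Au [_ Bu]; exists v.
Qed.

Lemma hausdorff_Ro : hausdorff_space R^o.
Proof. exact: Rhausdorff. Qed.

Lemma openXT (T U : topologicalType) (A : set T) :
  open A -> open (A `*` [set: U]).
Proof.
rewrite !openE => oA [a b] /= [/oA nA _].
by exists (A, setT) => //=; split => //; exact: filterT.
Qed.

Lemma Ck_cont k E G (U : set E) (f : E -> G) x :
  Ck k U f -> U x -> {for x, continuous f}.
Proof. by case: k => [|k] [c _]; exact: c. Qed.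

Lemma CkS k E G (U : set E) (f : E -> G) : Ck k.+1 U f -> Ck k U f.
Proof.
elim: k E G U f => [|k IH] E G U f [c [ex C]]; first by [].
by split => //; split => //; exact: IH.
Qed.

Lemma Ck_le m k E G (U : set E) (f : E -> G) : (m <= k)%N -> Ck k U f -> Ck m U f.
Proof.
by move=> /subnKC <-; elim: (k - m)%N => [|n IH]; rewrite ?addn0 // addnS => /CkS.
Qed.

(** Continuity and [dderiv] depend only on germs. The piece W and the local model g may vary with
    the point, as they must when a straightening of a subbundle exists only near each point. *)
Lemma Ck_local k E G (U : set E) (f : E -> G) :
  (forall x, U x -> exists W, exists g : E -> G,
     [/\ open W, W x, Ck k W g & forall y, W y -> f y = g y]) -> Ck k U f.
Proof.
have c0 E' G' (W : set E') (f' g : E' -> G') x : open W -> W x ->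
    (forall y, W y -> f' y = g y) -> \forall y \near x, g y = f' y.
  move=> oW Wx fg; apply: (filterS (P := W)) => [y /fg //|].
  exact: open_nbhs_nbhs.
have cc E' G' (W : set E') (f' g : E' -> G') x : open W -> W x ->
    (forall y, W y -> f' y = g y) -> {for x, continuous g} -> {for x, continuous f'}.
  move=> oW Wx fg cg; rewrite /prop_for /continuous_at (fg _ Wx).
  apply: cvg_trans cg; apply: near_eq_cvg.
  exact: c0 oW Wx fg.
elim: k E G U f => [|k IH] E G U f loc; split => //.
- by move=> x /loc[W [g [oW Wx [c _] fg]]]; exact: (cc _ _ _ _ _ _ oW Wx fg (c _ Wx)).
- by move=> x /loc[W [g [oW Wx [c _] fg]]]; exact: (cc _ _ _ _ _ _ oW Wx fg (c _ Wx)).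
split.
  move=> x h /loc[W [g [oW Wx [_ [ex _]] fg]]].
  have [l gl] := ex x h Wx; exists l; apply: has_dderiv_near gl.
  exact: c0 oW Wx fg.
apply: IH => -[x h] [/= /loc[W [g [oW Wx [_ [_ C]] fg]]] _].
exists (W `*` setT), (fun p => dderiv g p.1 p.2); split => //.
- exact: openXT.
- move=> [y k'] [/= Wy _]; apply: dderiv_near.
  by near=> z; apply: fg; near: z; exact: open_nbhs_nbhs.
Unshelve. all: by end_near. Qed.

Lemma Ck_eq k E G (U : set E) (f g : E -> G) : open U ->
  (forall x, U x -> g x = f x) -> Ck k U f -> Ck k U g.
Proof. by move=> oU fg C; apply: Ck_local => x Ux; exists U, f. Qed.

Lemma Ck_sub k E G (U V : set E) (f : E -> G) : open V -> U `<=` V ->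
  Ck k V f -> Ck k U f.
Proof. by move=> oV UV C; apply: Ck_local => x Ux; exists V, f; split => //; exact: UV. Qed.

Lemma Ck_cst k E G (U : set E) (c : G) : hausdorff_space G -> Ck k U (fun=> c).
Proof.
move=> hG; elim: k E U c => [|k IH] E U c;
  (split; first by [move=> x _; exact: cvg_cst]) => //.
split; first by [move=> x h _; exists 0; exact: has_dderiv_cst].
rewrite (_ : (fun _ => _) = fun=> 0); first exact: IH.
by apply/funext => p; apply: dderivE => //; exact: has_dderiv_cst.
Qed.

Lemma Ck_lin k E G (U : set E) (f : E -> G) : hausdorff_space G ->
  linear f -> continuous f -> Ck k U f.
Proof.
move=> hG; elim: k E U f => [|k IH] E U f lf cf; (split; first by [move=> x _; exact: cf]) => //.
split; first by [move=> x h _; exists (f h); exact: has_dderiv_lin].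
rewrite (_ : (fun _ => _) = f \o snd).
  apply: IH; first by move=> a p q /=; rewrite lf.
  by move=> p; apply: continuous_comp; [exact: cvg_snd|exact: cf].
by apply/funext => p; apply: dderivE => //; exact: has_dderiv_lin.
Qed.

Lemma Ck_pair k E G H (U : set E) (f : E -> G) (g : E -> H) :
  hausdorff_space G -> hausdorff_space H -> open U ->
  Ck k U f -> Ck k U g -> Ck k U (fun x => (f x, g x)).
Proof.
move=> hG hH; have cp E' (f' : E' -> G) (g' : E' -> H) x : {for x, continuous f'} ->
    {for x, continuous g'} -> {for x, continuous (fun x => (f' x, g' x))}.
  by move=> cf cg; exact: cvg_pairT cf cg.
elim: k E U f g => [|k IH] E U f g oU.
  by move=> [cf _] [cg _]; split => // x Ux; apply: cp; [exact: cf|exact: cg].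
move=> [cf [ef Cf]] [cg [eg Cg]].
split; first by [move=> x Ux; apply: cp; [exact: cf|exact: cg]].
split.
  move=> x h Ux; have [l fl] := ef x h Ux; have [m gm] := eg x h Ux.
  by exists (l, m); exact: has_dderiv_pair.
apply: Ck_eq (IH _ _ _ _ _ Cf Cg); try exact: openXT.
move=> [x h] [/= Ux _]; apply: dderivE; first exact: hausdorff_prod.
apply: has_dderiv_pair; apply: dderivP; [exact: ef|exact: eg].
Qed.

Lemma continuous_fst (T U : topologicalType) : continuous (fst : T * U -> T).
Proof. by move=> p; exact: cvg_fst. Qed.

Lemma continuous_snd (T U : topologicalType) : continuous (snd : T * U -> U).
Proof. by move=> p; exact: cvg_snd. Qed.

(** The derivative of the composite is again a composite, of [dderiv g] with (x, h) |-> (f x,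
    [dderiv f x h]), so the induction runs over all spaces at once. The induction hypothesis is used
    a second time to see that f after the first projection is C^k. *)
Lemma Ck_comp k E G H (U : set E) (V : set G) (f : E -> G) (g : G -> H) :
  hausdorff_space E -> hausdorff_space G -> hausdorff_space H ->
  open U -> open V -> (forall x, U x -> V (f x)) ->
  Ck k U f -> Ck k V g -> Ck k U (fun x => g (f x)).
Proof.
elim: k E G H U V f g => [|k IH] E G H U V f g hE hG hH oU oV UV Cf Cg.
  split => // x Ux; apply: continuous_comp.
    exact: Ck_cont Cf Ux.
  by apply: Ck_cont Cg _; exact: UV.
have C1f : C1 U f by exact: Ck_le Cf.
have C1g : C1 V g by exact: Ck_le Cg.
split.
  move=> x Ux; apply: continuous_comp.
    exact: Ck_cont Cf Ux.
  by apply: Ck_cont Cg _; exact: UV.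
have dgf x h : U x -> has_dderiv (fun x => g (f x)) x h (dderiv g (f x) (dderiv f x h)).
  move=> Ux; apply: (has_dderiv_comp hH oV C1g (UV _ Ux)).
  exact: C1_dderiv C1f Ux.
split; first by [move=> x h Ux; eexists; exact: dgf].
apply: (@Ck_eq _ _ _ _ (fun p => (fun q : G * G => dderiv g q.1 q.2) (f p.1, dderiv f p.1 p.2))).
- exact: openXT.
- by move=> [x h] [/= Ux _]; apply: dderivE => //; exact: dgf.
have hEE := hausdorff_prod hE hE.
apply: (IH (E * E)%type (G * G)%type H (U `*` setT) (V `*` setT)
    (fun p => (f p.1, dderiv f p.1 p.2)) (fun q => dderiv g q.1 q.2)) => //.
- exact: hausdorff_prod.
- exact: openXT.
- exact: openXT.
- by move=> p [/UV Vp _].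
- apply: Ck_pair => //.
  + exact: openXT.
  + apply: (IH (E * E)%type E G (U `*` setT) U fst f) => //.
    * exact: openXT.
    * by move=> p [].
    * by apply: Ck_lin => //; exact: continuous_fst.
    * exact: CkS Cf.
  + by case: Cf => [_ []].
- by case: Cg => [_ []].
Qed.

(** With a, b, c, d the values of f at the corners of a parallelogram, this exchanges the order in
    which the two differences are taken. *)
Lemma quotient_swap G (r t : R) (a b c d : G) :
  t^-1 *: ((r * t)^-1 *: (a - b) - (r * t)^-1 *: (c - d)) =
  r^-1 *: (t^-1 *: (t^-1 *: (a - c)) - t^-1 *: (t^-1 *: (b - d))).
Proof.
rewrite invfM -!scalerBr !scalerA mulrCA mulrA; congr (_ *: _).
by rewrite !opprB addrACA [RHS]addrACA; congr (_ + _); rewrite addrC.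
Qed.

(* Both iterated derivatives are the limit of the symmetric second difference
   quotient along the diagonal. *)
Lemma dderiv_sym E G (U : set E) (f : E -> G) x h k :
  hausdorff_space E -> hausdorff_space G -> open U -> Ck 2 U f -> U x ->
  dderiv (fun y => dderiv f y k) x h = dderiv (fun y => dderiv f y h) x k.
Proof.
move=> hE hG oU C2 Ux.
have C1f : C1 U f by exact: Ck_le C2.
pose Q h k (t : R) := t^-1 *: (t^-1 *: (f (x + t *: h + t *: k) - f (x + t *: k)))
  - t^-1 *: (t^-1 *: (f (x + t *: h) - f x)).
suff lim h' k' : Q h' k' @ (0 : R)^' --> dderiv (fun y => dderiv f y k') x h'.
  apply: (cvg_unique hG (lim h k)).
  have -> : Q h k = Q k h.
    apply/funext => t; rewrite /Q -!scalerBr; congr (_ *: (_ *: _)).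
    rewrite !opprB addrACA [RHS]addrACA; congr (_ + _); last exact: addrC.
    by rewrite addrAC.
  exact: lim.
have C1k : C1 U (fun y => dderiv f y k').
  apply: (@Ck_comp 1 _ _ _ U (U `*` setT) (fun y => (y, k')) (fun p => dderiv f p.1 p.2)) => //.
  - exact: hausdorff_prod.
  - exact: openXT.
  - apply: Ck_pair => //; last exact: Ck_cst.
    by apply: Ck_lin => // y; exact: cvg_id.
  - by case: C2 => [_ []].
move=> V /convex_nbhs[W [oW Wx cW WV]].
have nW : nbhs (dderiv (fun y => dderiv f y k') x h') W by exact: open_nbhs_nbhs.
have [A [B [d [nA nB d0] H1]]] := strong_dderiv_near hG oU C1k Ux nW.
have Bh : B h' by exact: nbhs_singleton.
have c2 : (fun p : R^o * R^o => x + p.1 *: h' + p.2 *: k') @ nbhs (0 : R^o, 0 : R^o) --> x.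
  have c1 : (fun p : R^o * R^o => p.1) @ nbhs (0 : R^o, 0 : R^o) --> (0 : R^o) by exact: cvg_fst.
  have c2 : (fun p : R^o * R^o => p.2) @ nbhs (0 : R^o, 0 : R^o) --> (0 : R^o) by exact: cvg_snd.
  have cx : (fun=> x) @ nbhs (0 : R^o, 0 : R^o) --> x by exact: cvg_cst.
  have ch : (fun=> h') @ nbhs (0 : R^o, 0 : R^o) --> h' by exact: cvg_cst.
  have ck : (fun=> k') @ nbhs (0 : R^o, 0 : R^o) --> k' by exact: cvg_cst.
  generalize (tvs_cvgD (tvs_cvgD cx (tvs_cvgZ c1 ch)) (tvs_cvgZ c2 ck)).
  by rewrite !scale0r !addr0.
have nAU : nbhs x (A `&` U) by apply: filterI => //; exact: open_nbhs_nbhs.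
have [[D1 D2] /= [[d1 d10 D1d] [d2 d20 D2d]] D12] := c2 _ nAU.
pose e := Num.min d (Num.min d1 d2).
exists e => /=; first by rewrite !lt_min d0 d10 d20.
move=> t /=; rewrite sub0r normrN !lt_min => /and3P[td td1 td2] t0; apply: WV.
have pt r s : `|r| <= `|t| -> `|s| <= `|t| -> (A `&` U) (x + r *: h' + s *: k').
  move=> rt st; apply: (D12 (r, s)); split; [apply: D1d|apply: D2d] => /=.
    by rewrite sub0r normrN; exact: le_lt_trans td1.
  by rewrite sub0r normrN; exact: le_lt_trans td2.
have st s : 0 <= s <= 1 -> `|s * t| <= `|t|.
  by move=> /andP[s0 s1]; rewrite normrM (ger0_norm s0) ler_piMl.
(* Along s the path moves in direction k', and its derivative is the quotient in direction h' of y
   |-> [dderiv f y k'] based at x + s t k'. The base point depends on s, so a strong derivative is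
   needed: [H1] keeps all these quotients in the convex set W. *)
have := @mean_value R G
  (fun s => t^-1 *: (t^-1 *: (f (x + t *: h' + (s * t) *: k') - f (x + (s * t) *: k'))))
  (fun s => t^-1 *: (dderiv f (x + (s * t) *: k' + t *: h') k' - dderiv f (x + (s * t) *: k') k')) W oW cW.
rewrite mul1r mul0r scale0r !addr0 => /= mv.
apply: mv => s s01.
  have [_ U1] := pt t (s * t) (lexx _) (st _ s01).
  have [_ U2] : (A `&` U) (x + 0 *: h' + (s * t) *: k').
    by apply: pt; rewrite ?normr0 // st.
  rewrite scale0r addr0 in U2.
  have l1 := cvg_comp _ _ (dnbhs0_mulr t0) (C1_dderiv k' C1f U1).
  have l2 := cvg_comp _ _ (dnbhs0_mulr t0) (C1_dderiv k' C1f U2).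
  have ct : (fun=> t^-1 : R^o) @ (0 : R)^' --> (t^-1 : R^o) by exact: cvg_cst.
  rewrite [x + (s * t) *: k' + t *: h']addrAC.
  generalize (tvs_cvgZ ct (tvs_cvgB l1 l2)).
  apply: cvg_trans; apply: near_eq_cvg; near=> r => /=.
  have e1 : x + t *: h' + ((s + r) * t) *: k' = x + t *: h' + (s * t) *: k' + (r * t) *: k'.
    by rewrite mulrDl scalerDl addrA.
  have e2 : x + ((s + r) * t) *: k' = x + (s * t) *: k' + (r * t) *: k'.
    by rewrite mulrDl scalerDl addrA.
  by rewrite e1 e2 quotient_swap.
apply: H1 => //.
have [+ _] : (A `&` U) (x + 0 *: h' + (s * t) *: k').
  by apply: pt; rewrite ?normr0 // st.
by rewrite scale0r addr0.
Unshelve. all: by end_near. Qed.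

End SmoothCalculus.

(** * Convergence in the dual *)

Section CountableBase.
Context (R : realType).

(** Stated for filters because it is needed both for neighbourhoods of a point and for the punctured
    neighbourhoods of 0 in R. *)
Definition cbase (I : Type) (Phi : set_system I) :=
  exists C : nat -> set I, (forall n, Phi (C n)) /\
    forall A, Phi A -> exists n, C n `<=` A.

Definition first_countable0 (E : tvsType R) := cbase (nbhs (0 : E)).

Lemma first_countable_cbase (E : tvsType R) (x : E) :
  first_countable0 E -> cbase (nbhs x).
Proof.
move=> [C [nC bC]]; exists (fun n => +%R x @` C n); split => [n|A nA].
  exact: nbhsT.
have := nbhsB (- x) nA; rewrite addNr => /bC[n Cn]; exists n.
by move=> _ [y /Cn [z Az <-] <-]; rewrite addrA subrr add0r.
Qed.

Lemma cbase_decreasing (I : Type) (Phi : set_system I) : Filter Phi -> cbase Phi ->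
  exists C : nat -> set I, [/\ forall n, Phi (C n),
    forall m n, (m <= n)%N -> C n `<=` C m &
    forall A, Phi A -> exists n, C n `<=` A].
Proof.
move=> FPhi [C [nC bC]].
pose D := fix D n := if n is n'.+1 then D n' `&` C n else C 0.
have DC n : D n `<=` C n by case: n => [|n] i //= [].
exists D; split.
- by elim=> [|n IH]; [exact: nC|exact: filterI].
- by move=> m n /subnKC <-; elim: (n - m)%N => [|k IH]; rewrite ?addn0 // addnS => i [/IH].
- by move=> A /bC[n Cn]; exists n => i /DC /Cn.
Qed.

Lemma first_countable_prod (E G : tvsType R) :
  first_countable0 E -> first_countable0 G -> first_countable0 (E * G)%type.
Proof.
move=> /cbase_decreasing[C [nC dC bC]] /cbase_decreasing[D [nD dD bD]].
exists (fun n => C n `*` D n); split => [n|A [[A1 A2] /= [/bC[n Cn] /bD[m Dm]] A12]].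
  by exists (C n, D n) => //=.
exists (maxn n m) => -[x y] [/= Cx Dy]; apply: A12; split => /=.
  by apply: Cn; apply: dC Cx; rewrite leq_maxl.
by apply: Dm; apply: dD Dy; rewrite leq_maxr.
Qed.

Lemma cbase_dnbhs0 : cbase (0 : R)^'.
Proof.
exists (fun n => [set t | `|t| < n.+1%:R^-1 /\ t != 0]); split => [n|A].
  by exists n.+1%:R^-1 => //= t; rewrite /= sub0r normrN.
move=> [d /= d0 dA]; have [n nd] := ltr_add_invr d0.
exists n => t /= [tn t0]; apply: dA => //=.
by rewrite sub0r normrN (lt_trans tn) //; move: nd; rewrite add0r.
Qed.

(** If P is not in the filter, every member of a decreasing base contains a point outside P, and
    these points form a sequence converging to the filter that avoids P. *)
Lemma cbase_seq (I : Type) (Phi : set_system I) (P : set I) : Filter Phi ->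
  cbase Phi ->
  (forall u : nat -> I, u @ \oo `=>` Phi -> exists n, P (u n)) -> Phi P.
Proof.
move=> FPhi /cbase_decreasing[C [nC dC bC]] H.
apply: contrapT => nP.
have /choice[u Hu] n : exists i, C n i /\ ~ P i.
  apply: contrapT => nex; apply: nP; apply: filterS (nC n) => i Ci.
  by apply: contrapT => nPi; apply: nex; exists i.
have [|n Pn] := H u; last by have [] := Hu n.
move=> A /bC[n Cn]; exists n => // m /= nm; apply: Cn; apply: dC nm _ _.
by have [] := Hu m.
Qed.

(** A filter on this set either clusters at the limit l or contains the finite set of terms
    preceding some index. This supplies the compact sets through which the hypothesis on B is
    used. *)
Lemma compact_range_cvg (T : topologicalType) (w : nat -> T) (l : T) :
  w @ \oo --> l -> compact (l |` range w).
Proof.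
move=> wl G PG GK; have [cl|ncl] := pselect (cluster G l).
  by exists l; split => //; left.
have [S [V [GS nV SV]]] : exists S V, [/\ G S, nbhs l V & ~ (S `&` V !=set0)].
  apply: contrapT => nex; apply: ncl => S V GS nV.
  by apply: contrapT => SV; apply: nex; exists S, V.
have [N _ NV] := wl _ nV.
have cA : compact (w @` `I_N) by apply: finite_compact; exact/finite_image/finite_II.
have GA : G (w @` `I_N).
  apply: filterS (filterI GS GK) => x [Sx [xl|[n _ wn]]].
    by exfalso; apply: SV; exists x; split => //; rewrite xl; exact: nbhs_singleton.
  have [nN|Nn] := ltnP n N; first by exists n.
  by exfalso; apply: SV; exists x; split => //; rewrite -wn; exact: NV.
by have [x [[n _ <-] cx]] := cA G PG GA; exists (w n); split => //; right; exists n.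
Qed.

End CountableBase.

Section DualLimits.
Context (R : realType) (F : tvsType R) (B : bornology F).
Hypothesis hBcompact : forall K : set F, compact K -> born_set B K.

Lemma dualB (a : dual B) v w : a (v - w) = (a v : R) - (a w : R) :> R.
Proof.
by rewrite [v - w]addrC -scaleN1r dual_linear scaleN1r addrC.
Qed.

Lemma dualD (a : dual B) v w : a (v + w) = (a v : R) + a w :> R.
Proof. by have := dual_linear a 1 v w; rewrite !scale1r. Qed.

Lemma dualZ (a : dual B) (k : R) v : a (k *: v) = k * (a v : R) :> R.
Proof. by have := dual_linear a k v 0; rewrite !addr0 dual0 addr0. Qed.

Lemma dual_funD (a b : dual B) v : (a + b) v = (a v : R) + b v :> R.
Proof. by []. Qed.

Lemma dual_funB (a b : dual B) v : (a - b) v = (a v : R) - (b v : R) :> R.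
Proof. by []. Qed.

Lemma dual_funZ (k : R) (a : dual B) v : (k *: a) v = k * (a v : R) :> R.
Proof. by []. Qed.

Lemma dual_ext (a b : dual B) : (forall v, a v = b v) -> a = b.
Proof. by move=> ab; apply/val_inj/funext. Qed.

Lemma born_set1 v : born_set B [set v].
Proof. by apply: hBcompact; exact: compact_set1. Qed.

(** Singletons are compact, hence belong to B, so convergence in the dual implies pointwise
    convergence. *)
Lemma hausdorff_dual : hausdorff_space (dual B).
Proof.
move=> a b cl; apply: dual_ext => v; apply: contrapT => ab.
have e0 : 0 < `|a v - b v| / 2 by rewrite divr_gt0 // normr_gt0 subr_eq0; exact/eqP.
pose N (c : dual B) := [set g : dual B | forall w, [set v] w -> `|c w - g w| < `|a v - b v| / 2].
have nN c : nbhs c (N c).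
  by apply/nbhs_dual; exists [set v], (`|a v - b v| / 2) => //; split => //; exact: born_set1.
have [g [/= ga gb]] := cl _ _ (nN a) (nN b).
have := ltrD (ga v erefl) (gb v erefl); rewrite -splitr.
rewrite [`|b v - _|]distrC ltNge => /negP; apply.
by rewrite -[a v - b v](subrKA (g v)) ler_normD.
Qed.

Lemma cvg_dual (I : Type) (Phi : set_system I) (FPhi : Filter Phi)
    (al : I -> dual B) (a : dual B) :
  al @ Phi --> a <-> forall b (e : R), born_set B b -> 0 < e ->
    Phi [set i | forall v, b v -> `|a v - al i v| < e].
Proof.
split=> [ala b e Bb e0|H P /nbhs_dual[b [e [Bb e0] bP]]].
  by apply: (ala [set g : dual B | forall v, b v -> `|a v - g v| < e]);
    apply/nbhs_dual; exists b, e.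
change (Phi (al @^-1` P)).
by apply: (filterS _ (H b e Bb e0)) => i Hi; exact: bP.
Qed.

Lemma dual_eval_continuous v : continuous (fun a : dual B => a v : R^o).
Proof.
move=> a; have : (fun a : dual B => a v : R^o) @ nbhs a --> (a v : R^o); last by [].
apply/cvgrPdist_lt => e e0.
have H : (fun a' : dual B => a') @ nbhs a --> a by exact: cvg_id.
move/cvg_dual/(_ _ _ (born_set1 v) e0) : H => H.
by apply: (filterS _ H) => a' /= h; exact: h.
Qed.

(** The substitute for joint continuity of evaluation. If the estimate failed along a sequence, a
    bad index j could be chosen for each term; the resulting vectors tend to 0 and together with 0
    form a compact set, hence a member of B, on which the forms converge uniformly. *)
Lemma eval_cvg0_unif (I J : Type) (Phi : set_system I) (FPhi : Filter Phi)
    (al : I -> dual B) (a : dual B) (b : set J) (w : I -> J -> F) (e : R) :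
  cbase Phi -> al @ Phi --> a ->
  (forall V : set F, nbhs 0 V -> Phi [set i | forall j, b j -> V (w i j)]) ->
  0 < e -> Phi [set i | forall j, b j -> `|al i (w i j) - a (w i j)| < e].
Proof.
move=> cPhi ala w0 e0; apply: cbase_seq => // u uPhi.
apply: contrapT => /forallNP H.
have /choice[v Hv] n : exists j, b j /\ e <= `|al (u n) (w (u n) j) - a (w (u n) j)|.
  apply: contrapT => nex; apply: (H n) => j bj; rewrite ltNge.
  by apply/negP => le; apply: nex; exists j.
pose z n := w (u n) (v n).
have z0 : z @ \oo --> (0 : F).
  move=> V nV.
  have h : (\oo : set_system nat) (u @^-1` [set i | forall j, b j -> V (w i j)]).
    exact: uPhi (w0 _ nV).
  change ((\oo : set_system nat) (z @^-1` V)); apply: (filterS _ h) => n /= Vn.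
  by apply: Vn; have [] := Hv n.
have := compact_range_cvg z0 => /hBcompact BK.
have /cvg_dual/(_ _ _ BK e0)/uPhi := ala.
move=> [N _ /(_ N (leqnn N))] /= HN.
have [_] := Hv N; rewrite leNgt => /negP; apply.
by rewrite distrC; apply: HN; right; exists N.
Qed.

(** The difference splits into (al - a)(w - w'), (al - a)(w') and a(w - w'). They are small by the
    preceding lemma, by convergence on the image of w', and by continuity of a; each gets a third of
    e. *)
Lemma eval_cvg_unif (I J : Type) (Phi : set_system I) (FPhi : Filter Phi)
    (al : I -> dual B) (a : dual B) (b : set J) (w : I -> J -> F) (w' : J -> F)
    (e : R) :
  cbase Phi -> al @ Phi --> a -> born_set B (w' @` b) ->
  (forall V : set F, nbhs 0 V -> Phi [set i | forall j, b j -> V (w i j - w' j)]) ->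
  0 < e -> Phi [set i | forall j, b j -> `|al i (w i j) - a (w' j)| < e].
Proof.
move=> cPhi ala Bw ww e0; have e3 : 0 < e / 3 by rewrite divr_gt0.
have H1 := eval_cvg0_unif FPhi cPhi ala ww e3.
have /cvg_dual/(_ _ _ Bw e3) H2 := ala.
have na : nbhs (0 : F) [set v | `|a v| < e / 3].
  have := @dual_continuous _ _ _ a 0 [set y : R^o | `|y| < e / 3]; rewrite dual0; apply.
  by apply/nbhs_ballP; exists (e / 3) => //= y; rewrite -ball_normE /= sub0r normrN.
have H3 := ww _ na.
apply: (filterS3 FPhi _ H1 H2 H3) => i /= h1 h2 h3 j bj.
have -> : al i (w i j) - a (w' j) = (al i (w i j - w' j) - a (w i j - w' j))
    - (a (w' j) - al i (w' j)) + a (w i j - w' j).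
  rewrite !dualB; lra.
have -> : e = e / 3 + e / 3 + e / 3 by lra.
apply: le_lt_trans (ler_normD _ _) _; apply: ltrD; last exact: h3.
apply: le_lt_trans (ler_normB _ _) _; apply: ltrD; first exact: h1.
by apply: h2; exists j.
Qed.

Lemma eval_cvg (I : Type) (Phi : set_system I) (FPhi : Filter Phi)
    (al : I -> dual B) (a : dual B) (x : I -> F) (x' : F) :
  cbase Phi -> al @ Phi --> a -> x @ Phi --> x' ->
  (fun i => al i (x i) : R^o) @ Phi --> (a x' : R^o).
Proof.
move=> cPhi ala xx; apply/cvgrPdist_lt => e e0.
have Bx : born_set B ((fun _ : unit => x') @` setT).
  by rewrite (_ : _ @` _ = [set x']); [exact: born_set1|apply/seteqP; split => [_ [? _ <-]|_ ->] //; exists tt].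
have := @eval_cvg_unif I unit Phi FPhi al a setT (fun i _ => x i) (fun=> x') e cPhi ala Bx _ e0.
move=> H; have : Phi [set i | forall j : unit, setT j -> `|al i (x i) - a x'| < e].
  apply: H => V nV; have cx : (fun=> x') @ Phi --> x' by exact: cvg_cst.
  have xx0 : (fun i => x i - x') @ Phi --> (0 : F).
    by rewrite -(subrr x'); exact: (tvs_cvgB xx cx).
  have h : Phi [set i | V (x i - x')] := xx0 _ nV.
  by apply: (filterS _ h) => i Vi j _.
move=> h; change (Phi [set i | `|a x' - al i (x i)| < e]).
by apply: (filterS _ h) => i /(_ tt Logic.I); rewrite distrC.
Qed.

(** Leibniz rule for the evaluation pairing. It holds although the pairing is not continuous,
    because t tends to 0 along a filter with a countable base. The quotient of [al] is evaluated at
    the moved vector, that of X is paired with the form at y. *)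
Lemma has_dderiv_eval (E : tvsType R) (al : E -> dual B) (X : E -> F) y h a x :
  has_dderiv al y h a -> has_dderiv X y h x ->
  has_dderiv (fun y => al y (X y) : R^o) y h (a (X y) + al y x : R^o).
Proof.
move=> dal dX.
have H1 : (fun t : R => (t^-1 *: (al (y + t *: h) - al y) : dual B) (X (y + t *: h)) : R^o)
    @ (0 : R)^' --> (a (X y) : R^o).
  exact: (eval_cvg _ (@cbase_dnbhs0 R) dal (has_dderiv_cont dX)).
have H2 : (fun t : R => al y (t^-1 *: (X (y + t *: h) - X y)) : R^o) @ (0 : R)^' --> (al y x : R^o).
  by apply: (cvg_comp _ _ dX (@dual_continuous _ _ _ (al y) x)).
generalize (tvs_cvgD H1 H2); apply: cvg_trans; apply: near_eq_cvg; near=> t.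
cbv beta; rewrite dualZ dualB dual_funZ dual_funB -mulrDr.
by rewrite addrA subrK.
Unshelve. all: by end_near. Qed.

End DualLimits.

(** * Smooth families of linear maps *)

Section ToDual.
Context (R : realType) (F : tvsType R) (B : bornology F).

Lemma to_dualE (g : F -> R^o) : linear g -> continuous g ->
  forall v, to_dual B g v = g v.
Proof.
move=> lg cg; have mg : g \in @dual_pred R F by apply/asboolP.
by apply: (@xgetPex _ 0 [set a : dual B | forall v, a v = g v]); exists (Dual B mg).
Qed.

Lemma to_dual_id (a : dual B) (g : F -> R) : (forall v, g v = a v) -> to_dual B g = a.
Proof.
move=> ga; apply: dual_ext => v; rewrite -ga.
by apply: (@xgetPex _ 0 [set a : dual B | forall v, a v = g v]); exists a => w /=.
Qed.

(** The transpose of g applied to a; meaningful when g is linear and continuous. *)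
Definition pull (a : dual B) (g : F -> F) : dual B := to_dual B (fun v => a (g v)).

Lemma pullE (a : dual B) (g : F -> F) v : linear g -> continuous g ->
  pull a g v = a (g v).
Proof.
move=> lg cg; rewrite /pull to_dualE //.
  by move=> k u w; rewrite lg dualD dualZ.
by move=> u; apply: continuous_comp; [exact: cg|exact: dual_continuous].
Qed.

End ToDual.

Section LinearFamilies.
Context (R : realType).

Lemma lin0 (V W : lmodType R) (f : V -> W) : linear f -> f 0 = 0.
Proof. by move=> lf; have := lf (-1) 0 0; rewrite scaler0 addr0 scaleN1r addNr. Qed.

Lemma linD (V W : lmodType R) (f : V -> W) u v : linear f -> f (u + v) = f u + f v.
Proof. by move=> lf; have := lf 1 u v; rewrite !scale1r. Qed.

Lemma linZ (V W : lmodType R) (f : V -> W) k u : linear f -> f (k *: u) = k *: f u.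
Proof. by move=> lf; have := lf k u 0; rewrite !addr0 lin0 // addr0. Qed.

Lemma linB (V W : lmodType R) (f : V -> W) u v : linear f -> f (u - v) = f u - f v.
Proof. by move=> lf; rewrite -scaleN1r linD // linZ // scaleN1r. Qed.

Lemma setXT (T T' : Type) (U : set T) (x : T) (y : T') : U x -> (U `*` setT) (x, y).
Proof. by []. Qed.

Section Family.
Context (E G H : tvsType R) (U : set E) (T : E * G -> H).
Hypotheses (hH : hausdorff_space H)
  (oU : open U) (lT : forall y, U y -> linear (fun v => T (y, v))).

(* For small fixed t0, linearity turns T(y',v) - T(y,v) into a difference
   quotient of T between (y, t0 v) and (y', t0 v), both close to (y, 0). *)
Lemma lin_family_unif_cont y (b : set G) (V : set H) :
  C1 (U `*` setT) T -> U y -> tvs_bounded b -> nbhs 0 V ->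
  \forall y' \near y, forall v, b v -> V (T (y', v) - T (y, v)).
Proof.
move=> C1T Uy bb nV.
(* The derivative in direction 0 vanishes, so a neighbourhood of 0 is a neighbourhood of this
   derivative. *)
have V0 : nbhs (dderiv T (y, 0) (0, 0)) V by rewrite (dderiv0 (G := H)).
have [A [D [d [nA nD d0] HV]]] :=
  strong_dderiv_near hH (openXT (U := G) oU) C1T (setXT 0 Uy) V0.
have [[A1 A2] /= [nA1 nA2] A12] := nA.
have [[D1 D2] /= [nD1 nD2] D12] := nD.
have sc : (fun z : R^o * G => z.1 *: z.2) @ nbhs (0 : R^o, 0 : G) --> (0 : G).
  by have := @scale_continuous R G (0, 0); rewrite /continuous_at /= scale0r.
have [[S W] /= [[e e0 eS] nW] SW] := sc _ nA2.
have [r br] := bb _ nW.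
(* The first bound puts t0 below d. The second gives |t0 r| < e, which moves t0 v into [A2] for
   every v in b, because b lies in r W; adding 1 to |r| keeps the denominator positive. *)
pose t0 := Num.min (d / 2) (e / 2 / (`|r| + 1)).
have r1 : 0 < `|r| + 1 by rewrite ltr_wpDl.
have t0_gt0 : 0 < t0 by rewrite lt_min !divr_gt0.
have t0d : `|t0| < d.
  by rewrite gtr0_norm // gt_min ltr_pdivrMr // ltr_pMr // ltr1n.
have t0r : `|t0 * r| < e.
  rewrite normrM (gtr0_norm t0_gt0).
  apply: (@le_lt_trans _ _ (e / 2)); last by rewrite ltr_pdivrMr // ltr_pMr // ltr1n.
  apply: (@le_trans _ _ (e / 2 / (`|r| + 1) * (`|r| + 1))).
    by apply: ler_pM => //; [exact: ltW|rewrite ge_min lexx orbT|rewrite lerDl].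
  by rewrite divfK // gt_eqF.
have nD1' : nbhs y [set y' | D1 (t0^-1 *: (y' - y))].
  have c1 : (fun y' : E => y') @ nbhs y --> y by exact: cvg_id.
  have c2 : (fun=> y) @ nbhs y --> y by exact: cvg_cst.
  have c3 : (fun=> t0^-1 : R^o) @ nbhs y --> (t0^-1 : R^o) by exact: cvg_cst.
  have : (fun y' : E => t0^-1 *: (y' - y)) @ nbhs y --> (0 : E).
    by rewrite -(scaler0 _ (t0^-1)) -(subrr y); exact: (tvs_cvgZ c3 (tvs_cvgB c1 c2)).
  by move=> /(_ _ nD1).
have nU : nbhs y U by exact: open_nbhs_nbhs.
apply: filterS (filterI nD1' nU) => y' [/= Dy' Uy'] v bv.
have A2v : A2 (t0 *: v).
  have [w Ww <-] := br _ bv; rewrite scalerA; apply: (SW (t0 * r, w)); split => //=.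
  by apply: eS => /=; rewrite sub0r normrN.
have t00 : t0 != 0 by rewrite gt_eqF.
have := HV (y, t0 *: v) (t0^-1 *: (y' - y), 0) t0.
have -> : (y, t0 *: v) + t0 *: (t0^-1 *: (y' - y), 0 : G) = (y', t0 *: v).
  congr (_, _) => /=; last by rewrite scaler0 addr0.
  by rewrite scalerA mulfV // scale1r addrC subrK.
rewrite (linZ t0 v (lT Uy)) (linZ t0 v (lT Uy')) -scalerBr scalerA mulVf // scale1r.
apply => //; first by apply: A12; split => //=; exact: nbhs_singleton.
by apply: D12; split => //=; exact: nbhs_singleton.
Qed.

Lemma lin_family_continuous y : (forall p, (U `*` setT) p -> {for p, continuous T}) ->
  U y -> continuous (fun v => T (y, v)).
Proof.
move=> cT Uy v.
apply: (@continuous_comp G (E * G)%type H (fun v => (y, v)) T).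
  by apply: cvg_pairT; [exact: cvg_cst|exact: cvg_id].
exact: cT.
Qed.

(** Linearity in v passes to the limit of the quotients, so the estimates for linear families apply
    to the derivative family as well. *)
Lemma lin_family_dderiv y h : C1 (U `*` setT) T -> U y ->
  linear (fun v => dderiv T (y, v) (h, 0)).
Proof.
move=> C1T Uy k v w; apply: dderivE => //.
have dv u := C1_dderiv (h, 0) C1T (setXT u Uy).
have ck : (fun=> k : R^o) @ (0 : R)^' --> (k : R^o) by exact: cvg_cst.
generalize (tvs_cvgD (tvs_cvgZ ck (dv v)) (dv w)).
apply: cvg_trans; apply: near_eq_cvg.
have nU : \forall t \near (0 : R)^', U (y + t *: h).
  by apply: (line_cvg h (x := y)); exact: open_nbhs_nbhs.
near=> t; have Ut : U (y + t *: h) by near: t.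
have e u : (y, u) + t *: (h, 0 : G) = (y + t *: h, u).
  by congr (_, _) => /=; rewrite scaler0 addr0.
rewrite !e (lT Ut) (lT Uy) !scalerBr !scalerDr !scalerA [k * _]mulrC opprD.
by rewrite !addrA; congr (_ + _); rewrite addrAC.
Unshelve. all: by end_near. Qed.

End Family.

(** The direction h joins the base point as a parameter in E * E, so the derivative is a family of
    the same kind and an induction can continue with it. *)
Lemma lin_family_Ck_dderiv k (E G H : tvsType R) (U : set E) (T : E * G -> H) :
  hausdorff_space E -> hausdorff_space G -> hausdorff_space H -> open U ->
  Ck k.+1 (U `*` setT) T ->
  Ck k ((U `*` setT) `*` setT) (fun q : (E * E) * G => dderiv T (q.1.1, q.2) (q.1.2, 0)).
Proof.
move=> hE hG hH oU CT.
have hEG := hausdorff_prod hE hG.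
have hEEG := hausdorff_prod (hausdorff_prod hE hE) hG.
apply: (@Ck_comp _ k _ _ _ ((U `*` setT) `*` setT) ((U `*` setT) `*` setT)
   (fun q : (E * E) * G => ((q.1.1, q.2), (q.1.2, 0 : G)))
   (fun p => dderiv T p.1 p.2)) => //.
- exact: hausdorff_prod.
- by do 2 apply: openXT.
- by do 2 apply: openXT.
- apply: Ck_lin; first exact: hausdorff_prod.
    move=> c [[a b] g] [[a' b'] g'] /=; congr (_, _); congr (_, _) => /=.
    by rewrite scaler0 addr0.
  move=> [[a b] g].
  have c1 : (fun q : (E * E) * G => q.1) @ nbhs ((a, b), g) --> (a, b) by exact: cvg_fst.
  have c2 : (fun q : (E * E) * G => q.2) @ nbhs ((a, b), g) --> g by exact: cvg_snd.
  have c11 : fst @ nbhs (a, b) --> a by exact: cvg_fst.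
  have c12 : snd @ nbhs (a, b) --> b by exact: cvg_snd.
  have c0 : (fun=> (0 : G)) @ nbhs ((a, b), g) --> (0 : G) by exact: cvg_cst.
  by apply: cvg_pairT; apply: cvg_pairT => //; [exact: cvg_comp c1 c11|exact: cvg_comp c1 c12].
- by case: CT => [_ []].
Qed.

(** The difference quotient in s of the path s |-> t^-1 T(y + s t h, v) - s c, to which the mean
    value theorem is applied below. *)
Lemma quotient_affine (G : tvsType R) (r s t : R) (a b c : G) : r != 0 ->
  (r * t)^-1 *: (a - b) - c =
  r^-1 *: (t^-1 *: a - (s + r) *: c - (t^-1 *: b - s *: c)).
Proof.
move=> r0; rewrite opprB [s *: c - _]addrC addrACA -scalerBr scalerDl opprD.
rewrite addrAC addNr add0r [RHS]scalerBr !scalerA mulVf // scale1r.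
by rewrite invfM.
Qed.

(* On the segment from y to y + t h the derivative of T in direction h is
   uniformly close, on bounded sets, to its value at y. *)
Lemma lin_family_unif_dderiv (E G H : tvsType R) (U : set E) (T : E * G -> H)
    y h (b : set G) (V : set H) :
  hausdorff_space E -> hausdorff_space G -> hausdorff_space H -> open U ->
  (forall y, U y -> linear (fun v => T (y, v))) ->
  Ck 2 (U `*` setT) T -> U y -> tvs_bounded b -> nbhs 0 V ->
  \forall t \near (0 : R)^', forall v, b v ->
    V (t^-1 *: (T (y + t *: h, v) - T (y, v)) - dderiv T (y, v) (h, 0)).
Proof.
move=> hE hG hH oU lT C2T Uy bb /convex_nbhs[W [oW W0 cW WV]].
have C1T : C1 (U `*` setT) T by exact: Ck_le C2T.
pose T' (p : E * G) := dderiv T (p.1, p.2) (h, 0).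
(* Here the order 2 of T is spent: with h frozen, [T'] is a linear family of class C^1, and the
   uniform continuity lemma applies to it. *)
have C1T' : C1 (U `*` setT) T'.
  apply: (@Ck_comp _ 1 _ _ _ (U `*` setT) ((U `*` setT) `*` setT)
    (fun p : E * G => ((p.1, h), p.2))
    (fun q : (E * E) * G => dderiv T (q.1.1, q.2) (q.1.2, 0))) => //.
  - exact: hausdorff_prod.
  - exact/hausdorff_prod/hG/hausdorff_prod.
  - exact: openXT.
  - by do 2 apply: openXT.
  - have o2 := openXT (U := G) oU.
    apply: Ck_pair => //; first exact: hausdorff_prod.
      apply: Ck_pair => //; last exact: Ck_cst.
      by apply: Ck_lin => //; exact: continuous_fst.
    by apply: Ck_lin => //; exact: continuous_snd.
  - exact: lin_family_Ck_dderiv.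
have lT' z : U z -> linear (fun v => T' (z, v)).
  by move=> Uz; exact: (lin_family_dderiv hH oU lT h C1T Uz).
have nW : nbhs 0 W by exact: open_nbhs_nbhs.
have near1 := lin_family_unif_cont hH oU lT' C1T' Uy bb nW.
have nU : nbhs y U by exact: open_nbhs_nbhs.
have c : (fun t : R^o => y + t *: h) @ nbhs (0 : R^o) --> y.
  have c0 : (fun t : R^o => t) @ nbhs (0 : R^o) --> (0 : R^o) by exact: cvg_id.
  have ch : (fun _ : R^o => h) @ nbhs (0 : R^o) --> h by exact: cvg_cst.
  have cx : (fun _ : R^o => y) @ nbhs (0 : R^o) --> y by exact: cvg_cst.
  by generalize (tvs_cvgD cx (tvs_cvgZ c0 ch)); rewrite scale0r addr0.
have [d d0 Hd] := c _ (filterI near1 nU).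
exists d => //= t; rewrite /= sub0r normrN => td t0 v bv; apply: WV.
have seg s : 0 <= s <= 1 -> W (T' (y + (s * t) *: h, v) - T' (y, v)) /\ U (y + (s * t) *: h).
  move=> /andP[s0 s1].
  have [] : ([set y' | forall v, b v -> W (T' (y', v) - T' (y, v))] `&` U) (y + (s * t) *: h).
    apply: Hd => /=; rewrite sub0r normrN normrM (ger0_norm s0).
    by apply: le_lt_trans td; rewrite ler_piMl.
  by move=> /(_ _ bv).
(* Subtracting s T'(y, v) makes the increment of the path from 0 to 1 exactly the error to be
   bounded, and its derivative the difference of values of [T'] controlled by [near1]. *)
have := @mean_value R H (fun s => t^-1 *: T (y + (s * t) *: h, v) - s *: T' (y, v))
  (fun s => T' (y + (s * t) *: h, v) - T' (y, v)) W oW cW.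
rewrite mul1r mul0r !scale0r addr0 scale1r subr0 addrAC -scalerBr; apply.
  move=> s /seg[_ Us].
  have l1 := cvg_comp _ _ (dnbhs0_mulr t0)
    (C1_dderiv (h, 0) C1T (setXT v Us)).
  have l2 : (fun _ : R => T' (y, v)) @ (0 : R)^' --> T' (y, v) by exact: cvg_cst.
  generalize (tvs_cvgB l1 l2); apply: cvg_trans; apply: near_eq_cvg; near=> r.
  have r0 : r != 0 by near: r; exact: nbhs_dnbhs_neq.
  rewrite /=.
  have -> : (y + (s * t) *: h, v) + (r * t) *: (h, 0 : G) = (y + ((s + r) * t) *: h, v).
    by congr (_, _) => /=; rewrite ?scaler0 ?addr0 // mulrDl scalerDl addrA.
  by rewrite (quotient_affine s) //.
by move=> s /seg[].
Unshelve. all: by end_near. Qed.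

End LinearFamilies.

(** * Pulling back smooth families of forms *)

Section PullBack.
Context (R : realType) (F : tvsType R) (B : bornology F).
Hypothesis hF : hausdorff_space F.
Hypothesis hBcompact : forall K : set F, compact K -> born_set B K.
Hypothesis hBendo : forall T : F -> F, linear T -> continuous T ->
  forall b, born_set B b -> born_set B (T @` b).

(** Uniformity of the pulled back forms on b amounts to uniformity on the image of b under w', which
    lies in B because B is stable under continuous endomorphisms. *)
Lemma pull_cvg (I : Type) (Phi : set_system I) (FPhi : Filter Phi)
    (al : I -> dual B) (a : dual B) (w : I -> F -> F) (w' : F -> F) :
  cbase Phi -> al @ Phi --> a -> linear w' -> continuous w' ->
  Phi [set i | linear (w i) /\ continuous (w i)] ->
  (forall b V, born_set B b -> nbhs (0 : F) V ->
    Phi [set i | forall v, b v -> V (w i v - w' v)]) ->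
  (fun i => pull (al i) (w i)) @ Phi --> pull a w'.
Proof.
move=> cPhi ala lw cw lcw ww; apply/cvg_dual => b e Bb e0.
have H1 := eval_cvg_unif hBcompact FPhi cPhi ala (hBendo lw cw Bb)
  (fun V nV => ww b V Bb nV) e0.
apply: (filterS2 FPhi _ H1 lcw) => i /= h1 [lwi cwi] v bv.
by rewrite !pullE // distrC; exact: h1.
Qed.

Section Derivative.
Context (E : tvsType R) (U : set E) (T : E * F -> F).
Hypotheses (hE : hausdorff_space E) (oU : open U)
  (lT : forall y, U y -> linear (fun v => T (y, v))).

(** The increment splits into the quotient of [al] pulled back along the moved map, and the fixed
    form [al y] pulled back along the quotient of T. The first needs uniform continuity of T on
    bounded sets, the second uniform differentiability. *)
Lemma has_dderiv_pull (al : E -> dual B) y h a :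
  Ck 2 (U `*` setT) T -> U y -> has_dderiv al y h a ->
  has_dderiv (fun y => pull (al y) (fun v => T (y, v))) y h
    (pull a (fun v => T (y, v)) + pull (al y) (fun v => dderiv T (y, v) (h, 0))).
Proof.
move=> C2 Uy dal.
have C1T : C1 (U `*` setT) T by exact: Ck_le C2.
have cT z : U z -> continuous (fun v => T (z, v)).
  move=> Uz; apply: (lin_family_continuous (U := U)) => // p Up.
  exact: Ck_cont C1T Up.
have nU : \forall t \near (0 : R)^', U (y + t *: h).
  by apply: (line_cvg h (x := y)); exact: open_nbhs_nbhs.
have lD := lin_family_dderiv hF oU lT h C1T Uy.
have cD : continuous (fun v => dderiv T (y, v) (h, 0)).
  move=> v; apply: (@continuous_comp F ((E * F) * (E * F))%type F
    (fun v => ((y, v), (h, 0 : F))) (fun p => dderiv T p.1 p.2)); last first.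
    exact: (C1_cont C1T (setXT v Uy)).
  by apply: cvg_pairT; [apply: cvg_pairT; [exact: cvg_cst|exact: cvg_id]|exact: cvg_cst].
have H1 : (fun t : R => pull (t^-1 *: (al (y + t *: h) - al y) : dual B)
    (fun v => T (y + t *: h, v))) @ (0 : R)^' --> pull a (fun v => T (y, v)).
  apply: pull_cvg => //.
  - exact: cbase_dnbhs0.
  - exact: lT.
  - exact: cT.
  - by apply: (filterS _ nU) => t Ut; split; [exact: lT|exact: cT].
  - move=> b V /born_bounded bb nV.
    exact: (line_cvg h _ (lin_family_unif_cont hF oU lT C1T Uy bb nV)).
have H2 : (fun t : R => pull (al y) (fun v => t^-1 *: (T (y + t *: h, v) - T (y, v))))
    @ (0 : R)^' --> pull (al y) (fun v => dderiv T (y, v) (h, 0)).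
  apply: pull_cvg => //.
  - exact: cbase_dnbhs0.
  - exact: cvg_cst.
  - apply: (filterS _ nU) => t Ut; split.
      move=> k u v; rewrite (lT Ut) (lT Uy) opprD addrACA -scalerBr scalerDr.
      by rewrite !scalerA mulrC.
    move=> v; have ct : (fun=> t^-1 : R^o) @ nbhs v --> (t^-1 : R^o) by exact: cvg_cst.
    exact: (tvs_cvgZ ct (tvs_cvgB (cT _ Ut v) (cT _ Uy v))).
  - move=> b V /born_bounded bb nV.
    exact: (lin_family_unif_dderiv h hE hF hF oU lT C2 Uy bb nV).
generalize (tvs_cvgD H1 H2); apply: cvg_trans; apply: near_eq_cvg; near=> t.
have Ut : U (y + t *: h) by near: t.
have cq : continuous (fun v => t^-1 *: (T (y + t *: h, v) - T (y, v))).
  move=> v; have ct : (fun=> t^-1 : R^o) @ nbhs v --> (t^-1 : R^o) by exact: cvg_cst.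
  exact: (tvs_cvgZ ct (tvs_cvgB (cT _ Ut v) (cT _ Uy v))).
have lq : linear (fun v => t^-1 *: (T (y + t *: h, v) - T (y, v))).
  move=> k u v; rewrite (lT Ut) (lT Uy) opprD addrACA -scalerBr scalerDr.
  by rewrite !scalerA mulrC.
have [lt ly] := (lT Ut, lT Uy); have [ct cy] := (cT _ Ut, cT _ Uy).
cbv beta; apply: dual_ext => v.
rewrite dual_funZ dual_funB dual_funD !pullE // dual_funZ dual_funB.
by rewrite dualZ dualB -mulrDr addrA subrK.
Unshelve. all: by end_near. Qed.

End Derivative.

Lemma Ck_addf k (E G : tvsType R) (U : set E) (f g : E -> G) :
  hausdorff_space E -> hausdorff_space G -> open U ->
  Ck k U f -> Ck k U g -> Ck k U (fun x => f x + g x).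
Proof.
move=> hE hG oU Cf Cg; have hGG := hausdorff_prod hG hG.
apply: (@Ck_comp _ k _ _ _ U setT (fun x => (f x, g x)) (fun p : G * G => p.1 + p.2)) => //.
- exact: openT.
- exact: Ck_pair.
- apply: Ck_lin => //; last exact: add_continuous.
  by move=> a [x y] [x' y'] /=; rewrite scalerDr addrACA.
Qed.

(** The derivative is a sum of two pull-backs over E * E, of [dderiv al] along T and of [al] along
    the derivative family. T is smooth of all orders, so differentiating it costs nothing in the
    induction on k, and E * E is again first countable. *)
Lemma Ck_pull k (E : tvsType R) (U : set E) (T : E * F -> F) (al : E -> dual B) :
  hausdorff_space E -> first_countable0 E -> open U ->
  (forall y, U y -> linear (fun v => T (y, v))) ->
  smooth_on (U `*` setT) T -> Ck k U al ->
  Ck k U (fun y => pull (al y) (fun v => T (y, v))).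
Proof.
have hd := hausdorff_dual hBcompact.
elim: k E U T al => [|k IH] E U T al hE fE oU lT sT Ca;
  have cont : forall y, U y -> {for y, continuous (fun y => pull (al y) (fun v => T (y, v)))}.
- move=> y Uy; have cT z : U z -> continuous (fun v => T (z, v)).
    move=> Uz; apply: (lin_family_continuous (U := U)) => // p Up.
    exact: Ck_cont (sT 0%N) Up.
  apply: pull_cvg.
  + exact: first_countable_cbase.
  + exact: Ck_cont Ca Uy.
  + exact: lT.
  + exact: cT.
  + apply: (filterS (P := U)); last exact: open_nbhs_nbhs.
    by move=> z Uz; split; [exact: lT|exact: cT].
  + move=> b V /born_bounded bb nV.
    exact: (lin_family_unif_cont hF oU lT (sT 1%N) Uy bb nV).
- by [].
- by move=> y Uy; exact: (Ck_cont (IH _ _ _ _ hE fE oU lT sT (CkS Ca)) Uy).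
split => //.
have [_ [exa Cda]] := Ca.
have dP y h : U y -> has_dderiv (fun y => pull (al y) (fun v => T (y, v))) y h
    (pull (dderiv al y h) (fun v => T (y, v)) +
     pull (al y) (fun v => dderiv T (y, v) (h, 0))).
  move=> Uy; apply: (has_dderiv_pull hE oU lT (sT 2%N) Uy).
  exact/dderivP/exa.
split; first by [move=> y h Uy; eexists; exact: dP].
have hEE := hausdorff_prod hE hE.
have fEE := first_countable_prod fE fE.
have oUT := openXT (U := E) oU.
apply: (@Ck_eq _ k _ _ _ (fun p : E * E =>
    pull (dderiv al p.1 p.2) (fun v => T (p.1, v)) +
    pull (al p.1) (fun v => dderiv T (p.1, v) (p.2, 0)))) => //.
  by move=> [y h] [/= Uy _]; apply: dderivE => //; exact: dP.
have CkU j (f : E -> dual B) : Ck j U f -> Ck j (U `*` [set: E]) (fun p : E * E => f p.1).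
  move=> Cf; apply: (@Ck_comp _ j _ _ _ (U `*` setT) U fst f) => //.
    by move=> p [].
  by apply: Ck_lin => //; exact: continuous_fst.
apply: Ck_addf => //.
  apply: (IH _ _ (fun q : (E * E) * F => T (q.1.1, q.2))) => //.
  - by move=> [y h] [/= Uy _]; exact: lT.
  - move=> j; apply: (@Ck_comp _ j _ _ _ ((U `*` setT) `*` setT) (U `*` setT)
      (fun q : (E * E) * F => (q.1.1, q.2)) T) => //.
    + exact: hausdorff_prod.
    + exact: hausdorff_prod.
    + exact: openXT.
    + exact: openXT.
    + by move=> [[y h] v] [[/= Uy _] _].
    + apply: Ck_lin; first exact: hausdorff_prod.
        by move=> c [[a b] v] [[a' b'] v'].
      move=> [[a b] v].
      have c1 : (fun q : (E * E) * F => q.1) @ nbhs ((a, b), v) --> (a, b) by exact: cvg_fst.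
      have c2 : (fun q : (E * E) * F => q.2) @ nbhs ((a, b), v) --> v by exact: cvg_snd.
      have c11 : fst @ nbhs (a, b) --> a by exact: cvg_fst.
      by apply: cvg_pairT => //; exact: cvg_comp c1 c11.
apply: (IH _ _ (fun q : (E * E) * F => dderiv T (q.1.1, q.2) (q.1.2, 0))) => //.
- by move=> [y h] [/= Uy _]; exact: (lin_family_dderiv hF oU lT h (sT 1%N) Uy).
- by move=> j; apply: lin_family_Ck_dderiv.
- exact/CkU/CkS.
Qed.

(** By the chain rule only scalar multiplication itself has to be treated. Its derivative is a sum
    of two copies of it, composed with continuous linear maps, which gives an induction on k. *)
Lemma Ck_scale k (E G : tvsType R) (U : set E) (f : E -> R^o) (g : E -> G) :
  hausdorff_space E -> hausdorff_space G -> open U ->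
  Ck k U f -> Ck k U g -> Ck k U (fun x => f x *: g x).
Proof.
move=> hE hG; have hR := @hausdorff_Ro R; have hRG := hausdorff_prod hR hG.
suff sc : Ck k setT (fun p : R^o * G => p.1 *: p.2).
  move=> oU Cf Cg.
  apply: (@Ck_comp _ k _ _ _ U setT (fun x => (f x, g x)) (fun p : R^o * G => p.1 *: p.2)) => //.
    exact: openT.
  exact: Ck_pair.
move=> {E U f g hE}.
elim: k => [|k IH]; (split; first by [move=> p _; exact: scale_continuous]) => //.
have d (p q : R^o * G) : has_dderiv (fun p : R^o * G => p.1 *: p.2) p q (p.1 *: q.2 + q.1 *: p.2).
  case: p q => [r x] [s y] /=.
  have c1 : (fun t : R => r + t *: s : R^o) @ (0 : R)^' --> (r : R^o) by exact: (line_cvg (E := R^o)).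
  have cy : (fun _ : R => y) @ (0 : R)^' --> y by exact: cvg_cst.
  have cx : (fun _ : R => s *: x) @ (0 : R)^' --> s *: x by exact: cvg_cst.
  generalize (tvs_cvgD (tvs_cvgZ c1 cy) cx); apply: cvg_trans; apply: near_eq_cvg; near=> t.
  have t0 : t != 0 by near: t; exact: nbhs_dnbhs_neq.
  have e : (r + t *: s) *: (x + t *: y) - r *: x = t *: ((r + t *: s) *: y + s *: x).
    rewrite scalerDr addrAC -scalerBl [r + _]addrC addrK [RHS]scalerDr [RHS]addrC.
    by rewrite !scalerA [t * (_ + _)]mulrC.
  by rewrite /= e scalerA mulVf // scale1r.
split; first by [move=> p q _; eexists; exact: d].
have hRG2 := hausdorff_prod hRG hRG.
apply: (@Ck_eq _ k _ _ _ (fun p : (R^o * G) * (R^o * G) => p.1.1 *: p.2.2 + p.2.1 *: p.1.2)).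
- by apply: openXT; exact: openT.
- by move=> [p q] _; apply: dderivE => //; exact: d.
have oT : open [set: (R^o * G) * (R^o * G)] by exact: openT.
have c1 (p : (R^o * G) * (R^o * G)) : (fun q : (R^o * G) * (R^o * G) => q.1) @ nbhs p --> p.1.
  exact: cvg_fst.
have c2 (p : (R^o * G) * (R^o * G)) : (fun q : (R^o * G) * (R^o * G) => q.2) @ nbhs p --> p.2.
  exact: cvg_snd.
have d1 (p : R^o * G) : fst @ nbhs p --> p.1 by exact: cvg_fst.
have d2 (p : R^o * G) : snd @ nbhs p --> p.2 by exact: cvg_snd.
have C (f : (R^o * G) * (R^o * G) -> R^o * G) : linear f -> continuous f ->
    Ck k (setT `*` setT) (fun p => (f p).1 *: (f p).2).
  move=> lf cf; apply: (@Ck_comp _ k _ _ _ (setT `*` setT) setT f (fun p => p.1 *: p.2)) => //.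
  - by apply: openXT; exact: openT.
  - exact: openT.
  - exact: Ck_lin.
apply: Ck_addf => //.
- by apply: openXT; exact: openT.
- apply: (C (fun p => (p.1.1, p.2.2))).
    by move=> a [[x y] [x' y']] [[z w] [z' w']].
  by move=> p; apply: cvg_pairT; [exact: cvg_comp (c1 p) (d1 _)|exact: cvg_comp (c2 p) (d2 _)].
- apply: (C (fun p => (p.2.1, p.1.2))).
    by move=> a [[x y] [x' y']] [[z w] [z' w']].
  by move=> p; apply: cvg_pairT; [exact: cvg_comp (c2 p) (d1 _)|exact: cvg_comp (c1 p) (d2 _)].
Unshelve. all: by end_near. Qed.

End PullBack.

(** * Brackets in a chart *)

(* Values of forms are generalized to real variables first: unification on their
   arguments is very slow. *)
Ltac form_generalize :=
  repeat match goal with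
  | |- context [@dual_fun ?R ?F ?B ?a ?v] =>
      let z := fresh "z" in generalize (@dual_fun R F B a v : Num.NumDomain.sort R) => z
  end; clear.

Ltac form_lra := form_generalize; move=> *; lra.

Ltac form_ring := form_generalize; move=> *; subst; ring.

Section LocalBrackets.
Context (R : realType).

(** The cancellations in the Jacobi identity for vector fields: a, c and i stand for the second
    derivatives of Z, Y and X, the other letters for iterated first derivatives such as
    dZ(dY(X)). *)
Lemma jacobi_terms (W : zmodType) (a b c d e f g h i : W) :
  a + b - (c + d) - (e - f) =
  b - g - (c + h - (i + f)) + (a + g - (i + e) - (d - h)).
Proof.
rewrite !opprD !opprK !addrA [LHS](ACl (2*3*6*1*5*4)).
by rewrite [RHS](ACl (1*3*6*7*10*11*(8*2)*(12*4)*(5*9))) /= !subrr !addr0.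
Qed.

(** The total derivative is split along (w, 0) + (0, z); linearity in the second variable identifies
    the second part. *)
Lemma has_dderiv_family (E G H : tvsType R) (U : set E) (T : E * G -> H)
    (Z : E -> G) y w z :
  hausdorff_space H -> open U -> (forall y, U y -> linear (fun v => T (y, v))) ->
  C1 (U `*` setT) T -> U y -> has_dderiv Z y w z ->
  has_dderiv (fun y => T (y, Z y)) y w (dderiv (fun y' => T (y', Z y)) y w + T (y, z)).
Proof.
move=> hH oU lT C1T Uy dZ.
have oUT := openXT (U := G) oU.
have UyZ : (U `*` [set: G]) (y, Z y) by [].
have id_d : has_dderiv (fun y : E => y) y w w by apply: has_dderiv_lin.
have d0 := has_dderiv_comp (f := fun y => (y, Z y)) hH oUT C1T UyZ (has_dderiv_pair id_d dZ).
have d1 := has_dderiv_comp (f := fun y' => (y', Z y)) hH oUT C1T UyZ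
  (has_dderiv_pair id_d (has_dderiv_cst (Z y) y w)).
have d2 := has_dderiv_comp (f := fun v => (y, v)) (x := Z y) (h := z) hH oUT C1T UyZ
  (has_dderiv_pair (has_dderiv_cst y (Z y) z) (@has_dderiv_lin R G G id (Z y) z (fun a b c => erefl))).
have -> : T (y, z) = dderiv T (y, Z y) (0, z).
  by rewrite -(dderivE hH d2); apply/esym/dderivE => //; apply: has_dderiv_lin; exact: lT.
rewrite (dderivE hH d1) -(dderivD _ _ hH oUT C1T UyZ).
by have -> : (w, 0) + (0, z) = (w, z) :> E * G by congr (_, _); rewrite /= ?addr0 ?add0r.
Qed.

Lemma has_dderiv_dderiv (E G : tvsType R) (U : set E) (Z : E -> E)
    (g : E -> G) y w z :
  hausdorff_space G -> open U -> Ck 2 U g -> U y -> has_dderiv Z y w z ->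
  has_dderiv (fun y => dderiv g y (Z y)) y w
    (dderiv (fun y' => dderiv g y' (Z y)) y w + dderiv g y z).
Proof.
move=> hG oU C2 Uy dZ.
apply: (has_dderiv_family (T := fun p => dderiv g p.1 p.2) hG oU) => //.
  by move=> x Ux; apply: dderiv_linear (Ux) => //; exact: Ck_le C2.
by case: C2 => [_ []].
Qed.

Context (F : tvsType R) (B : bornology F).
Hypothesis hF : hausdorff_space F.
Hypothesis hBcompact : forall K : set F, compact K -> born_set B K.

Definition lbr (X Y : F -> F) (y : F) : F := dderiv Y y (X y) - dderiv X y (Y y).

(* the form part [L_X be - i_Y d al] of the Dorfman bracket in a chart *)
Definition lform (X : F -> F) (al : F -> dual B) (Y : F -> F) (be : F -> dual B)
    (y v : F) : R :=
  (dderiv be y (X y) v : R) + be y (dderiv X y v) - (dderiv al y (Y y) v : R) +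
  dderiv al y v (Y y).

(** X and X' are phi-related vector fields. *)
Definition pmap_rel (U : set F) (phi X X' : F -> F) :=
  forall y, U y -> X' (phi y) = dderiv phi y (X y).

(** [be] is the pull-back of [be'] along phi; in this form phi is never inverted. *)
Definition pform_rel (U : set F) (phi : F -> F) (be be' : F -> dual B) :=
  forall y v, U y -> be' (phi y) (dderiv phi y v) = be y v.

(** * Covariance of the local brackets under a change of chart *)

Section Covariance.
Context (U V : set F) (phi : F -> F) (y : F).
Hypotheses (oU : open U) (oV : open V) (Cphi : Ck 2 U phi)
  (UV : forall z, U z -> V (phi z)) (Uy : U y).

Let C1phi : C1 U phi. Proof. exact: Ck_le Cphi. Qed.

Let nU : nbhs y U. Proof. exact: open_nbhs_nbhs. Qed.

(** Obtained by differentiating X'(phi z) = dphi(z)(X z) in z by the chain rule on one side and the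
    product rule on the other. *)
Lemma dderiv_pmap (X X' : F -> F) w : C1 U X -> C1 V X' -> pmap_rel U phi X X' ->
  dderiv X' (phi y) (dderiv phi y w) =
    dderiv (fun y' => dderiv phi y' (X y)) y w + dderiv phi y (dderiv X y w).
Proof.
move=> CX CX' rX.
have d1 := has_dderiv_comp hF oV CX' (UV Uy) (C1_dderiv w C1phi Uy).
apply: (has_dderiv_unique hF d1).
apply: (has_dderiv_near (f := fun z => dderiv phi z (X z))).
  by apply: (filterS _ nU) => z Uz; rewrite /= rX.
by apply: (has_dderiv_dderiv (U := U)) => //; exact: C1_dderiv CX Uy.
Qed.

Lemma lbr_pmap (X X' Y Y' : F -> F) : C1 U X -> C1 V X' -> C1 U Y -> C1 V Y' ->
  pmap_rel U phi X X' -> pmap_rel U phi Y Y' ->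
  lbr X' Y' (phi y) = dderiv phi y (lbr X Y y).
Proof.
move=> CX CX' CY CY' rX rY; rewrite /lbr (rX _ Uy) (rY _ Uy).
rewrite (dderiv_pmap _ CX CX' rX) (dderiv_pmap _ CY CY' rY).
rewrite (dderiv_sym (Y y) (X y) hF hF oU Cphi Uy).
rewrite (linB _ _ (dderiv_linear hF oU C1phi Uy)).
by rewrite opprD addrACA subrr add0r.
Qed.

(** Obtained by differentiating be'(phi z)(dphi(z) v) = be(z)(v) with v fixed; the second derivative
    of phi appears because the vector dphi(z) v moves. *)
Lemma dderiv_pform (be be' : F -> dual B) v w : C1 U be -> C1 V be' ->
  pform_rel U phi be be' ->
  dderiv be y w v = (dderiv be' (phi y) (dderiv phi y w) (dderiv phi y v) : R) +
    be' (phi y) (dderiv (fun y' => dderiv phi y' v) y w) :> R.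
Proof.
move=> Cb Cb' rb; have hd := hausdorff_dual hBcompact.
have d1 := has_dderiv_comp hd oV Cb' (UV Uy) (C1_dderiv w C1phi Uy).
have dv : has_dderiv (fun y' => dderiv phi y' v) y w
    (dderiv (fun y' => dderiv phi y' v) y w).
  apply: dderivP; eexists; exact: (has_dderiv_dderiv hF oU Cphi Uy (has_dderiv_cst v y w)).
have d2 := has_dderiv_eval hBcompact d1 dv.
have d3 := has_dderiv_eval hBcompact (C1_dderiv w Cb Uy) (has_dderiv_cst v y w).
rewrite dual0 addr0 in d3.
apply: (has_dderiv_unique (@hausdorff_Ro R) d3).
apply: (has_dderiv_near _ d2).
by apply: (filterS _ nU) => z Uz; rewrite /= rb.
Qed.

(** The second derivatives of phi cancel by symmetry: the one from d be' against the one from dX',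
    and the two from d al' against each other. *)
Lemma lform_pmap (X X' Y Y' : F -> F) (al al' be be' : F -> dual B) v :
  C1 U X -> C1 V X' -> C1 U Y -> C1 V Y' ->
  C1 U al -> C1 V al' -> C1 U be -> C1 V be' ->
  pmap_rel U phi X X' -> pmap_rel U phi Y Y' ->
  pform_rel U phi al al' -> pform_rel U phi be be' ->
  lform X' al' Y' be' (phi y) (dderiv phi y v) = lform X al Y be y v.
Proof.
move=> CX CX' CY CY' Ca Ca' Cb Cb' rX rY ra rb; rewrite /lform.
have e1 := dderiv_pform v (X y) Cb Cb' rb.
have e2 := dderiv_pform v (Y y) Ca Ca' ra.
have e3 := dderiv_pform (Y y) v Ca Ca' ra.
have eX : be' (phi y) (dderiv X' (phi y) (dderiv phi y v)) =
    (be' (phi y) (dderiv (fun y' => dderiv phi y' (X y)) y v) : R) +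
    be' (phi y) (dderiv phi y (dderiv X y v)).
  by rewrite (dderiv_pmap v CX CX' rX) dualD.
have sX : be' (phi y) (dderiv (fun y' => dderiv phi y' v) y (X y)) =
    be' (phi y) (dderiv (fun y' => dderiv phi y' (X y)) y v).
  by rewrite (dderiv_sym (X y) v hF hF oU Cphi Uy).
have rX' := rb y (dderiv X y v) Uy.
have sY : al' (phi y) (dderiv (fun y' => dderiv phi y' v) y (Y y)) =
    al' (phi y) (dderiv (fun y' => dderiv phi y' (Y y)) y v).
  by rewrite (dderiv_sym (Y y) v hF hF oU Cphi Uy).
rewrite (rX y Uy) (rY y Uy).
move: e1 e2 e3 eX sX rX' sY; form_lra.
Qed.

End Covariance.

(** * Jacobi identities in a chart *)

Section Jacobi.
Context (V : set F) (y : F).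
Hypotheses (oV : open V) (Vy : V y).

Lemma has_dderiv_lbr (X Y : F -> F) w : Ck 2 V X -> Ck 2 V Y ->
  has_dderiv (lbr X Y) y w
    (dderiv (fun z => dderiv Y z (X y)) y w + dderiv Y y (dderiv X y w)
     - (dderiv (fun z => dderiv X z (Y y)) y w + dderiv X y (dderiv Y y w))).
Proof.
move=> CX CY.
have CX1 : C1 V X by exact: Ck_le CX.
have CY1 : C1 V Y by exact: Ck_le CY.
apply: has_dderiv_sub.
  exact: (has_dderiv_dderiv hF oV CY Vy (C1_dderiv w CX1 Vy)).
exact: (has_dderiv_dderiv hF oV CX Vy (C1_dderiv w CY1 Vy)).
Qed.

Lemma lbr_jacobi (X Y Z : F -> F) : Ck 2 V X -> Ck 2 V Y -> Ck 2 V Z ->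
  lbr X (lbr Y Z) y = lbr (lbr X Y) Z y + lbr Y (lbr X Z) y.
Proof.
move=> CX CY CZ.
have l (G : F -> F) : Ck 2 V G -> linear (dderiv G y).
  move=> C; have C1G : C1 V G by exact: Ck_le C.
  exact: (dderiv_linear hF oV C1G Vy).
have e G H w : Ck 2 V G -> Ck 2 V H -> _ :=
  fun CG CH => dderivE hF (@has_dderiv_lbr G H w CG CH).
rewrite {1}/lbr (e Y Z _ CY CZ) [X in _ = X + _]/lbr (e X Y _ CX CY).
rewrite [X in _ = _ + X]/lbr (e X Z _ CX CZ).
rewrite (linB _ _ (l _ CX)) (linB _ _ (l _ CY)) (linB _ _ (l _ CZ)).
rewrite (dderiv_sym (Z y) (X y) hF hF oV CY Vy).
rewrite (dderiv_sym (Z y) (Y y) hF hF oV CX Vy).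
rewrite (dderiv_sym (Y y) (X y) hF hF oV CZ Vy).
exact: jacobi_terms.
Qed.

Lemma has_dderiv_lform (X Y : F -> F) (al be : F -> dual B) v w :
  Ck 2 V X -> Ck 2 V Y -> Ck 2 V al -> Ck 2 V be ->
  has_dderiv (fun z => lform X al Y be z v : R^o) y w
    ((dderiv (fun z => dderiv be z (X y)) y w v : R) + dderiv be y (dderiv X y w) v
     + ((dderiv be y w (dderiv X y v) : R) + be y (dderiv (fun z => dderiv X z v) y w))
     - ((dderiv (fun z => dderiv al z (Y y)) y w v : R) + dderiv al y (dderiv Y y w) v)
     + ((dderiv (fun z => dderiv al z v) y w (Y y) : R) + dderiv al y v (dderiv Y y w)) : R^o).
Proof.
move=> CX CY Ca Cb; have hd := hausdorff_dual hBcompact.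
have CX1 : C1 V X by exact: Ck_le CX.
have CY1 : C1 V Y by exact: Ck_le CY.
have Cb1 : C1 V be by exact: Ck_le Cb.
have ev (ga : F -> dual B) d : has_dderiv ga y w d ->
    has_dderiv (fun z => ga z v : R^o) y w (d v : R^o).
  move=> dga; have := has_dderiv_eval hBcompact dga (has_dderiv_cst v y w).
  by rewrite dual0 addr0.
have dd (G : tvsType R) (f : F -> G) : hausdorff_space G -> Ck 2 V f ->
    has_dderiv (fun z => dderiv f z v) y w (dderiv (fun z => dderiv f z v) y w).
  move=> hG Cf; apply: dderivP; eexists.
  exact: (has_dderiv_dderiv hG oV Cf Vy (has_dderiv_cst v y w)).
have t1 := ev _ _ (has_dderiv_dderiv hd oV Cb Vy (C1_dderiv w CX1 Vy)).
have t2 := has_dderiv_eval hBcompact (C1_dderiv w Cb1 Vy) (dd _ _ hF CX).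
have t3 := ev _ _ (has_dderiv_dderiv hd oV Ca Vy (C1_dderiv w CY1 Vy)).
have t4 := has_dderiv_eval hBcompact (dd _ _ hd Ca) (C1_dderiv w CY1 Vy).
exact: (has_dderiv_add (has_dderiv_sub (has_dderiv_add t1 t2) t3) t4).
Qed.

(** [lform] prescribes only the values of [ga]. As [ga] is assumed C^1 into the dual, evaluating at
    a fixed v commutes with differentiation, and the derivative is read off from these values. *)
Lemma dderiv_lform (X Y : F -> F) (al be ga : F -> dual B) v w :
  Ck 2 V X -> Ck 2 V Y -> Ck 2 V al -> Ck 2 V be -> C1 V ga ->
  (forall z v, V z -> ga z v = lform X al Y be z v) ->
  dderiv ga y w v =
    (dderiv (fun z => dderiv be z (X y)) y w v : R) + dderiv be y (dderiv X y w) v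
     + ((dderiv be y w (dderiv X y v) : R) + be y (dderiv (fun z => dderiv X z v) y w))
     - ((dderiv (fun z => dderiv al z (Y y)) y w v : R) + dderiv al y (dderiv Y y w) v)
     + ((dderiv (fun z => dderiv al z v) y w (Y y) : R) + dderiv al y v (dderiv Y y w)) :> R.
Proof.
move=> CX CY Ca Cb Cg gaE.
have d1 := @has_dderiv_lform X Y al be v w CX CY Ca Cb.
refine (has_dderiv_unique (@hausdorff_Ro R) _ d1).
have := has_dderiv_eval hBcompact (C1_dderiv w Cg Vy) (has_dderiv_cst v y w).
rewrite dual0 addr0; apply: has_dderiv_near.
have nV : nbhs y V by exact: open_nbhs_nbhs.
by apply: (filterS _ nV) => z Vz; exact: gaE.
Qed.

(** [g], [a1] and [b1] are the form parts of the inner brackets [t, u], [s, t] and [s, u]. Once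
    their derivatives are expanded and mixed second derivatives identified by symmetry, the claim is
    a linear consequence of equations between real numbers. *)
Lemma lform_jacobi (X Y Z : F -> F) (al be ga g a1 b1 : F -> dual B) v :
  Ck 2 V X -> Ck 2 V Y -> Ck 2 V Z -> Ck 2 V al -> Ck 2 V be -> Ck 2 V ga ->
  C1 V g -> C1 V a1 -> C1 V b1 ->
  (forall z v, V z -> g z v = lform Y be Z ga z v) ->
  (forall z v, V z -> a1 z v = lform X al Y be z v) ->
  (forall z v, V z -> b1 z v = lform X al Z ga z v) ->
  lform X al (lbr Y Z) g y v =
    lform (lbr X Y) a1 Z ga y v + lform Y be (lbr X Z) b1 y v.
Proof.
move=> CX CY CZ Ca Cb Cg C1g C1a C1b gE aE bE.
have hd := hausdorff_dual hBcompact.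
have lin1 (G : tvsType R) (f : F -> G) : hausdorff_space G -> Ck 2 V f -> linear (dderiv f y).
  move=> hG C; have C1f : C1 V f by exact: Ck_le C.
  exact: (dderiv_linear hG oV C1f Vy).
have e G H w : Ck 2 V G -> Ck 2 V H -> _ :=
  fun CG CH => dderivE hF (@has_dderiv_lbr G H w CG CH).
have eg := dderiv_lform v (X y) CY CZ Cb Cg C1g gE.
have ea1 := dderiv_lform v (Z y) CX CY Ca Cb C1a aE.
have ea2 := dderiv_lform (Z y) v CX CY Ca Cb C1a aE.
have eb := dderiv_lform v (Y y) CX CZ Ca Cg C1b bE.
have gX := gE y (dderiv X y v) Vy.
have bY := bE y (dderiv Y y v) Vy.
have lw (f : F -> dual B) u u' w : Ck 2 V f ->
    dderiv f y (u - u') w = (dderiv f y u w : R) - (dderiv f y u' w : R).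
  by move=> Cf; rewrite (linB _ _ (lin1 _ _ hd Cf)) dual_funB.
have sw (f : F -> dual B) u u' w : Ck 2 V f ->
    dderiv (fun z => dderiv f z u) y u' w = dderiv (fun z => dderiv f z u') y u w.
  by move=> Cf; rewrite (dderiv_sym u' u hF hd oV Cf Vy).
have sv (f : dual B) (G : F -> F) u u' : Ck 2 V G ->
    f (dderiv (fun z => dderiv G z u) y u') = f (dderiv (fun z => dderiv G z u') y u).
  by move=> CG; rewrite (dderiv_sym u' u hF hF oV CG Vy).
have gXY : ga y (dderiv (lbr X Y) y v) =
    (ga y (dderiv (fun z => dderiv Y z (X y)) y v) : R) + ga y (dderiv Y y (dderiv X y v))
    - ((ga y (dderiv (fun z => dderiv X z (Y y)) y v) : R) + ga y (dderiv X y (dderiv Y y v)) : R).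
  by rewrite (e X Y v CX CY) dualB !dualD.
have h1 := lw al (dderiv Z y (Y y)) (dderiv Y y (Z y)) v Ca.
have h2 : dderiv al y v (lbr Y Z y) =
    (dderiv al y v (dderiv Z y (Y y)) : R) - (dderiv al y v (dderiv Y y (Z y)) : R).
  by rewrite dualB.
have h3 := lw ga (dderiv Y y (X y)) (dderiv X y (Y y)) v Cg.
have h4 := lw be (dderiv Z y (X y)) (dderiv X y (Z y)) v Cb.
have h5 : dderiv be y v (lbr X Z y) =
    (dderiv be y v (dderiv Z y (X y)) : R) - (dderiv be y v (dderiv X y (Z y)) : R).
  by rewrite dualB.
have s1 := sw ga (X y) (Y y) v Cg.
have s2 := sw be (X y) (Z y) v Cb.
have s3 := sw be (X y) v (Z y) Cb.
have s4 := sv (ga y) Y v (X y) CY.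
have s5 := sv (ga y) X v (Y y) CX.
have s6 := sv (be y) X v (Z y) CX.
have s7 := sw al (Y y) (Z y) v Ca.
have s8 := sw al (Y y) v (Z y) Ca.
have s9 := sw al (Z y) v (Y y) Ca.
move: eg gX h1 h2 h3 gXY ea1 ea2 eb bY h4 h5 s1 s2 s3 s4 s5 s6 s7 s8 s9.
rewrite /lform -/(lbr Y Z y) -/(lbr X Y y) -/(lbr X Z y).
clear; form_lra.
Qed.

End Jacobi.
End LocalBrackets.

(** * Charts and local representatives *)

Notation tr c d := (fun y => cfun d (cinv c y)).

Section Charts.
Context (R : realType) (F : tvsType R) (M : manifold F).
Hypothesis hF : hausdorff_space F.
Implicit Types (c d e : chart F M) (x : M) (v w : F).

(** [cset c (cdom c)] is the whole image of the chart, and [cset c (cdom d)] the domain of the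
    transition map from c to d. *)
Definition cset c (A : set M) : set F := c @` (cdom c `&` A).

Lemma cset_in c A x : cdom c x -> A x -> cset c A (c x).
Proof. by move=> cx Ax; exists x. Qed.

Lemma cset_out c A y : cset c A y ->
  [/\ cdom c (cinv c y), A (cinv c y) & c (cinv c y) = y].
Proof. by move=> [x [cx Ax] <-]; rewrite cfunK. Qed.

Lemma cset_open c A : open A -> open (cset c A).
Proof.
move=> oA; rewrite openE => y [x [cx Ax] xy].
have Iy : (c @` cdom c) y by exists x.
have nA : nbhs (cinv c y) A by apply: open_nbhs_nbhs; split => //; rewrite -xy cfunK.
have h1 : nbhs y (cinv c @^-1` A) := cinv_continuous Iy nA.
have h2 : nbhs y (c @` cdom c) by apply: open_nbhs_nbhs; split => //; exact: cimg_open.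
apply: (filterS _ (filterI h1 h2)) => z [/= Az [x' cx' x'z]].
by exists x' => //; split => //; move: Az; rewrite -x'z cfunK.
Qed.

Lemma tr_smooth c d : atlas M c -> atlas M d -> smooth_on (cset c (cdom d)) (tr c d).
Proof. by move=> ac ad; exact: atlas_smooth. Qed.

Lemma cset_cdom_open c d : open (cset c (cdom d)).
Proof. by apply: cset_open; exact: cdom_open. Qed.

Lemma near_chart c A x : open A -> cdom c x -> A x -> \forall y \near c x, cset c A y.
Proof.
move=> oA cx Ax; apply: open_nbhs_nbhs; split; first exact: cset_open.
exact: cset_in.
Qed.

(** The cocycle identity of the tangent bundle. Since [tcoord] and [tcoord_inv] are derivatives of
    transition maps from and to the preferred chart, their relations below are instances of it. *)
Lemma dtr_comp a b c x v : atlas M a -> atlas M b -> atlas M c ->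
  cdom a x -> cdom b x -> cdom c x ->
  dderiv (tr b c) (b x) (dderiv (tr a b) (a x) v) = dderiv (tr a c) (a x) v.
Proof.
move=> aa ab ac ax bx cx.
have Ib : cset b (cdom c) (b x) by exact: cset_in.
have Ia : cset a (cdom b) (a x) by exact: cset_in.
have bE : tr a b (a x) = b x by rewrite cfunK.
rewrite -{1}bE in Ib; rewrite -{1}bE.
have h := has_dderiv_comp hF (cset_cdom_open b c) (tr_smooth ab ac 1%N) Ib
  (C1_dderiv v (tr_smooth aa ab 1%N) Ia).
apply/esym/dderivE => //; apply: has_dderiv_near h.
apply: (filterS _ (near_chart (cdom_open b) ax bx)) => y /cset_out[_ by_ _] /=.
by rewrite cfunK.
Qed.

Lemma dtr_id c x v : cdom c x -> dderiv (tr c c) (c x) v = v.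
Proof.
move=> cx; apply: dderivE => //.
apply: (has_dderiv_near (f := id)); last exact: has_dderiv_lin.
by apply: (filterS _ (near_chart (cdom_open c) cx cx)) => y /cset_out[_ _ ->].
Qed.

Lemma dtr_linear c d x : atlas M c -> atlas M d -> cdom c x -> cdom d x ->
  linear (dderiv (tr c d) (c x)).
Proof.
move=> ac ad cx dx.
exact: (dderiv_linear hF (cset_cdom_open c d) (tr_smooth ac ad 1%N) (cset_in cx dx)).
Qed.

Lemma dtr_continuous c d x : atlas M c -> atlas M d -> cdom c x -> cdom d x ->
  continuous (dderiv (tr c d) (c x)).
Proof.
move=> ac ad cx dx.
exact: (dderiv_continuous (tr_smooth ac ad 1%N) (cset_in cx dx)).
Qed.

Let at_atlas x : atlas M (chart_at x) := chart_at_atlas x.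
Let at_dom x : cdom (chart_at x) x := chart_at_dom x.

Lemma tcoord_linear c x : atlas M c -> cdom c x -> linear (tcoord c x).
Proof. by move=> ac cx; exact: (dtr_linear (at_atlas x) ac (at_dom x) cx). Qed.

Lemma tcoord_inv_linear c x : atlas M c -> cdom c x -> linear (tcoord_inv c x).
Proof. by move=> ac cx; exact: (dtr_linear ac (at_atlas x) cx (at_dom x)). Qed.

Lemma tcoord_continuous c x : atlas M c -> cdom c x -> continuous (tcoord c x).
Proof. by move=> ac cx; exact: (dtr_continuous (at_atlas x) ac (at_dom x) cx). Qed.

Lemma tcoord_inv_continuous c x : atlas M c -> cdom c x -> continuous (tcoord_inv c x).
Proof. by move=> ac cx; exact: (dtr_continuous ac (at_atlas x) cx (at_dom x)). Qed.

Lemma tcoord_invK c x w : atlas M c -> cdom c x -> tcoord c x (tcoord_inv c x w) = w.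
Proof.
move=> ac cx; rewrite /tcoord /tcoord_inv (dtr_comp w ac (at_atlas x) ac cx (at_dom x) cx).
exact: dtr_id.
Qed.

Lemma tcoordK c x v : atlas M c -> cdom c x -> tcoord_inv c x (tcoord c x v) = v.
Proof.
move=> ac cx; rewrite /tcoord /tcoord_inv.
by rewrite (dtr_comp v (at_atlas x) ac (at_atlas x) (at_dom x) cx (at_dom x)) dtr_id.
Qed.

Lemma tcoord_tr c d x v : atlas M c -> atlas M d -> cdom c x -> cdom d x ->
  dderiv (tr c d) (c x) (tcoord c x v) = tcoord d x v.
Proof. by move=> ac ad cx dx; exact: (dtr_comp v (at_atlas x) ac ad (at_dom x) cx dx). Qed.

Lemma tcoord_inv_tr c d x w : atlas M c -> atlas M d -> cdom c x -> cdom d x ->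
  tcoord_inv d x (dderiv (tr c d) (c x) w) = tcoord_inv c x w.
Proof. by move=> ac ad cx dx; exact: (dtr_comp w ac ad (at_atlas x) cx dx (at_dom x)). Qed.

Lemma tcoord_at x v : tcoord (chart_at x) x v = v.
Proof. exact: dtr_id. Qed.

Lemma tcoord_inv_at x v : tcoord_inv (chart_at x) x v = v.
Proof. exact: dtr_id. Qed.

End Charts.

(** * Linearity and continuity of the functionals handed to [to_dual] *)

Section LinearForms.
Context (R : realType) (F : tvsType R) (B : bornology F).
Hypothesis hBcompact : forall K : set F, compact K -> born_set B K.
Context (p : F) (a : dual B) (L : F -> dual B) (L' : F -> F).

Lemma linear_evalD : linear L -> linear L' ->
  linear (fun v => (L v p : R) + a (L' v) : R^o).
Proof.
move=> lL lL' k u v; rewrite lL lL'.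
have e1 := dual_funD (k *: L u) (L v) p.
have e2 := dual_funZ k (L u) p.
have e3 := dualD a (k *: L' u) (L' v).
have e4 := dualZ a k (L' u).
rewrite e1 e2 e3 e4.
change (k * (L u p : R) + L v p + (k * (a (L' u) : R) + a (L' v)) =
  k * ((L u p : R) + a (L' u)) + ((L v p : R) + a (L' v))).
by move: (L u p : R) (L v p : R) (a (L' u) : R) (a (L' v) : R) => *; ring.
Qed.

Lemma linear_evalB : linear L -> linear (fun v => (a v : R) - (L v p : R) : R^o).
Proof.
move=> lL k u v; rewrite lL.
have e1 := dual_funD (k *: L u) (L v) p.
have e2 := dual_funZ k (L u) p.
have e3 := dualD a (k *: u) v.
have e4 := dualZ a k u.
rewrite e1 e2 e3 e4.
change (k * (a u : R) + a v - (k * (L u p : R) + L v p) =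
  k * ((a u : R) - (L u p : R)) + ((a v : R) - (L v p : R))).
by move: (L u p : R) (L v p : R) (a u : R) (a v : R) => *; ring.
Qed.

Lemma continuous_evalD : continuous L -> continuous L' ->
  continuous (fun v => (L v p : R) + a (L' v) : R^o).
Proof.
move=> cL cL' u.
have c3 : (fun v => L v p : R^o) @ nbhs u --> (L u p : R^o).
  exact: (cvg_comp _ _ (cL u) (@dual_eval_continuous R F B hBcompact p _)).
have c4 : (fun v => a (L' v) : R^o) @ nbhs u --> (a (L' u) : R^o).
  exact: (cvg_comp _ _ (cL' u) (@dual_continuous _ _ _ a _)).
exact: (tvs_cvgD c3 c4).
Qed.

Lemma continuous_evalB : continuous L ->
  continuous (fun v => (a v : R) - (L v p : R) : R^o).
Proof.
move=> cL u.
have c3 : (fun v => L v p : R^o) @ nbhs u --> (L u p : R^o).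
  exact: (cvg_comp _ _ (cL u) (@dual_eval_continuous R F B hBcompact p _)).
exact: (tvs_cvgB (@dual_continuous _ _ _ a u) c3).
Qed.

End LinearForms.

(** * Sections and their brackets in charts *)

Section Sections.
Context (R : realType) (F : tvsType R) (M : manifold F) (B : bornology F).
Hypothesis hF : hausdorff_space F.
Hypothesis hBcompact : forall K : set F, compact K -> born_set B K.
Implicit Types (c d e : chart F M) (x : M) (v w : F) (s t : section (gtangent M B)).

(** [vrep] and [frep] repeat the two components of the trivialization of [gtangent], so that
    smoothness of a section is by definition smoothness of the pair. *)
Definition vrep s c (y : F) : F := tcoord c (cinv c y) (pr1 s (cinv c y)).

Definition frep s c (y : F) : dual B :=
  to_dual B (fun w => (pr2 s (cinv c y) : dual B) (tcoord_inv c (cinv c y) w)).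

Lemma frepE s c y w : atlas M c -> cset c (cdom c) y ->
  frep s c y w = (pr2 s (cinv c y) : dual B) (tcoord_inv c (cinv c y) w).
Proof.
move=> ac /cset_out[cy _ _].
exact: (pullE _ _ (tcoord_inv_linear hF ac cy) (tcoord_inv_continuous ac cy)).
Qed.

(** Over x the preferred chart at x trivializes by the identity. This is how definitions made at x
    in that chart turn into the local formulas. *)
Lemma vrep_at s x : vrep s (chart_at x) (chart_at x x) = pr1 s x.
Proof. by rewrite /vrep cfunK ?tcoord_at //; exact: chart_at_dom. Qed.

Lemma frep_at s x : frep s (chart_at x) (chart_at x x) = pr2 s x.
Proof.
apply: dual_ext => w; rewrite frepE.
- by rewrite cfunK ?tcoord_inv_at //; exact: chart_at_dom.
- exact: chart_at_atlas.
- by apply: cset_in; exact: chart_at_dom.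
Qed.

Lemma smooth_reps s c : atlas M c -> smooth_section s ->
  smooth_on (cset c (cdom c)) (fun y => (vrep s c y, frep s c y)).
Proof. by move=> ac /(_ (exist _ c ac) c ac). Qed.

Lemma smooth_vrep s c : atlas M c -> smooth_section s ->
  smooth_on (cset c (cdom c)) (vrep s c).
Proof.
move=> ac ss k; have hd := hausdorff_dual hBcompact.
apply: (@Ck_comp _ k _ _ _ _ setT (fun y => (vrep s c y, frep s c y)) fst) => //.
- exact: hausdorff_prod.
- exact: cset_cdom_open.
- exact: openT.
- exact: smooth_reps.
- by apply: Ck_lin => //; exact: continuous_fst.
Qed.

Lemma smooth_frep s c : atlas M c -> smooth_section s ->
  smooth_on (cset c (cdom c)) (frep s c).
Proof.
move=> ac ss k; have hd := hausdorff_dual hBcompact.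
apply: (@Ck_comp _ k _ _ _ _ setT (fun y => (vrep s c y, frep s c y)) snd) => //.
- exact: hausdorff_prod.
- exact: cset_cdom_open.
- exact: openT.
- exact: smooth_reps.
- by apply: Ck_lin => //; exact: continuous_snd.
Qed.

Lemma vrep_tr s c d : atlas M c -> atlas M d ->
  pmap_rel (cset c (cdom d)) (tr c d) (vrep s c) (vrep s d).
Proof.
move=> ac ad y /cset_out[cy dy yE]; rewrite /vrep cfunK //.
by rewrite -(tcoord_tr hF _ ac ad cy dy) yE.
Qed.

Lemma frep_tr s c d : atlas M c -> atlas M d ->
  pform_rel (cset c (cdom d)) (tr c d) (frep s c) (frep s d).
Proof.
move=> ac ad y v /cset_out[cy dy yE].
rewrite !frepE //; [|by rewrite -yE; exact: cset_in|exact: cset_in].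
by have := tcoord_inv_tr hF v ac ad cy dy; rewrite yE cfunK // => ->.
Qed.

Lemma contr_rep s t c y : atlas M c -> cset c (cdom c) y ->
  contr1 (pr1 s) (pr2 t) (cinv c y) = frep t c y (vrep s c y).
Proof.
move=> ac cy; rewrite frepE // /vrep tcoordK //; by case/cset_out: cy.
Qed.

Lemma dR0_rep (f : M -> R) (g : F -> R^o) x :
  linear g -> continuous g ->
  (forall v, dderiv (fun y => f (cinv (chart_at x) y) : R^o) (chart_at x x) v = g v) ->
  forall v, (dR0 B f x : dual B) v = g v.
Proof.
move=> lg cg fg v; rewrite /dR0.
have -> : (fun v => vact (vext x v) f x) = g.
  by apply/funext => w; rewrite /vact /vext tcoord_inv_at // fg.
exact: to_dualE.
Qed.

Lemma dderiv_contr s t x v : smooth_section s -> smooth_section t ->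
  dderiv (fun y => contr1 (pr1 s) (pr2 t) (cinv (chart_at x) y) : R^o) (chart_at x x) v
  = (dderiv (frep t (chart_at x)) (chart_at x x) v (pr1 s x) : R)
    + (pr2 t x : dual B) (dderiv (vrep s (chart_at x)) (chart_at x x) v) :> R.
Proof.
set e := chart_at x => ss st.
have ae : atlas M e by exact: chart_at_atlas.
have Ix : cset e (cdom e) (e x) by apply: cset_in; exact: chart_at_dom.
have h := has_dderiv_eval hBcompact (C1_dderiv v (smooth_frep ae st 1%N) Ix)
   (C1_dderiv v (smooth_vrep ae ss 1%N) Ix).
rewrite vrep_at frep_at in h.
apply: dderivE; first exact: hausdorff_Ro.
apply: has_dderiv_near h.
have nI : nbhs (e x) (cset e (cdom e)).
  by apply: open_nbhs_nbhs; split => //; exact: cset_cdom_open.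
by apply: (filterS _ nI) => y Iy; rewrite contr_rep.
Qed.

Lemma dR0_contr s t x v : smooth_section s -> smooth_section t ->
  (dR0 B (contr1 (pr1 s) (pr2 t)) x : dual B) v =
  (dderiv (frep t (chart_at x)) (chart_at x x) v (pr1 s x) : R)
    + (pr2 t x : dual B) (dderiv (vrep s (chart_at x)) (chart_at x x) v) :> R.
Proof.
move=> ss st; have hd := hausdorff_dual hBcompact.
set e := chart_at x.
have ae : atlas M e by exact: chart_at_atlas.
have Ix : cset e (cdom e) (e x) by apply: cset_in; exact: chart_at_dom.
have oI := cset_cdom_open e e.
have Ct := smooth_frep ae st 1%N; have Cs := smooth_vrep ae ss 1%N.
have lt := dderiv_linear hd oI Ct Ix; have ls := dderiv_linear hF oI Cs Ix.
pose g v : R^o := (dderiv (frep t e) (e x) v (pr1 s x) : R)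
    + (pr2 t x : dual B) (dderiv (vrep s e) (e x) v).
apply: (dR0_rep (g := g)) => [k u w|u|u].
- exact: (linear_evalD (pr1 s x) (pr2 t x) lt ls).
- apply: (continuous_evalD hBcompact (p := pr1 s x) (a := pr2 t x) (L := dderiv (frep t e) (e x))
    (L' := dderiv (vrep s e) (e x))).
    exact: (dderiv_continuous Ct Ix).
  exact: (dderiv_continuous Cs Ix).
- exact: dderiv_contr.
Qed.

Lemma vext_rep x v c : c = chart_at x -> forall y, cset c (cdom c) y ->
  tcoord c (cinv c y) (vext x v (cinv c y)) = v.
Proof.
move=> -> y /cset_out[cy _ _]; rewrite /vext tcoord_invK //.
exact: chart_at_atlas.
Qed.

Lemma contr1_vext t x v y : cset (chart_at x) (cdom (chart_at x)) y ->
  contr1 (vext x v) (pr2 t) (cinv (chart_at x) y) = frep t (chart_at x) y v.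
Proof.
by move=> Iy; rewrite frepE //; exact: chart_at_atlas.
Qed.

(** Both extensions are constant in the preferred chart, so the bracket term in [dR1] drops out. *)
Lemma vbracket_vext x v w : vbracket (vext x v) (vext x w) x = 0.
Proof.
have nI : nbhs (chart_at x x) (cset (chart_at x) (cdom (chart_at x))).
  apply: open_nbhs_nbhs; split; first exact: cset_cdom_open.
  by apply: cset_in; exact: chart_at_dom.
have d0 v' u : dderiv (fun y => tcoord (chart_at x) (cinv (chart_at x) y)
    (vext x v' (cinv (chart_at x) y))) (chart_at x x) u = 0.
  apply: dderivE => //; apply: has_dderiv_near (has_dderiv_cst v' _ _).
  by apply: (filterS _ nI) => y Iy; rewrite (vext_rep _ erefl).
by rewrite /vbracket !d0 subrr.
Qed.

Lemma dR1_rep t x v w : smooth_section t ->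
  dR1 (pr2 t) x v w = (dderiv (frep t (chart_at x)) (chart_at x x) v w : R)
    - (dderiv (frep t (chart_at x)) (chart_at x x) w v : R).
Proof.
move=> st; set e := chart_at x.
have ae : atlas M e by exact: chart_at_atlas.
have Ix : cset e (cdom e) (e x) by apply: cset_in; exact: chart_at_dom.
have nI : nbhs (e x) (cset e (cdom e)).
  by apply: open_nbhs_nbhs; split => //; exact: cset_cdom_open.
have Ct := smooth_frep ae st 1%N.
have va u u' : vact (vext x u) (contr1 (vext x u') (pr2 t)) x = dderiv (frep t e) (e x) u u'.
  have vu : vext x u x = u by rewrite /vext tcoord_inv_at.
  rewrite /vact vu; apply: dderivE; first exact: hausdorff_Ro.
  have h := has_dderiv_eval hBcompact (C1_dderiv u Ct Ix) (has_dderiv_cst u' (e x) u).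
  rewrite dual0 addr0 in h; apply: has_dderiv_near h.
  by apply: (filterS _ nI) => y Iy; rewrite contr1_vext.
by rewrite /dR1 !va /contr1 vbracket_vext dual0 subr0.
Qed.

Lemma contr2_dR1 t x (X : section (tangent M)) v : smooth_section t ->
  (contr2 B X (dR1 (pr2 t)) x : dual B) v =
  (dderiv (frep t (chart_at x)) (chart_at x x) (X x) v : R)
    - (dderiv (frep t (chart_at x)) (chart_at x x) v (X x) : R).
Proof.
move=> st; rewrite /contr2.
have ae : atlas M (chart_at x) by exact: chart_at_atlas.
have Ix : cset (chart_at x) (cdom (chart_at x)) (chart_at x x).
  by apply: cset_in; exact: chart_at_dom.
have oI := cset_cdom_open (chart_at x) (chart_at x).
have Ct := smooth_frep ae st 1%N.
have -> : dR1 (pr2 t) x (X x) = (fun v =>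
    (dderiv (frep t (chart_at x)) (chart_at x x) (X x) v : R)
    - (dderiv (frep t (chart_at x)) (chart_at x x) v (X x) : R)).
  by apply/funext => w; rewrite dR1_rep.
apply: to_dualE.
  by apply: linear_evalB; exact: (dderiv_linear (hausdorff_dual hBcompact) oI Ct Ix).
by apply: continuous_evalB => //; exact: (dderiv_continuous Ct Ix).
Qed.

Lemma dorfman_vec_at s t x : pr1 (dorfman s t) x =
  lbr (vrep s (chart_at x)) (vrep t (chart_at x)) (chart_at x x).
Proof. by rewrite /lbr !vrep_at. Qed.

Lemma dorfman_form_at s t x v : smooth_section s -> smooth_section t ->
  (pr2 (dorfman s t) x : dual B) v =
  lform (vrep s (chart_at x)) (frep s (chart_at x)) (vrep t (chart_at x))
    (frep t (chart_at x)) (chart_at x x) v.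
Proof.
move=> ss st.
have e0 : (pr2 (dorfman s t) x : dual B) v =
   ((dR0 B (contr1 (pr1 s) (pr2 t)) x : dual B) v : R)
   + ((contr2 B (pr1 s) (dR1 (pr2 t)) x : dual B) v : R)
   - ((contr2 B (pr1 t) (dR1 (pr2 s)) x : dual B) v : R) by [].
rewrite e0 (dR0_contr _ _ ss st) (contr2_dR1 _ _ _ st) (contr2_dR1 _ _ _ ss).
rewrite /lform !vrep_at frep_at; form_lra.
Qed.

(** The bracket is defined at each point through the preferred chart of that point. Covariance
    replaces these charts by one chart c on its whole domain, without which the bracket could not be
    differentiated again. *)
Lemma dorfman_vrep s t c y : atlas M c -> smooth_section s -> smooth_section t ->
  cset c (cdom c) y -> vrep (dorfman s t) c y = lbr (vrep s c) (vrep t c) y.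
Proof.
move=> ac ss st /cset_out[cy _ yE].
set x := cinv c y in cy yE; set e := chart_at x.
have ae : atlas M e by exact: chart_at_atlas.
have ex : cdom e x by exact: chart_at_dom.
have Iy : cset e (cdom c) (e x) by exact: cset_in.
rewrite /vrep -/x dorfman_vec_at -/e /tcoord -/e.
have UV z : cset e (cdom c) z -> cset c (cdom c) (tr e c z).
  by move=> /cset_out[_ cz _]; exact: cset_in.
have sub c' d' : cset c' (cdom d') `<=` cset c' (cdom c').
  by move=> z [x' [cx' _] <-]; exact: cset_in.
have CU r : smooth_section r -> C1 (cset e (cdom c)) (vrep r e).
  by move=> sr; apply: Ck_sub (smooth_vrep ae sr 1%N); [exact: cset_cdom_open|exact: sub].
have h := (lbr_pmap hF (cset_cdom_open e c) (cset_cdom_open c c) (tr_smooth ae ac 2%N) UV Iy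
  (CU _ ss) (smooth_vrep ac ss 1%N) (CU _ st) (smooth_vrep ac st 1%N)
  (vrep_tr s ae ac) (vrep_tr t ae ac)).
have ey : c (cinv e (e x)) = y by rewrite cfunK // yE.
exact: (etrans (esym h) (congr1 (lbr (vrep s c) (vrep t c)) ey)).
Qed.

Lemma dorfman_frep s t c y v : atlas M c -> smooth_section s -> smooth_section t ->
  cset c (cdom c) y ->
  frep (dorfman s t) c y v = lform (vrep s c) (frep s c) (vrep t c) (frep t c) y v.
Proof.
move=> ac ss st Iy'; rewrite frepE //; have /cset_out[cy _ yE] := Iy'.
set x := cinv c y in cy yE *; set e := chart_at x.
have ae : atlas M e by exact: chart_at_atlas.
have ex : cdom e x by exact: chart_at_dom.
have Iy : cset c (cdom e) y by rewrite -yE; exact: cset_in.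
rewrite dorfman_form_at // -/e /tcoord_inv -/e yE.
have UV z : cset c (cdom e) z -> cset e (cdom e) (tr c e z).
  by move=> /cset_out[_ cz _]; exact: cset_in.
have sub : cset c (cdom e) `<=` cset c (cdom c).
  by move=> z [x' [cx' _] <-]; exact: cset_in.
have oc := cset_cdom_open c c.
(* Forms pull back, so the transition map goes from c to the preferred chart, opposite to its
   direction for the vector part. *)
have h := lform_pmap hF hBcompact (cset_cdom_open c e) (cset_cdom_open e e)
  (tr_smooth ac ae 2%N) UV Iy v
  (Ck_sub oc sub (smooth_vrep ac ss 1%N)) (smooth_vrep ae ss 1%N)
  (Ck_sub oc sub (smooth_vrep ac st 1%N)) (smooth_vrep ae st 1%N)
  (Ck_sub oc sub (smooth_frep ac ss 1%N)) (smooth_frep ae ss 1%N)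
  (Ck_sub oc sub (smooth_frep ac st 1%N)) (smooth_frep ae st 1%N)
  (vrep_tr s ac ae) (vrep_tr t ac ae) (frep_tr s ac ae) (frep_tr t ac ae).
by rewrite -h.
Qed.

End Sections.

(** * Linearity and Leibniz rule of the local brackets, slot by slot *)

Section LocalLinearity.
Context (R : realType) (F : tvsType R) (B : bornology F).
Hypothesis hF : hausdorff_space F.
Hypothesis hBcompact : forall K : set F, compact K -> born_set B K.

Lemma lbr_near (X X' Y Y' : F -> F) y : (\forall z \near y, X z = X' z) ->
  (\forall z \near y, Y z = Y' z) -> lbr X Y y = lbr X' Y' y.
Proof.
move=> XX YY; rewrite /lbr (dderiv_near _ XX) (dderiv_near _ YY).
by rewrite (nbhs_singleton XX) (nbhs_singleton YY).
Qed.

(** Y enters [lform] undifferentiated, so agreement at the point suffices for it, whereas X must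
    agree nearby. *)
Lemma lform_near (X X' Y Y' : F -> F) (al be : F -> dual B) y v :
  (\forall z \near y, X z = X' z) -> Y y = Y' y ->
  lform X al Y be y v = lform X' al Y' be y v.
Proof.
by move=> XX YY; rewrite /lform (dderiv_near _ XX) (nbhs_singleton XX) YY.
Qed.

Lemma dderiv_comb (E G : tvsType R) (U : set E) (f g h : E -> G) (k : R) y w :
  hausdorff_space G -> open U -> C1 U f -> C1 U g -> U y ->
  (forall z, U z -> h z = k *: f z + g z) ->
  dderiv h y w = k *: dderiv f y w + dderiv g y w.
Proof.
move=> hG oU Cf Cg Uy hE; apply: dderivE => //.
have lk : linear (fun v : G => k *: v).
  by move=> a u v; rewrite scalerDr !scalerA mulrC.
have ck : continuous (fun v : G => k *: v).
  move=> v; have c0 : (fun _ : G => k : R^o) @ nbhs v --> (k : R^o) by exact: cvg_cst.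
  have c1 : (fun u : G => u) @ nbhs v --> v by exact: cvg_id.
  exact: (tvs_cvgZ c0 c1).
have d1 := has_dderiv_clin lk ck (C1_dderiv w Cf Uy).
apply: has_dderiv_near (has_dderiv_add d1 (C1_dderiv w Cg Uy)).
have nU : nbhs y U by exact: open_nbhs_nbhs.
by apply: (filterS _ nU) => z Uz; rewrite hE.
Qed.

Lemma quotient_scale (G : tvsType R) (t a b : R) (p q : G) :
  a *: (t^-1 *: (p - q)) + (t^-1 * (a - b)) *: q = t^-1 *: (a *: p - b *: q).
Proof.
rewrite scalerA [a * _]mulrC -!scalerA -scalerDr scalerBr scalerBl.
by rewrite addrA subrK.
Qed.

Lemma dderiv_scalef (E G : tvsType R) (U : set E) (f : E -> R^o) (g h : E -> G) y w :
  hausdorff_space G -> open U -> C1 U f -> C1 U g -> U y ->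
  (forall z, U z -> h z = f z *: g z) ->
  dderiv h y w = f y *: dderiv g y w + dderiv f y w *: g y.
Proof.
move=> hG oU Cf Cg Uy hE.
have dg := C1_dderiv w Cg Uy; have df := C1_dderiv w Cf Uy.
apply: dderivE => //.
have d0 : has_dderiv (fun z => f z *: g z) y w (f y *: dderiv g y w + dderiv f y w *: g y).
  have cg : (fun _ : R => g y) @ (0 : R)^' --> g y by exact: cvg_cst.
  generalize (tvs_cvgD (tvs_cvgZ (has_dderiv_cont df) dg) (tvs_cvgZ df cg)).
  apply: cvg_trans; apply: near_eq_cvg; near=> t.
  exact: quotient_scale.
apply: has_dderiv_near d0.
have nU : nbhs y U by exact: open_nbhs_nbhs.
by apply: (filterS _ nU) => z Uz; rewrite hE.
Unshelve. all: by end_near. Qed.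

Section Slots.
Context (V : set F) (y : F).
Hypotheses (oV : open V) (Vy : V y).
Context (X Y X' Y' : F -> F) (al be al' be' : F -> dual B) (k : R) (v : F).
Hypotheses (CX : C1 V X) (CY : C1 V Y) (CX' : C1 V X') (CY' : C1 V Y')
  (Ca : C1 V al) (Cb : C1 V be) (Ca' : C1 V al') (Cb' : C1 V be').

Let lX := dderiv_linear hF oV CX Vy.
Let lY := dderiv_linear hF oV CY Vy.
Let la := dderiv_linear (hausdorff_dual hBcompact) oV Ca Vy.
Let lb := dderiv_linear (hausdorff_dual hBcompact) oV Cb Vy.

Lemma lbr_combl X1 : (forall z, V z -> X1 z = k *: X z + X' z) ->
  lbr X1 Y y = k *: lbr X Y y + lbr X' Y y.
Proof.
move=> XE; rewrite /lbr (dderiv_comb _ hF oV CX CX' Vy XE) (XE _ Vy) lY.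
by rewrite scalerBr opprD addrACA.
Qed.

Lemma lbr_combr Y1 : (forall z, V z -> Y1 z = k *: Y z + Y' z) ->
  lbr X Y1 y = k *: lbr X Y y + lbr X Y' y.
Proof.
move=> YE; rewrite /lbr (dderiv_comb _ hF oV CY CY' Vy YE) (YE _ Vy) lX.
by rewrite scalerBr opprD addrACA.
Qed.

Lemma lform_combl X1 al1 : (forall z, V z -> X1 z = k *: X z + X' z) ->
  (forall z, V z -> al1 z = k *: al z + al' z) ->
  lform X1 al1 Y be y v = k * lform X al Y be y v + lform X' al' Y be y v.
Proof.
move=> XE aE; have hd := hausdorff_dual hBcompact.
have e1 : dderiv be y (X1 y) v =
    k * (dderiv be y (X y) v : R) + (dderiv be y (X' y) v : R) :> R.
  by rewrite (XE _ Vy) lb.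
have e2 : be y (dderiv X1 y v) =
    k * (be y (dderiv X y v) : R) + (be y (dderiv X' y v) : R) :> R.
  by rewrite (dderiv_comb _ hF oV CX CX' Vy XE) dualD dualZ.
have ea w u : dderiv al1 y w u =
    k * (dderiv al y w u : R) + (dderiv al' y w u : R) :> R.
  by rewrite (dderiv_comb _ hd oV Ca Ca' Vy aE).
move: e1 e2 (ea (Y y) v) (ea v (Y y)); rewrite /lform; form_ring.
Qed.

Lemma lform_combr Y1 be1 : (forall z, V z -> Y1 z = k *: Y z + Y' z) ->
  (forall z, V z -> be1 z = k *: be z + be' z) ->
  lform X al Y1 be1 y v = k * lform X al Y be y v + lform X al Y' be' y v.
Proof.
move=> YE bE; have hd := hausdorff_dual hBcompact.
have e1 : dderiv be1 y (X y) v =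
    k * (dderiv be y (X y) v : R) + (dderiv be' y (X y) v : R) :> R.
  by rewrite (dderiv_comb _ hd oV Cb Cb' Vy bE).
have e2 : be1 y (dderiv X y v) =
    k * (be y (dderiv X y v) : R) + (be' y (dderiv X y v) : R) :> R.
  by rewrite bE.
have e3 : dderiv al y (Y1 y) v =
    k * (dderiv al y (Y y) v : R) + (dderiv al y (Y' y) v : R) :> R.
  by rewrite YE // la.
have e4 : dderiv al y v (Y1 y) =
    k * (dderiv al y v (Y y) : R) + (dderiv al y v (Y' y) : R) :> R.
  by rewrite YE // dualD dualZ.
move: e1 e2 e3 e4; rewrite /lform; form_ring.
Qed.

Context (f : F -> R^o) (Cf : C1 V f).

Lemma lbr_scaler Y1 : (forall z, V z -> Y1 z = f z *: Y z) ->
  lbr X Y1 y = f y *: lbr X Y y + dderiv f y (X y) *: Y y.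
Proof.
move=> YE; rewrite /lbr (dderiv_scalef _ hF oV Cf CY Vy YE) (YE _ Vy).
by rewrite (linZ _ _ lX) scalerBr addrAC.
Qed.

(** In the second slot only [be] is differentiated in a way that meets f, and in the direction X;
    hence the single extra term. Scaling the first slot would also produce a multiple of df by the
    pairing. *)
Lemma lform_scaler Y1 be1 : (forall z, V z -> Y1 z = f z *: Y z) ->
  (forall z, V z -> be1 z = f z *: be z) ->
  lform X al Y1 be1 y v = f y * lform X al Y be y v + dderiv f y (X y) * (be y v : R).
Proof.
move=> YE bE; have hd := hausdorff_dual hBcompact.
have e1 : dderiv be1 y (X y) v =
    f y * (dderiv be y (X y) v : R) + dderiv f y (X y) * (be y v : R) :> R.
  by rewrite (dderiv_scalef _ hd oV Cf Cb Vy bE).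
have e2 : be1 y (dderiv X y v) = f y * (be y (dderiv X y v) : R) :> R by rewrite bE.
have e3 : dderiv al y (Y1 y) v = f y * (dderiv al y (Y y) v : R) :> R.
  by rewrite YE // (linZ _ _ la).
have e4 : dderiv al y v (Y1 y) = f y * (dderiv al y v (Y y) : R) :> R.
  by rewrite YE // dualZ.
move: e1 e2 e3 e4; rewrite /lform.
move: (f y : R) (dderiv f y (X y) : R) => m n; form_ring.
Qed.

End Slots.
End LocalLinearity.

(** * The Dorfman bracket on sections *)

Section SectionAlgebra.
Context (R : realType) (F : tvsType R) (M : manifold F) (B : bornology F).
Hypothesis hF : hausdorff_space F.
Hypothesis hBcompact : forall K : set F, compact K -> born_set B K.
Implicit Types (c d e : chart F M) (x : M) (v w : F) (s t u : section (gtangent M B)).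

Lemma gtangent_ext (p q : (F * dual B)%type) : p.1 = q.1 -> (forall v, p.2 v = q.2 v) -> p = q.
Proof. by case: p q => [p1 p2] [q1 q2] /= -> e; congr (_, _); exact: dual_ext. Qed.

Lemma near_chart_at x :
  \forall y \near chart_at x x, cset (chart_at x) (cdom (chart_at x)) y.
Proof.
apply: open_nbhs_nbhs; split; first exact: cset_cdom_open.
by apply: cset_in; exact: chart_at_dom.
Qed.

Let Ix x : cset (chart_at x) (cdom (chart_at x)) (chart_at x x).
Proof. exact: nbhs_singleton (near_chart_at x). Qed.

Let oI x : open (cset (chart_at x) (cdom (chart_at x))).
Proof. exact: cset_cdom_open. Qed.

(** The outer brackets differentiate the inner ones, which are therefore replaced by their local
    formulas on a neighbourhood of x. The smoothness assumed of the inner brackets makes their form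
    parts differentiable. *)
Lemma dorfman_jacobi s t u x : smooth_section s -> smooth_section t ->
  smooth_section u -> smooth_section (dorfman t u) ->
  smooth_section (dorfman s t) -> smooth_section (dorfman s u) ->
  (dorfman s (dorfman t u) x : (F * dual B)%type) =
  (dorfman (dorfman s t) u x : (F * dual B)%type) + dorfman t (dorfman s u) x.
Proof.
move=> ss st su stu sst ssu.
have ae := chart_at_atlas x.
have nb (a b : section (gtangent M B)) : smooth_section a -> smooth_section b -> \forall y \near chart_at x x,
    vrep (dorfman a b) (chart_at x) y = lbr (vrep a (chart_at x)) (vrep b (chart_at x)) y.
  move=> sa sb; apply: (filterS _ (near_chart_at x)) => y Iy.
  exact: (dorfman_vrep hF hBcompact ae sa sb Iy).
have nr (a : section (gtangent M B)) : \forall y \near chart_at x x, vrep a (chart_at x) y = vrep a (chart_at x) y.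
  by apply: (filterS _ (near_chart_at x)).
have CV (a : section (gtangent M B)) (sa : smooth_section a) := smooth_vrep hF hBcompact ae sa 2%N.
have CA (a : section (gtangent M B)) (sa : smooth_section a) := smooth_frep hF hBcompact ae sa.
have fr (a b : section (gtangent M B)) (sa : smooth_section a) (sb : smooth_section b) y v :=
  @dorfman_frep _ _ _ _ hF hBcompact a b (chart_at x) y v ae sa sb.
apply: gtangent_ext => [|v].
  have e1 := dorfman_vec_at hF s (dorfman t u) x.
  have e2 := dorfman_vec_at hF (dorfman s t) u x.
  have e3 := dorfman_vec_at hF t (dorfman s u) x.
  rewrite (lbr_near (nr s) (nb _ _ st su)) in e1.
  rewrite (lbr_near (nb _ _ ss st) (nr u)) in e2.
  rewrite (lbr_near (nr t) (nb _ _ ss su)) in e3.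
  rewrite (lbr_jacobi hF (oI x) (Ix x) (CV _ ss) (CV _ st) (CV _ su)) in e1.
  by rewrite -e2 -e3 in e1; exact: e1.
have e1 := dorfman_form_at hF hBcompact x v ss stu.
have e2 := dorfman_form_at hF hBcompact x v sst su.
have e3 := dorfman_form_at hF hBcompact x v st ssu.
rewrite (lform_near _ _ v (nr s) (nbhs_singleton (nb _ _ st su))) in e1.
rewrite (lform_near _ _ v (nb _ _ ss st) erefl) in e2.
rewrite (lform_near _ _ v (nr t) (nbhs_singleton (nb _ _ ss su))) in e3.
have J := @lform_jacobi R F B hF hBcompact _ _ (oI x) (Ix x) _ _ _ _ _ _ _ _ _ v
  (CV _ ss) (CV _ st) (CV _ su) (CA _ ss 2%N) (CA _ st 2%N) (CA _ su 2%N)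
  (CA _ stu 1%N) (CA _ sst 1%N) (CA _ ssu 1%N)
  (fr _ _ st su) (fr _ _ ss st) (fr _ _ ss su).
by rewrite J -e2 -e3 in e1; exact: e1.
Qed.

Lemma vrep_comb (k : R) s t (r : section (gtangent M B)) c y : atlas M c ->
  (forall x, (r x : (F * dual B)%type) = k *: (s x : (F * dual B)%type) + t x) ->
  cset c (cdom c) y -> vrep r c y = k *: vrep s c y + vrep t c y.
Proof.
move=> ac rE /cset_out[cy _ _]; rewrite /vrep -(tcoord_linear hF ac cy).
by rewrite /pr1 rE.
Qed.

Lemma frep_comb (k : R) s t (r : section (gtangent M B)) c y : atlas M c ->
  (forall x, (r x : (F * dual B)%type) = k *: (s x : (F * dual B)%type) + t x) ->
  cset c (cdom c) y -> frep r c y = k *: frep s c y + frep t c y.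
Proof.
move=> ac rE cy; apply: dual_ext => v.
rewrite dual_funD dual_funZ !frepE // /pr2 rE.
by [].
Qed.

(** The combination is a separate section [r] with a pointwise equation, so that it applies to a
    section given in another form. *)
Lemma dorfman_combl (k : R) s t u (r : section (gtangent M B)) x : smooth_section s -> smooth_section t ->
  smooth_section u -> smooth_section r ->
  (forall x, (r x : (F * dual B)%type) = k *: (s x : (F * dual B)%type) + t x) ->
  (dorfman r u x : (F * dual B)%type) =
    k *: (dorfman s u x : (F * dual B)%type) + dorfman t u x.
Proof.
move=> ss st su sr rE; have ae := chart_at_atlas x.
have CV (a : section (gtangent M B)) (sa : smooth_section a) := smooth_vrep hF hBcompact ae sa 1%N.
have CA (a : section (gtangent M B)) (sa : smooth_section a) := smooth_frep hF hBcompact ae sa 1%N.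
apply: gtangent_ext => [|v].
  have := lbr_combl hF (oI x) (Ix x) (CV _ ss) (CV _ su) (CV _ st)
     (fun z => vrep_comb ae rE).
  by rewrite -!dorfman_vec_at.
have := lform_combl hF hBcompact (oI x) (Ix x) (vrep u (chart_at x)) v
  (CV _ ss) (CV _ st) (CA _ ss) (CA _ su) (CA _ st)
  (fun z => vrep_comb ae rE) (fun z => frep_comb ae rE).
have e1 := dorfman_form_at hF hBcompact x v sr su.
have e2 := dorfman_form_at hF hBcompact x v ss su.
have e3 := dorfman_form_at hF hBcompact x v st su.
by move=> h; rewrite -e2 -e3 -e1 in h; exact: h.
Qed.

Lemma dorfman_combr (k : R) s t u (r : section (gtangent M B)) x :
  smooth_section s -> smooth_section t ->
  smooth_section u -> smooth_section r ->
  (forall x, (r x : (F * dual B)%type) = k *: (s x : (F * dual B)%type) + t x) ->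
  (dorfman u r x : (F * dual B)%type) =
    k *: (dorfman u s x : (F * dual B)%type) + dorfman u t x.
Proof.
move=> ss st su sr rE; have ae := chart_at_atlas x.
have CV (a : section (gtangent M B)) (sa : smooth_section a) := smooth_vrep hF hBcompact ae sa 1%N.
have CA (a : section (gtangent M B)) (sa : smooth_section a) := smooth_frep hF hBcompact ae sa 1%N.
apply: gtangent_ext => [|v].
  have := lbr_combr hF (oI x) (Ix x) (CV _ su) (CV _ ss) (CV _ st)
     (fun z => vrep_comb ae rE).
  by rewrite -!dorfman_vec_at.
have h := @lform_combr R F B hBcompact _ _ (oI x) (Ix x) (vrep u (chart_at x))
  _ _ _ _ _ _ v (CA _ su) (CA _ ss) (CA _ st) _ _
  (fun z => vrep_comb ae rE) (fun z => frep_comb ae rE).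
have e1 := dorfman_form_at hF hBcompact x v su sr.
have e2 := dorfman_form_at hF hBcompact x v su ss.
have e3 := dorfman_form_at hF hBcompact x v su st.
by rewrite -e2 -e3 -e1 in h; exact: h.
Qed.

Lemma dorfman_scaler (f : M -> R) s t (r : section (gtangent M B)) x : smooth_fun f ->
  smooth_section s -> smooth_section t -> smooth_section r ->
  (forall x, (r x : (F * dual B)%type) = f x *: (t x : (F * dual B)%type)) ->
  (dorfman s r x : (F * dual B)%type) =
    f x *: (dorfman s t x : (F * dual B)%type) + vact (pr1 s) f x *: (t x : (F * dual B)%type).
Proof.
move=> sf ss st sr rE; have ae := chart_at_atlas x.
have CV (a : section (gtangent M B)) (sa : smooth_section a) := smooth_vrep hF hBcompact ae sa 1%N.
have CA (a : section (gtangent M B)) (sa : smooth_section a) := smooth_frep hF hBcompact ae sa 1%N.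
have Cf : C1 (cset (chart_at x) (cdom (chart_at x))) (fun y => f (cinv (chart_at x) y) : R^o).
  apply: Ck_sub (sf _ ae 1%N); first exact: cimg_open.
  by move=> _ [y [cy _] <-]; exists y.
have vE y : cset (chart_at x) (cdom (chart_at x)) y ->
    vrep r (chart_at x) y = f (cinv (chart_at x) y) *: vrep t (chart_at x) y.
  move=> /cset_out[cy _ _]; rewrite /vrep -(linZ _ _ (tcoord_linear hF ae cy)).
  by rewrite /pr1 rE.
have fE y : cset (chart_at x) (cdom (chart_at x)) y ->
    frep r (chart_at x) y = f (cinv (chart_at x) y) *: frep t (chart_at x) y.
  move=> cy; apply: dual_ext => v.
  rewrite dual_funZ !frepE // /pr2 rE.
  by [].
have xK : cinv (chart_at x) (chart_at x x) = x by rewrite cfunK //; exact: chart_at_dom.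
apply: gtangent_ext => [|v].
  have := lbr_scaler hF (oI x) (Ix x) (CV _ ss) (CV _ st) Cf vE.
  by rewrite -!dorfman_vec_at // !vrep_at // xK.
have h := lform_scaler hBcompact (oI x) (Ix x) (vrep s (chart_at x)) v
  (CA _ ss) (CA _ st) Cf vE fE.
have e1 := dorfman_form_at hF hBcompact x v ss sr.
have e2 := dorfman_form_at hF hBcompact x v ss st.
rewrite -e2 -e1 vrep_at // frep_at // xK in h.
exact: h.
Qed.

Lemma has_dderiv_contr s t x v : smooth_section s -> smooth_section t ->
  has_dderiv (fun y => contr1 (pr1 s) (pr2 t) (cinv (chart_at x) y) : R^o) (chart_at x x) v
    ((dR0 B (contr1 (pr1 s) (pr2 t)) x : dual B) v : R^o).
Proof.
move=> ss st; rewrite (dR0_contr hF hBcompact x v ss st).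
have ae := chart_at_atlas x.
have h := has_dderiv_eval hBcompact (C1_dderiv v (smooth_frep hF hBcompact ae st 1%N) (Ix x))
   (C1_dderiv v (smooth_vrep hF hBcompact ae ss 1%N) (Ix x)).
rewrite vrep_at // frep_at // in h.
apply: has_dderiv_near h.
by apply: (filterS _ (near_chart_at x)) => y Iy; rewrite contr_rep.
Qed.

(** The pairing vanishes, so beta(X) = -alpha(Y), and half the differential of alpha(Y) - beta(X) is
    d(alpha(Y)). This cancels the exact part of the Lie derivative of alpha along Y and leaves the
    contraction of d alpha with Y. *)
Lemma courant_dorfman s t x : smooth_section s -> smooth_section t ->
  (forall x, pairing (s x) (t x) = 0) -> courant s t x = dorfman s t x.
Proof.
move=> ss st p0; apply: gtangent_ext => //= v.
have fE : (fun x' => contr1 (pr1 t) (pr2 s) x' - contr1 (pr1 s) (pr2 t) x') =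
    (fun x' => contr1 (pr1 t) (pr2 s) x' + contr1 (pr1 t) (pr2 s) x').
  apply/funext => x'; congr (_ + _); apply/eqP.
  rewrite -subr_eq0 -opprD oppr_eq0 addrC; apply/eqP; exact: p0.
have dE : dR0 B (fun x' => contr1 (pr1 t) (pr2 s) x' + contr1 (pr1 t) (pr2 s) x') x
    = 2 *: (dR0 B (contr1 (pr1 t) (pr2 s)) x : dual B).
  apply: to_dual_id => w; rewrite /vact /vext tcoord_inv_at //.
  have h := @has_dderiv_contr t s x w st ss.
  rewrite (dderivE (@hausdorff_Ro R) (has_dderiv_add h h)) dual_funZ.
  by rewrite [RHS]mulrDl mul1r.
rewrite fE dE scalerA mulVf ?scale1r ?pnatr_eq0 // /lie_der.
rewrite opprD addrA addrAC subrK.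
by [].
Qed.

(** On the diagonal the differences cancel term by term, and only the differential of the zero
    function is left. *)
Lemma courant_self s x : courant s s x = 0.
Proof.
rewrite /courant; congr (_, _); first exact: subrr.
rewrite subrr add0r.
have -> : (fun x' => contr1 (pr1 s) (pr2 s) x' - contr1 (pr1 s) (pr2 s) x') = fun=> 0.
  by apply/funext => x'; rewrite subrr.
rewrite (_ : dR0 _ _ _ = 0 :> dual B) ?scaler0 //.
apply: to_dual_id => w; rewrite /vact; apply: dderivE; first exact: hausdorff_Ro.
exact: has_dderiv_cst.
Qed.

Lemma smooth_section_comb (L : bundle M) (k : R) (s t : section L) :
  hausdorff_space (bmodel L) -> (forall i : bidx L, open (bdom i)) ->
  (forall (i : bidx L) x, bdom i x -> linear (@btriv _ _ _ L i x)) ->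
  smooth_section s -> smooth_section t -> smooth_section (fun x => k *: s x + t x).
Proof.
move=> hL oL lL ss st i c ac j.
have oc : open (c @` (cdom c `&` bdom i)) by exact: (cset_open c (oL i)).
apply: (@Ck_eq _ j _ _ _ (fun y => k *: btriv i (s (cinv c y)) + btriv i (t (cinv c y)))) => //.
  by move=> y /cset_out[_ iy _]; rewrite lL.
apply: Ck_addf => //; last exact: st.
apply: Ck_scale => //; last exact: ss.
by apply: Ck_cst; exact: hausdorff_Ro.
Qed.

Lemma smooth_section_scale (L : bundle M) (f : M -> R) (s : section L) :
  hausdorff_space (bmodel L) -> (forall i : bidx L, open (bdom i)) ->
  (forall (i : bidx L) x, bdom i x -> linear (@btriv _ _ _ L i x)) ->
  smooth_fun f -> smooth_section s -> smooth_section (fun x => f x *: s x).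
Proof.
move=> hL oL lL sf ss i c ac j.
have oc : open (c @` (cdom c `&` bdom i)) by exact: (cset_open c (oL i)).
apply: (@Ck_eq _ j _ _ _ (fun y => (f (cinv c y) : R^o) *: btriv i (s (cinv c y)))) => //.
  by move=> y /cset_out[_ iy _]; rewrite (linZ _ _ (lL _ _ iy)).
apply: Ck_scale => //; last exact: ss.
apply: Ck_sub (sf c ac j); first exact: cimg_open.
by move=> _ [y [cy _] <-]; exists y.
Qed.

Lemma pull_linear (g : F -> F) : linear g -> continuous g ->
  linear (fun a : dual B => pull a g).
Proof.
move=> lg cg k a b; apply: dual_ext => v.
by rewrite dual_funD dual_funZ !pullE.
Qed.

Lemma gtangent_linear (i : bidx (gtangent M B)) x : bdom i x ->
  linear (@btriv _ _ _ (gtangent M B) i x).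
Proof.
case: i => c ac /= cx k [p a] [q b]; congr (_, _).
  exact: (tcoord_linear hF ac cx).
exact: (pull_linear (tcoord_inv_linear hF ac cx) (tcoord_inv_continuous ac cx) k a b).
Qed.

Lemma gtangent_open (i : bidx (gtangent M B)) : open (bdom i).
Proof. by case: i => c ac; exact: cdom_open. Qed.

End SectionAlgebra.

(** * Changes of trivialization and subbundles *)

Section Lift.
Context (R : realType) (K G : tvsType R) (iota : K -> G).
Hypotheses (liota : linear iota) (inj : injective iota)
  (nb : forall k U, nbhs k U <-> exists2 V, nbhs (iota k) V & iota @^-1` V `<=` U)
  (cl : closed (range iota)) (hG : hausdorff_space G).

Lemma embedding_continuous : continuous iota.
Proof. by move=> k V nV; apply/nb; exists V. Qed.

Lemma embedding_hausdorff : hausdorff_space K.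
Proof.
move=> a b cab; apply: inj; apply: hG => V W nV nW.
have [|| z [Vz Wz]] := cab (iota @^-1` V) (iota @^-1` W).
- exact: embedding_continuous.
- exact: embedding_continuous.
- by exists (iota z).
Qed.

Lemma cvg_embedding (I : Type) (Phi : set_system I) (FPhi : Filter Phi) (f : I -> K) k :
  (fun i => iota (f i)) @ Phi --> iota k -> f @ Phi --> k.
Proof.
move=> fk U /nb[V nV VU]; change (Phi (f @^-1` U)).
have h : Phi ((fun i => iota (f i)) @^-1` V) := fk _ nV.
by apply: (filterS _ h) => i /= Vi; exact: VU.
Qed.

(** The difference quotients lie in the range of [iota]. The range is closed, so it contains the
    limit, and convergence lifts because K carries the induced topology. *)
Lemma has_dderiv_embedding (E : tvsType R) (f : E -> K) x h l :
  has_dderiv (fun y => iota (f y)) x h l ->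
  exists2 m, iota m = l & has_dderiv f x h m.
Proof.
move=> fl.
have qE (t : R) : t^-1 *: (iota (f (x + t *: h)) - iota (f x)) =
    iota (t^-1 *: (f (x + t *: h) - f x)).
  by rewrite (linZ _ _ liota) (linB _ _ liota).
have [m _ ml] : range iota l.
  apply: cl => W nW.
  have h1 : (0 : R)^' [set t | W (t^-1 *: (iota (f (x + t *: h)) - iota (f x)))] := fl _ nW.
  have [t Wt] := filter_ex h1; exists (t^-1 *: (iota (f (x + t *: h)) - iota (f x))).
  by split => //; rewrite qE; eexists.
exists m => //; apply: cvg_embedding.
rewrite ml; apply: cvg_trans fl; apply: near_eq_cvg; near=> t.
by rewrite /= qE.
Unshelve. all: by end_near. Qed.

(** Lets smoothness into the model of a subbundle be tested in the ambient model. Each derivative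
    factors through the embedding again, which drives the induction. *)
Lemma Ck_embedding k (E : tvsType R) (U : set E) (f : E -> K) : open U ->
  Ck k U (fun x => iota (f x)) -> Ck k U f.
Proof.
have cf (E' : tvsType R) (U' : set E') (f' : E' -> K) j x : Ck j U' (fun x => iota (f' x)) -> U' x ->
    {for x, continuous f'}.
  by move=> C Ux; apply: cvg_embedding; exact: Ck_cont C Ux.
elim: k E U f => [|k IH] E U f oU C.
  by split => // x Ux; exact: cf C Ux.
split; first by [move=> x Ux; exact: cf C Ux].
have [_ [ex Cd]] := C.
have dP x h : U x -> exists2 m, iota m = dderiv (fun x => iota (f x)) x h & has_dderiv f x h m.
  by move=> Ux; apply: has_dderiv_embedding; apply: dderivP; exact: ex.
split; first by [move=> x h /(dP x h)[m _ fm]; exists m].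
apply: IH; first exact: openXT.
apply: (Ck_eq _ _ Cd); first exact: openXT.
move=> [x h] [/= Ux _]; have [m <- fm] := dP x h Ux.
by rewrite (dderivE embedding_hausdorff fm).
Qed.

End Lift.

(** * Changes of trivialization of the generalized tangent bundle *)

Section Change.
Context (R : realType) (F : tvsType R) (M : manifold F) (B : bornology F).
Hypothesis hF : hausdorff_space F.
Hypothesis hBcompact : forall K : set F, compact K -> born_set B K.
Hypothesis hBendo : forall T : F -> F, linear T -> continuous T ->
  forall b, born_set B b -> born_set B (T @` b).
Implicit Types (c d e : chart F M) (x : M).

(** The change of trivialization from chart c to chart d over x: vectors move by the derivative of
    the transition map, forms by the transpose of its inverse. *)
Definition gtc c d x (p : (F * dual B)%type) : (F * dual B)%type :=
  (dderiv (tr c d) (c x) p.1, pull p.2 (dderiv (tr d c) (d x))).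

Lemma btriv_gtc (i j : bidx (gtangent M B)) x (p : bfib (gtangent M B) x) :
  bdom i x -> bdom j x ->
  btriv j p = gtc (proj1_sig i) (proj1_sig j) x (btriv i p).
Proof.
case: i j => [c ac] [d ad] /= cx dx; rewrite /gtc /=; congr (_, _).
  by rewrite tcoord_tr.
have ld := tcoord_inv_linear hF ad dx; have cd := tcoord_inv_continuous ad dx.
have lc := tcoord_inv_linear hF ac cx; have cc := tcoord_inv_continuous ac cx.
have lt := dtr_linear hF ad ac dx cx; have ct := dtr_continuous ad ac dx cx.
apply: dual_ext => v; rewrite pullE //.
have e1 := pullE p.2 v ld cd.
have e2 := pullE p.2 (dderiv (tr d c) (d x) v) lc cc.
rewrite (tcoord_inv_tr hF v ad ac dx cx) in e2.
exact: (etrans e1 (esym e2)).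
Qed.

Section Domain.
Context (E : tvsType R) (O : set E) (pi : E -> F) (c j d : chart F M).
Hypotheses (hE : hausdorff_space E) (oO : open O) (spi : smooth_on O pi)
  (ac : atlas M c) (aj : atlas M j) (ad : atlas M d)
  (Opi : forall p, O p -> cset c (cdom j `&` cdom d) (pi p)).

Let Oc p : O p -> [/\ cdom c (cinv c (pi p)), cdom j (cinv c (pi p)) & cdom d (cinv c (pi p))].
Proof. by move=> /Opi/cset_out[? [? ?] _]. Qed.

Lemma smooth_chart e : atlas M e -> (forall p, O p -> cdom e (cinv c (pi p))) ->
  smooth_on O (fun p => e (cinv c (pi p))).
Proof.
move=> ae Oe k; apply: (@Ck_comp _ k _ _ _ O (cset c (cdom e)) pi (tr c e)) => //.
- exact: cset_cdom_open.
- by move=> p Op; have /cset_out[h _ <-] := Opi Op; apply: cset_in => //; exact: Oe.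
- exact: tr_smooth.
Qed.

Lemma dtr_smooth k (a b : chart F M) : atlas M a -> atlas M b ->
  Ck k (cset a (cdom b) `*` setT) (fun q : F * F => dderiv (tr a b) q.1 q.2).
Proof. by move=> aa ab; have [_ [_ ]] := tr_smooth aa ab k.+1. Qed.

Lemma smooth_gtc_vec (xi : E -> F) : smooth_on O xi ->
  smooth_on O (fun p => dderiv (tr j d) (j (cinv c (pi p))) (xi p)).
Proof.
move=> sxi k; have hFF := hausdorff_prod hF hF.
apply: (@Ck_comp _ k _ _ _ O (cset j (cdom d) `*` setT)
  (fun p => (j (cinv c (pi p)), xi p)) (fun q : F * F => dderiv (tr j d) q.1 q.2)) => //.
- by apply: openXT; exact: cset_cdom_open.
- by move=> p /Oc[_ jp dp]; split => //=; exact: cset_in.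
- apply: Ck_pair => //; apply: smooth_chart => // p /Oc[] //.
- exact: dtr_smooth.
Qed.

Lemma smooth_gtc_form (al : E -> dual B) : first_countable0 E -> smooth_on O al ->
  smooth_on O (fun p => pull (al p) (dderiv (tr d j) (d (cinv c (pi p))))).
Proof.
move=> fE sal k; have hFF := hausdorff_prod hF hF; have hEF := hausdorff_prod hE hF.
apply: (@Ck_pull _ _ _ hF hBcompact hBendo k E O
  (fun q : E * F => dderiv (tr d j) (d (cinv c (pi q.1))) q.2)) => //.
- by move=> p /Oc[_ jp dp]; exact: (dtr_linear hF ad aj dp jp).
- move=> l; apply: (@Ck_comp _ l _ _ _ (O `*` setT) (cset d (cdom j) `*` setT)
    (fun q : E * F => (d (cinv c (pi q.1)), q.2)) (fun q : F * F => dderiv (tr d j) q.1 q.2)) => //.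
  + exact: openXT.
  + by apply: openXT; exact: cset_cdom_open.
  + by move=> q [/Oc[_ jp dp] _]; split => //=; exact: cset_in.
  + apply: Ck_pair => //; first exact: openXT.
      apply: (@Ck_comp _ l _ _ _ (O `*` setT) O fst (fun p => d (cinv c (pi p)))) => //.
      * exact: openXT.
      * by move=> q [].
      * by apply: Ck_lin => //; exact: continuous_fst.
      * by apply: smooth_chart => // p /Oc[].
    by apply: Ck_lin => //; exact: continuous_snd.
  + exact: dtr_smooth.
Qed.

(** The base point depends on p through [pi]. With E := F and the identity this treats sections;
    with E := F * smodel D and the first projection, the trivializations of D. *)
Lemma smooth_gtc (sig : E -> (F * dual B)%type) : first_countable0 E -> smooth_on O sig ->
  smooth_on O (fun p => gtc j d (cinv c (pi p)) (sig p)).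
Proof.
move=> fE ssig k; have hd := hausdorff_dual hBcompact; have hFd := hausdorff_prod hF hd.
apply: Ck_pair => //.
  apply: smooth_gtc_vec => l.
  apply: (@Ck_comp _ l _ _ _ O setT sig fst) => //; first exact: openT.
  by apply: Ck_lin => //; exact: continuous_fst.
apply: smooth_gtc_form => // l.
apply: (@Ck_comp _ l _ _ _ O setT sig snd) => //; first exact: openT.
by apply: Ck_lin => //; exact: continuous_snd.
Qed.

End Domain.
End Change.

Lemma subspace_valP (R : realType) (V : lmodType R) (W : Defs.subspace V) (v : subspace_type W) :
  W (subspace_val v).
Proof. by case: v => v vP /=; apply/asboolP. Qed.

Lemma subspace_val_inj (R : realType) (V : lmodType R) (W : Defs.subspace V) :
  injective (@subspace_val R V W).
Proof. exact: val_inj. Qed.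

(** * Trivializations and smooth sections of a subbundle *)

Section DiracBundle.
Context (R : realType) (F : tvsType R) (M : manifold F) (B : bornology F).
Hypothesis hF : hausdorff_space F.
Hypothesis fF : first_countable0 F.
Hypothesis hBcompact : forall K : set F, compact K -> born_set B K.
Hypothesis hBendo : forall T : F -> F, linear T -> continuous T ->
  forall b, born_set B b -> born_set B (T @` b).
Context (D : subbundle (gtangent M B)).
Implicit Types (c d e : chart F M) (x : M).

Let hFd : hausdorff_space (F * dual B)%type.
Proof. exact: hausdorff_prod hF (hausdorff_dual hBcompact). Qed.

Let iota : smodel D -> (F * dual B)%type := @sincl _ _ _ _ D.

Lemma smodel_hausdorff : hausdorff_space (smodel D).
Proof. exact: (embedding_hausdorff (@sincl_inj _ _ _ _ D) (@sincl_nbhs _ _ _ _ D) hFd). Qed.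

Lemma gtangent_inj (i : bidx (gtangent M B)) x : bdom i x ->
  injective (@btriv _ _ _ (gtangent M B) i x).
Proof.
case: i => c ac /= cx [p a] [q b] [/= e1 e2].
have lc := tcoord_inv_linear hF ac cx; have cc := tcoord_inv_continuous ac cx.
congr (_, _); first by rewrite -(tcoordK hF p ac cx) e1 tcoordK.
apply: dual_ext => v; rewrite -(tcoordK hF v ac cx).
by rewrite -(pullE a (tcoord c x v) lc cc) -(pullE b (tcoord c x v) lc cc) /pull e2.
Qed.

Lemma gtangent_surj (i : bidx (gtangent M B)) x (p : (F * dual B)%type) : bdom i x ->
  exists q : bfib (gtangent M B) x, btriv i q = p.
Proof.
case: i p => c ac [p a] /= cx.
have lc := tcoord_linear hF ac cx; have cc := tcoord_continuous ac cx.
exists (tcoord_inv c x p, pull a (tcoord c x)); congr (_, _).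
  exact: tcoord_invK.
by apply: to_dual_id => v; rewrite /= pullE // tcoord_invK.
Qed.

(** The [xget] in the trivialization succeeds because v lies in the subbundle, which [st_fib]
    translates into membership in the range of [iota]. *)
Lemma sub_btrivE (S : bidx (bundle_of_sub D)) x (v : bfib (bundle_of_sub D) x) :
  bdom S x -> iota (btriv S v) = st_fun S x (btriv (st_idx S) (subspace_val v)).
Proof.
move=> Sx.
have /(st_fib _ Sx)[k kE] := subspace_valP v.
exact: (@xgetPex _ 0 [set k : smodel D | iota k = st_fun S x (btriv (st_idx S) (subspace_val v))]
  (ex_intro _ k kE)).
Qed.

Lemma sub_btriv_inv (S : bidx (bundle_of_sub D)) x (v : bfib (bundle_of_sub D) x) :
  bdom S x -> btriv (st_idx S) (subspace_val v) = st_inv S x (iota (btriv S v)).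
Proof. by move=> Sx; rewrite sub_btrivE // st_funK. Qed.

Lemma sub_idx_dom (S : bidx (bundle_of_sub D)) x : bdom S x -> bdom (st_idx S) x.
Proof. exact: st_sub. Qed.

Lemma sub_btriv_linear (S : bidx (bundle_of_sub D)) x : bdom S x ->
  linear (@btriv _ _ _ (bundle_of_sub D) S x).
Proof.
move=> Sx a v w; apply: (@sincl_inj _ _ _ _ D).
rewrite sincl_linear -!/(iota _) !sub_btrivE //.
have -> : subspace_val (a *: v + w) = a *: subspace_val v + subspace_val w by [].
by rewrite (gtangent_linear hF (sub_idx_dom Sx)) st_linear.
Qed.

Lemma sub_btriv_bij (S : bidx (bundle_of_sub D)) x : bdom S x ->
  bijective (@btriv _ _ _ (bundle_of_sub D) S x).
Proof.
move=> Sx.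
have inj : injective (@btriv _ _ _ (bundle_of_sub D) S x).
  move=> v w /(congr1 iota); rewrite !sub_btrivE // => /(can_inj (st_funK Sx)).
  by move=> /(gtangent_inj (sub_idx_dom Sx))/subspace_val_inj.
have surj k : exists v, @btriv _ _ _ (bundle_of_sub D) S x v = k.
  have [q qE] := gtangent_surj (st_inv S x (iota k)) (sub_idx_dom Sx).
  have Dq : D x q by apply/(st_fib _ Sx); exists k; rewrite qE st_invK.
  have mq : q \in subspace_pred (D x) by apply/asboolP.
  exists (SubspaceElt mq); apply: (@sincl_inj _ _ _ _ D).
  by rewrite -!/(iota _) sub_btrivE // -[subspace_val _]/q qE st_invK.
have cK : cancel (@btriv_inv _ _ _ (bundle_of_sub D) S x) (@btriv _ _ _ (bundle_of_sub D) S x).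
  by move=> k; exact: (@xgetPex _ 0 [set v | @btriv _ _ _ (bundle_of_sub D) S x v = k] (surj k)).
by exists (@btriv_inv _ _ _ (bundle_of_sub D) S x) => // v; apply: inj; rewrite cK.
Qed.

Lemma sub_btriv_invK (S : bidx (bundle_of_sub D)) x k : bdom S x ->
  btriv S (btriv_inv (L := bundle_of_sub D) S x k) = k.
Proof.
move=> /sub_btriv_bij[g gK Kg].
by apply: (@xgetPex _ 0 [set v | @btriv _ _ _ (bundle_of_sub D) S x v = k]); exists (g k); exact: Kg.
Qed.

Lemma sub_open (S : bidx (bundle_of_sub D)) : open (bdom S).
Proof. exact: st_open. Qed.

Lemma Ck_sincl k (E : tvsType R) (U : set E) (f : E -> smodel D) :
  hausdorff_space E -> open U -> Ck k U f -> Ck k U (fun p => iota (f p)).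
Proof.
move=> hE oU Cf.
apply: (@Ck_comp _ k _ _ _ U setT f iota) => //.
- exact: smodel_hausdorff.
- exact: openT.
- apply: Ck_lin => //; first exact: sincl_linear.
  exact: (embedding_continuous (@sincl_nbhs _ _ _ _ D)).
Qed.

(** A straightening S starts from a chart of its own. The section is therefore first written in that
    chart, by [st_inv] after the inclusion, and then carried to the given chart d by [gtc]. Since S
    exists only near a point, the argument is local. *)
Lemma smooth_subspace_val (s : section (bundle_of_sub D)) : smooth_section s ->
  smooth_section (L := gtangent M B) (fun x => subspace_val (s x)).
Proof.
move=> ss [d ad] c ac k; apply: Ck_local => y /cset_out[cx dx yE].
set x := cinv c y in cx dx yE; simpl in dx.
have [S Sx] := sstraight D x.
have SU : st_dom S `<=` bdom (st_idx S) := @st_sub _ _ _ _ _ _ _ S.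
set O := cset c (st_dom S `&` cdom d).
have oO : open O by apply: cset_open; apply: openI; [exact: st_open|exact: cdom_open].
pose i := st_idx S; have ai := proj2_sig i.
have Oi p : O p -> cset c (cdom (proj1_sig i) `&` cdom d) p.
  by move=> /cset_out[cp [Sp dp] <-]; apply: cset_in => //; split => //; exact: SU.
have hFK := hausdorff_prod hF smodel_hausdorff.
pose sig y := st_inv S (cinv c y) (iota (btriv (b := bundle_of_sub D) S (s (cinv c y)))).
have ssig : smooth_on O sig.
  move=> l.
  have oS : open [set p : (F * (F * dual B))%type | cset c (st_dom S) p.1].
    have -> : [set p : (F * (F * dual B))%type | cset c (st_dom S) p.1] = cset c (st_dom S) `*` setT.
      by apply/seteqP; split => p //= [].
    by apply: openXT; apply: cset_open; exact: st_open.
  apply: (@Ck_comp _ l _ _ _ O [set p : (F * (F * dual B))%type | cset c (st_dom S) p.1]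
    (fun y => (y, iota (btriv (b := bundle_of_sub D) S (s (cinv c y)))))
    (fun p => st_inv S (cinv c p.1) p.2)) => //.
  - exact: hausdorff_prod.
  - by move=> p /cset_out[cp [Sp _] <-]; exact: cset_in.
  - apply: Ck_pair => //; first by apply: Ck_lin => // z; exact: cvg_id.
    apply: Ck_sincl => //.
    apply: Ck_sub (ss S c ac l); first by apply: cset_open; exact: st_open.
    by move=> p /cset_out[cp [Sp _] <-]; exact: cset_in.
  - exact: (@st_inv_smooth _ _ _ _ _ _ _ S c ac l).
have sid : smooth_on O (fun y : F => y).
  by move=> l; apply: Ck_lin => // z; exact: cvg_id.
exists O, (fun p => gtc (proj1_sig i) d (cinv c p) (sig p)); split => //.
- by rewrite -yE; apply: cset_in.
- exact: (smooth_gtc hF hBcompact hBendo hF oO sid ac ai ad Oi fF ssig).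
- move=> p /cset_out[cp [Sp dp] _].
  rewrite /sig -sub_btriv_inv //.
  exact: (btriv_gtc hF (i := i) (j := exist _ d ad) _ (SU _ Sp) dp).
Qed.

(** Needed because closure of a Dirac structure gives smoothness of a bracket only as a section of
    the ambient bundle. *)
Lemma smooth_section_sub (s : section (bundle_of_sub D)) :
  smooth_section (L := gtangent M B) (fun x => subspace_val (s x)) -> smooth_section s.
Proof.
move=> ss S c ac k.
have oO : open (cset c (st_dom S)) by apply: cset_open; exact: st_open.
have SU : st_dom S `<=` bdom (st_idx S) := @st_sub _ _ _ _ _ _ _ S.
apply: (Ck_embedding (@sincl_linear _ _ _ _ D) (@sincl_inj _ _ _ _ D)
  (@sincl_nbhs _ _ _ _ D) (@sincl_closed _ _ _ _ D) hFd oO).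
apply: (@Ck_eq _ k _ _ _ (fun y => st_fun S (cinv c y)
    (btriv (st_idx S) (subspace_val (s (cinv c y)))))) => //.
  by move=> y /cset_out[_ Sy _]; exact: sub_btrivE.
have oS : open [set p : (F * (F * dual B))%type | cset c (st_dom S) p.1].
  have -> : [set p : (F * (F * dual B))%type | cset c (st_dom S) p.1] = cset c (st_dom S) `*` setT.
    by apply/seteqP; split => p //= [].
  exact: openXT.
apply: (@Ck_comp _ k _ _ _ (cset c (st_dom S)) [set p : (F * (F * dual B))%type | cset c (st_dom S) p.1]
  (fun y => (y, btriv (st_idx S) (subspace_val (s (cinv c y)))))
  (fun p => st_fun S (cinv c p.1) p.2)) => //.
- exact: hausdorff_prod.
- apply: Ck_pair => //; first by apply: Ck_lin => // z; exact: cvg_id.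
  apply: Ck_sub (ss (st_idx S) c ac k).
    by apply: cset_open; exact: gtangent_open.
  by move=> p /cset_out[cp Sp <-]; apply: cset_in => //; exact: SU.
- exact: (@st_fun_smooth _ _ _ _ _ _ _ S c ac k).
Qed.

End DiracBundle.

(** * The algebroid of a Dirac structure *)

Section DiracAlgebroid.
Context (R : realType) (F : tvsType R) (M : manifold F) (B : bornology F).
Hypothesis hF : hausdorff_space F.
Hypothesis fF : first_countable0 F.
Hypothesis hBcompact : forall K : set F, compact K -> born_set B K.
Hypothesis hBendo : forall T : F -> F, linear T -> continuous T ->
  forall b, born_set B b -> born_set B (T @` b).
Context (D : subbundle (gtangent M B)).
Implicit Types (c d e : chart F M) (x : M).

Let hFd : hausdorff_space (F * dual B)%type.
Proof. exact: hausdorff_prod hF (hausdorff_dual hBcompact). Qed.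

Let hK : hausdorff_space (smodel D).
Proof. exact: smodel_hausdorff. Qed.

Let hFK : hausdorff_space (F * smodel D)%type.
Proof. exact: hausdorff_prod. Qed.

Let iota : smodel D -> (F * dual B)%type := @sincl _ _ _ _ D.

Let dom (S : bidx (bundle_of_sub D)) c (A : set M) : set (F * smodel D)%type :=
  [set p | (c @` (cdom c `&` st_dom S `&` A)) p.1].

Let domP S c A p : dom S c A p ->
  [/\ cdom c (cinv c p.1), st_dom S (cinv c p.1), A (cinv c p.1) & c (cinv c p.1) = p.1].
Proof. by rewrite /dom /= => -[x [[cx Sx] Ax] <-]; rewrite cfunK. Qed.

Let dom_open S c A : open A -> open (dom S c A).
Proof.
move=> oA; have -> : dom S c A = cset c (st_dom S `&` A) `*` setT.
  by rewrite /dom -setIA; apply/seteqP; split => p //= [].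
by apply: openXT; apply: cset_open; apply: openI => //; exact: st_open.
Qed.

Let slice_open (S : bidx (bundle_of_sub D)) c :
  open [set p : (F * (F * dual B))%type | cset c (st_dom S) p.1].
Proof.
have -> : [set p : (F * (F * dual B))%type | cset c (st_dom S) p.1] = cset c (st_dom S) `*` setT.
  by apply/seteqP; split => p //= [].
by apply: openXT; apply: cset_open; exact: st_open.
Qed.

Let model_inv (S : bidx (bundle_of_sub D)) c (p : (F * smodel D)%type) : (F * dual B)%type :=
  st_inv S (cinv c p.1) (iota p.2).

Let model_inv_smooth (S : bidx (bundle_of_sub D)) c (A : set M) : atlas M c -> open A ->
  smooth_on (dom S c A) (model_inv S c).
Proof.
move=> ac oA l; have oO := @dom_open S c A oA.
apply: (@Ck_comp _ l _ _ _ (dom S c A) [set p : (F * (F * dual B))%type | cset c (st_dom S) p.1]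
  (fun p => (p.1, iota p.2)) (fun p => st_inv S (cinv c p.1) p.2)) => //.
- exact: hausdorff_prod.
- by move=> p /domP[cp Sp _ <-]; exact: cset_in.
- apply: Ck_pair => //; first by apply: Ck_lin => //; exact: continuous_fst.
  by apply: Ck_sincl => //; apply: Ck_lin => //; exact: continuous_snd.
- exact: (@st_inv_smooth _ _ _ _ _ _ _ S c ac l).
Qed.

Let model_invE (S : bidx (bundle_of_sub D)) c A p : dom S c A p ->
  btriv (st_idx S) (subspace_val (btriv_inv (L := bundle_of_sub D) S (cinv c p.1) p.2)) =
  model_inv S c p.
Proof. by move=> /domP[_ Sp _ _]; rewrite sub_btriv_inv // sub_btriv_invK. Qed.

Let dom_idx (S : bidx (bundle_of_sub D)) c (A : set M) p : dom S c A p ->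
  cset c (cdom (proj1_sig (st_idx S)) `&` A) p.1.
Proof.
move=> /domP[cp Sp Ap <-]; apply: cset_in => //; split => //.
exact: (@sub_idx_dom _ _ _ _ D S).
Qed.

(** The anchor sees only the vector half of the change of trivialization, a derivative of a
    transition map and thus jointly smooth. *)
Lemma dirac_pr_bundle_map :
  is_bundle_map (L := bundle_of_sub D) (L' := tangent M) (@dirac_pr R F M B D).
Proof.
split; first by [].
move=> S [d ad] c ac k.
have oO := @dom_open S c (cdom d) (cdom_open d).
have ai := proj2_sig (st_idx S).
have sfst : smooth_on (dom S c (cdom d)) (fun p : F * smodel D => p.1).
  by move=> l; apply: Ck_lin => //; exact: continuous_fst.
have sxi : smooth_on (dom S c (cdom d)) (fun p => (model_inv S c p).1).
  move=> l; apply: (@Ck_comp _ l _ _ _ (dom S c (cdom d)) setT (model_inv S c) fst) => //.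
  - exact: openT.
  - by apply: model_inv_smooth => //; exact: cdom_open.
  - by apply: Ck_lin => //; exact: continuous_fst.
apply: (Ck_eq oO _ (smooth_gtc_vec hF hFK oO sfst ac ai ad (@dom_idx S c (cdom d)) sxi k)).
move=> p Op; have [cp Sp dp _] := domP Op.
rewrite -(model_invE Op).
have := btriv_gtc hF (i := st_idx S) (j := exist _ d ad)
  (subspace_val (btriv_inv (L := bundle_of_sub D) S (cinv c p.1) p.2)) (st_sub Sp) dp.
by move/(congr1 fst).
Qed.

(** The changes of trivialization of D live on F * smodel D and involve pull-backs of forms, which
    are continuous along sequences; first countability of the model turns this into continuity. *)
Lemma sub_is_vbundle : first_countable0 (smodel D) -> is_vbundle (bundle_of_sub D).
Proof.
move=> fK; split => //.
- split; first by move=> S; exact: st_open.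
  exact: sstraight.
- by move=> S x Sx; split; [exact: sub_btriv_linear|exact: sub_btriv_bij].
move=> S S' c ac k.
have oO := @dom_open S c (st_dom S') (@st_open _ _ _ _ _ _ _ S').
have ai := proj2_sig (st_idx S); have ai' := proj2_sig (st_idx S').
have sfst : smooth_on (dom S c (st_dom S')) (fun p : F * smodel D => p.1).
  by move=> l; apply: Ck_lin => //; exact: continuous_fst.
have Opi p : dom S c (st_dom S') p ->
    cset c (cdom (proj1_sig (st_idx S)) `&` cdom (proj1_sig (st_idx S'))) p.1.
  move=> /dom_idx/cset_out[cp [jp Sp] <-]; apply: cset_in => //; split => //.
  exact: (@sub_idx_dom _ _ _ _ D S').
have fFK := first_countable_prod fF fK.
have ssig := model_inv_smooth S ac (@st_open _ _ _ _ _ _ _ S').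
have sg := smooth_gtc hF hBcompact hBendo hFK oO sfst ac ai ai' Opi fFK ssig.
apply: (Ck_embedding (@sincl_linear _ _ _ _ D) (@sincl_inj _ _ _ _ D)
  (@sincl_nbhs _ _ _ _ D) (@sincl_closed _ _ _ _ D) hFd oO).
apply: (@Ck_eq _ k _ _ _ (fun p => st_fun S' (cinv c p.1)
   (gtc (proj1_sig (st_idx S)) (proj1_sig (st_idx S')) (cinv c p.1) (model_inv S c p)))) => //.
  move=> p Op; have [cp Sp Sp' _] := domP Op.
  rewrite sub_btrivE // -(model_invE Op).
  congr (st_fun S' _ _).
  by apply: btriv_gtc => //; exact: sub_idx_dom.
apply: (@Ck_comp _ k _ _ _ (dom S c (st_dom S')) [set p : (F * (F * dual B))%type | cset c (st_dom S') p.1]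
  (fun p => (p.1, gtc (proj1_sig (st_idx S)) (proj1_sig (st_idx S')) (cinv c p.1) (model_inv S c p)))
  (fun p => st_fun S' (cinv c p.1) p.2)) => //.
- exact: hausdorff_prod.
- by move=> p /domP[cp Sp Sp' <-]; exact: cset_in.
- exact: Ck_pair.
- exact: (@st_fun_smooth _ _ _ _ _ _ _ S' c ac k).
Qed.

(** The bracket has to be a function on all sections, smooth or not. The default 0 is taken only
    where the Courant bracket leaves D, which does not occur for smooth sections. *)
Definition dirac_bracket (s t : section (bundle_of_sub D)) : section (bundle_of_sub D) :=
  fun x => xget 0 [set p : subspace_type (D x) |
    subspace_val p = courant (fun y => subspace_val (s y)) (fun y => subspace_val (t y)) x].

Hypothesis hD : is_dirac D.

Definition dirac_section (s : section (gtangent M B)) :=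
  smooth_section s /\ forall x, D x (s x).

Lemma dirac_section_val (s : section (bundle_of_sub D)) :
  smooth_section s -> dirac_section (fun x => subspace_val (s x)).
Proof.
move=> ss; split; first exact: smooth_subspace_val.
by move=> x; exact: subspace_valP.
Qed.

Lemma dirac_pairing s t x : dirac_section s -> dirac_section t ->
  pairing (s x) (t x) = 0.
Proof. by move=> [_ Ds] [_ Dt]; have [H _] := hD; exact: (proj1 (H x (s x)) (Ds x)). Qed.

Lemma dirac_courant s t x : dirac_section s -> dirac_section t ->
  courant s t x = dorfman s t x.
Proof.
move=> Ps Pt; apply: courant_dorfman => //; [by case: Ps|by case: Pt|].
by move=> y; exact: dirac_pairing.
Qed.

Lemma dirac_dorfman s t : dirac_section s -> dirac_section t -> dirac_section (dorfman s t).
Proof. by move=> [ss Ds] [st Dt]; have [_ H] := hD; exact: H. Qed.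

Lemma dirac_bracketE (s t : section (bundle_of_sub D)) x :
  dirac_section (fun y => subspace_val (s y)) ->
  dirac_section (fun y => subspace_val (t y)) ->
  subspace_val (dirac_bracket s t x) =
  dorfman (fun y => subspace_val (s y)) (fun y => subspace_val (t y)) x.
Proof.
move=> Ps Pt; have [_ Dd] := dirac_dorfman Ps Pt.
have mp : dorfman (fun y => subspace_val (s y)) (fun y => subspace_val (t y)) x
    \in subspace_pred (D x) by apply/asboolP.
rewrite -(dirac_courant x Ps Pt).
apply: (@xgetPex _ 0 [set p : subspace_type (D x) |
    subspace_val p = courant (fun y => subspace_val (s y)) (fun y => subspace_val (t y)) x]).
by exists (SubspaceElt mp); rewrite /= dirac_courant.
Qed.

Lemma dirac_bracket_val s t : smooth_section s -> smooth_section t ->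
  (fun y => subspace_val (dirac_bracket s t y)) =
  dorfman (fun y => subspace_val (s y)) (fun y => subspace_val (t y)) :> section (gtangent M B).
Proof.
move=> /dirac_section_val Ps /dirac_section_val Pt; apply: functional_extensionality_dep => x.
exact: dirac_bracketE.
Qed.

Lemma dirac_bracket_smooth s t : smooth_section s -> smooth_section t ->
  smooth_section (dirac_bracket s t).
Proof.
move=> ss st; apply: smooth_section_sub => //; rewrite dirac_bracket_val //.
by have [] := dirac_dorfman (dirac_section_val ss) (dirac_section_val st).
Qed.

Lemma sub_section_comb (k : R) (s t : section (bundle_of_sub D)) :
  smooth_section s -> smooth_section t -> smooth_section (fun y => k *: s y + t y).
Proof.
apply: smooth_section_comb => //; [exact: sub_open|exact: sub_btriv_linear].
Qed.

Lemma subspace_comb x (k : R) (p q : bfib (gtangent M B) x) :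
  D x p -> D x q -> D x (k *: p + q).
Proof.
move=> Dp Dq; have [_ h] := subspace_closed (D x).
have mp : p \in ((fun v => `[< D x v >]) : {pred _}) by apply/asboolP.
have mq : q \in ((fun v => `[< D x v >]) : {pred _}) by apply/asboolP.
by have /asboolP := h k p q mp mq.
Qed.

Lemma dirac_comb (k : R) (s t : section (gtangent M B)) :
  dirac_section s -> dirac_section t -> dirac_section (fun x => k *: s x + t x).
Proof.
move=> [ss Ds] [st Dt]; split; last by move=> x; exact: subspace_comb.
apply: smooth_section_comb => //; [exact: gtangent_open|exact: gtangent_linear].
Qed.

Lemma dirac_dorfman_self s x : dirac_section s ->
  (dorfman s s x : (F * dual B)%type) = 0.
Proof. by move=> Ps; rewrite -(dirac_courant x Ps Ps); exact: courant_self. Qed.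

(** Polarization: the bracket of s + t with itself vanishes. *)
Lemma dirac_dorfman_anti s t x : dirac_section s -> dirac_section t ->
  (dorfman t s x : (F * dual B)%type) = - (dorfman s t x : (F * dual B)%type).
Proof.
move=> Ps Pt; have Pr := dirac_comb 1 Ps Pt.
have [[ss _] [st _] [sr _]] := And3 Ps Pt Pr.
have := dirac_dorfman_self x Pr.
rewrite (dorfman_combl hF hBcompact x ss st sr sr (fun=> erefl)).
rewrite (dorfman_combr hF hBcompact x ss st ss sr (fun=> erefl)).
rewrite (dorfman_combr hF hBcompact x ss st st sr (fun=> erefl)).
rewrite !scale1r !dirac_dorfman_self // add0r addr0 => /eqP.
by rewrite addr_eq0 => /eqP ->; rewrite opprK.
Qed.

(** Antisymmetry, applied to the inner bracket of u and s and to the outer bracket of u with [s, t],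
    turns the Leibniz form of the identity into the cyclic one. *)
Lemma dirac_dorfman_cyclic s t u x :
  dirac_section s -> dirac_section t -> dirac_section u ->
  (dorfman s (dorfman t u) x : (F * dual B)%type) + dorfman t (dorfman u s) x
   + dorfman u (dorfman s t) x = 0.
Proof.
move=> Ps Pt Pu.
have Ptu := dirac_dorfman Pt Pu; have Pst := dirac_dorfman Ps Pt.
have Psu := dirac_dorfman Ps Pu; have Pus := dirac_dorfman Pu Ps.
have J := dorfman_jacobi hF hBcompact x (proj1 Ps) (proj1 Pt) (proj1 Pu)
  (proj1 Ptu) (proj1 Pst) (proj1 Psu).
(* The negative of a section is written as -2 times it plus itself, to fit the shape k s + t that
   [dorfman_combr] handles. *)
have E y : (dorfman u s y : (F * dual B)%type) =
    (-2) *: (dorfman s u y : (F * dual B)%type) + dorfman s u y.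
  rewrite (dirac_dorfman_anti y Ps Pu) -[X in _ = _ + X]scale1r -scalerDl.
  by rewrite (_ : -2 + 1 = -1 :> R) ?scaleN1r //; ring.
have e1 := dorfman_combr hF hBcompact x (proj1 Psu) (proj1 Psu) (proj1 Pt) (proj1 Pus) E.
rewrite J e1 (dirac_dorfman_anti x Pst Pu).
rewrite -[X in (-2) *: _ + X]scale1r -scalerDl (_ : -2 + 1 = -1 :> R); last by ring.
by rewrite scaleN1r addrK addrN.
Qed.

Lemma dirac_is_lie_bracket : is_lie_bracket dirac_bracket.
Proof.
split.
- exact: dirac_bracket_smooth.
- move=> k s t u ss st su.
  have sr := sub_section_comb k ss st.
  have Ps := dirac_section_val ss; have Pt := dirac_section_val st.
  have Pu := dirac_section_val su; have Pr := dirac_section_val sr.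
  split=> x; apply: subspace_val_inj.
    apply: (etrans (dirac_bracketE x Pr Pu)).
    apply: (etrans (dorfman_combl hF hBcompact (k := k) x (proj1 Ps) (proj1 Pt) (proj1 Pu)
      (proj1 Pr) (fun=> erefl))).
    by rewrite -(dirac_bracketE x Ps Pu) -(dirac_bracketE x Pt Pu).
  apply: (etrans (dirac_bracketE x Pu Pr)).
  apply: (etrans (dorfman_combr hF hBcompact (k := k) x (proj1 Ps) (proj1 Pt) (proj1 Pu)
    (proj1 Pr) (fun=> erefl))).
  by rewrite -(dirac_bracketE x Pu Ps) -(dirac_bracketE x Pu Pt).
- move=> s ss x; apply: subspace_val_inj.
  have Ps := dirac_section_val ss.
  by apply: (etrans (dirac_bracketE x Ps Ps)); exact: dirac_dorfman_self.
- move=> s t u ss st su x; apply: subspace_val_inj.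
  have Ps := dirac_section_val ss; have Pt := dirac_section_val st.
  have Pu := dirac_section_val su.
  have cyc := dirac_dorfman_cyclic x Ps Pt Pu.
  have E (a b c : section (bundle_of_sub D)) (sa : smooth_section a) (sb : smooth_section b) (sc : smooth_section c) :
      subspace_val (dirac_bracket a (dirac_bracket b c) x) =
      dorfman (fun y => subspace_val (a y))
       (dorfman (fun y => subspace_val (b y)) (fun y => subspace_val (c y))) x.
    rewrite dirac_bracketE; first by rewrite dirac_bracket_val.
      exact: dirac_section_val.
    exact/dirac_section_val/dirac_bracket_smooth.
  by rewrite -(E s t u) // -(E t u s) // -(E u s t) // in cyc; exact: cyc.
Qed.

Lemma dirac_algebroid_axioms : algebroid_axioms dirac_bracket (@dirac_pr R F M B D).
Proof.
split.
- exact: dirac_pr_bundle_map.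
- move=> s t ss st x.
  by rewrite /anchor_section /dirac_pr (dirac_bracketE x (dirac_section_val ss) (dirac_section_val st)).
- move=> f s t sf ss st x; apply: subspace_val_inj.
  have sr : smooth_section (fun y => f y *: t y).
    by apply: smooth_section_scale => //; [exact: sub_open|exact: sub_btriv_linear].
  have Ps := dirac_section_val ss; have Pt := dirac_section_val st.
  have Pr := dirac_section_val sr.
  apply: (etrans (dirac_bracketE x Ps Pr)).
  apply: (etrans (dorfman_scaler hF hBcompact x sf (proj1 Ps) (proj1 Pt) (proj1 Pr) (fun=> erefl))).
  by rewrite -(dirac_bracketE x Ps Pt).
Qed.

End DiracAlgebroid.

(** The model of D is a closed subspace of F * F'_B, and the dual of a Fréchet space need not be
    metrizable. The Fréchet property therefore appears in the last clause as a condition on that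
    model, while the Lie bracket and the anchor axioms are asserted unconditionally. *)
Theorem mainTheorem1 (R : realType) (F : tvsType R) (hF : frechet F)
    (M : manifold F) (B : bornology F)
    (hBcompact : forall K : set F, compact K -> born_set B K)
    (hBendo : forall T : F -> F, linear T -> continuous T ->
       forall b, born_set B b -> born_set B (T @` b))
    (D : subbundle (gtangent M B)) (hD : is_dirac D) :
  exists br : section (bundle_of_sub D) -> section (bundle_of_sub D) ->
              section (bundle_of_sub D),
    [/\ forall s t : section (bundle_of_sub D),
          smooth_section s -> smooth_section t ->
          forall x : M,
            subspace_val (br s t x)
            = courant (fun y => subspace_val (s y))
                      (fun y => subspace_val (t y)) x,
        is_lie_bracket br,
        algebroid_axioms br (@dirac_pr R F M B D) &
        frechet (smodel D) ->
          is_frechet_lie_algebroid br (@dirac_pr R F M B D)].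
Proof.
have [hausF fcF _] := hF.
have lieD := dirac_is_lie_bracket hausF fcF hBcompact hBendo hD.
have axD := dirac_algebroid_axioms hausF fcF hBcompact hBendo hD.
exists (@dirac_bracket R F M B D); split => //.
  move=> s t ss st x.
  have Ps := dirac_section_val hausF fcF hBcompact hBendo ss.
  have Pt := dirac_section_val hausF fcF hBcompact hBendo st.
  rewrite (dirac_courant hausF hBcompact hD x Ps Pt).
  exact: (dirac_bracketE hausF hBcompact hD x Ps Pt).
move=> frK; split => //; split => //.
by apply: sub_is_vbundle => //; case: frK.
Qed.
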